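(* Assume that conditions (A1)–(A4) stated in the context hold. Then for any Borel probability measure $\nu$ on $(0,1)$ the Markov chain $(X^\nu_n)$ is asymptotically stable. That is, there is a Borel probability measure $\mu_*$ on $(0,1)$ with $P\mu_*=\mu_*$ such that for every Borel probability measure $\nu$ on $(0,1)$ the laws $P^n\nu$ of $X^\nu_n$ converge weakly to $\mu_*$ as $n\to\infty$.
   Context: Let $x_0,y_0$ be real numbers, $a_0=\frac{y_0}{x_0}$, $a_1=\frac{1-y_0}{1-x_0}$. Define homeomorphisms $f_0,f_1:[0,1]\to[0,1]$ by $f_0(x)=a_0x$ for $x\le x_0$, $f_0(x)=a_1(x-1)+1$ for $x>x_0$, and $f_1(x)=1-f_0(1-x)$. Let $p_0,p_1:[0,1]\to\mathbb{R}$ be positive functions with $p_0(x)+p_1(x)=1$ for all $x$. Put $\Lambda_0=p_0(0)\log a_0+p_1(0)\log a_1$ and $\Lambda_1=p_0(1)\log a_1+p_1(1)\log a_0$. Conditions: (A1) $\frac12<x_0<1$ and $\frac12\le y_0<x_0$; (A2) $p_0,p_1$ are Dini continuous, i.e. with the modulus of continuity $\beta(t)=\max_{i=0,1}\sup\{|p_i(x)-p_i(x+h)|: x\in(0,1),\ |h|\le t,\ x+h\in[0,1]\}$ one has $\sum_n\beta(Ct^n)<\infty$ for every $C\ge0$ and $0\le t<1$; (A3) $0<p_i(x)<1$ for $x\in[0,1]$, $i=0,1$; (A4) $\Lambda_0>0$ and $\Lambda_1>0$. For a Borel probability measure $\nu$ on $(0,1)$, $(X^\nu_n)_{n\ge0}$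 denotes the Markov chain with state space the open interval $(0,1)$, initial distribution $\nu$ and transition probabilities $p(x,\cdot)=p_0(x)\delta_{f_0(x)}+p_1(x)\delta_{f_1(x)}$, $x\in(0,1)$. The operator $P$ on Borel measures on $(0,1)$ is $P\mu(A)=\int_{f_0^{-1}(A)}p_0\,d\mu+\int_{f_1^{-1}(A)}p_1\,d\mu$ for Borel $A\subseteq(0,1)$, so the law of $X_n^\nu$ is $P^n\nu$. Weak convergence is convergence of integrals of bounded continuous functions on $(0,1)$. *)

(* Defs.v *)
From HB Require Import structures.
From mathcomp Require Import all_boot all_order all_algebra.
From mathcomp Require Import all_classical all_reals all_analysis.

Set Implicit Arguments.
Unset Strict Implicit.
Unset Printing Implicit Defensive.

Import Order.TTheory GRing.Theory Num.Theory.
Import numFieldNormedType.Exports.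

Local Open Scope classical_set_scope.
Local Open Scope ring_scope.

(* Functions on [0, 1] are represented by total functions R -> R of which only
   the restriction to [0, 1] is used. *)

Definition slope0 (R : realType) (x0 y0 : R) : R := y0 / x0.

Definition slope1 (R : realType) (x0 y0 : R) : R := (1 - y0) / (1 - x0).

Definition map0 (R : realType) (x0 y0 x : R) : R :=
  if x <= x0 then slope0 x0 y0 * x else slope1 x0 y0 * (x - 1) + 1.

Definition map1 (R : realType) (x0 y0 x : R) : R := 1 - map0 x0 y0 (1 - x).

Definition lyapunov0 (R : realType) (x0 y0 : R) (p0 p1 : R -> R) : R :=
  p0 0 * ln (slope0 x0 y0) + p1 0 * ln (slope1 x0 y0).

Definition lyapunov1 (R : realType) (x0 y0 : R) (p0 p1 : R -> R) : R :=
  p0 1 * ln (slope1 x0 y0) + p1 1 * ln (slope0 x0 y0).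

Definition oscillation (R : realType) (p : R -> R) (t : R) : \bar R :=
  ereal_sup [set r : \bar R | exists x h : R,
    [/\ 0 < x < 1, `|h| <= t, 0 <= x + h <= 1 & r = (`|p x - p (x + h)|)%:E]].

Definition modulus (R : realType) (p0 p1 : R -> R) (t : R) : \bar R :=
  maxe (oscillation p0 t) (oscillation p1 t).

Definition dini (R : realType) (p0 p1 : R -> R) : Prop :=
  forall C t : R, 0 <= C -> 0 <= t < 1 ->
    (\sum_(0 <= n <oo) modulus p0 p1 (C * t ^+ n) < +oo)%E.

(* Borel measures on (0, 1) are identified with the Borel measures on R that
   are carried by (0, 1). *)
Definition carried_by_01 (R : realType)
    (mu : probability (measurableTypeR R) R) : Prop :=
  mu (`]0, 1[%classic : set R) = 1%E.

(* The library integral is defined with respect to an arbitrary set function,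
   so the operator can be iterated without bundling a proof that its value is
   again a measure. The n-th iterate at nu is the law at time n of the Markov
   chain that starts from nu and jumps from x to map0 x with probability p0 x
   and to map1 x with probability p1 x. *)
Definition markov_operator (R : realType) (x0 y0 : R) (p0 p1 : R -> R)
    (mu : set (measurableTypeR R) -> \bar R) (A : set (measurableTypeR R)) :
    \bar R :=
  (\int[mu]_(x in `]0%R, 1%R[%classic `&` map0 x0 y0 @^-1` A) (p0 x)%:E +
   \int[mu]_(x in `]0%R, 1%R[%classic `&` map1 x0 y0 @^-1` A) (p1 x)%:E)%E.

Definition weakly_converges_01 (R : realType)
    (mu_ : nat -> set (measurableTypeR R) -> \bar R)
    (mu : set (measurableTypeR R) -> \bar R) : Prop :=
  forall g : R -> R,
    {within `]0, 1[%classic, continuous g} ->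
    (exists M : R, forall x : R, 0 < x < 1 -> `|g x| <= M) ->
    (\int[mu_ n]_(x in `]0%R, 1%R[%classic) (g x)%:E)%E @[n --> \oo] -->
    (\int[mu]_(x in `]0%R, 1%R[%classic) (g x)%:E)%E.

Definition asymptotically_stable (R : realType)
    (P : (set (measurableTypeR R) -> \bar R) ->
         set (measurableTypeR R) -> \bar R) : Prop :=
  exists mu : probability (measurableTypeR R) R,
    [/\ carried_by_01 mu,
        (forall A : set (measurableTypeR R), measurable A -> P mu A = mu A) &
        forall nu : probability (measurableTypeR R) R, carried_by_01 nu ->
          weakly_converges_01 (fun n => iter n P nu) mu].

(* Main.v *)
Require Import Defs.
From HB Require Import structures.
From mathcomp Require Import all_boot all_order all_algebra.
From mathcomp Require Import all_classical all_reals all_analysis.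
From mathcomp Require Import measurable_realfun ring lra.

(* In the metric |x - y| / min(x, 1 - x), f0 is an isometry near the endpoints
   and contracts strictly on ]1/2, x0[, because y0 >= 1/2; symmetrically for
   f1. Every point reaches one of these contracting zones, and the positivity
   of the two Lyapunov exponents pushes the chain away from the endpoints. Hence
   there is a weight V, tending to infinity at 0 and 1, such that
   D(x, y) = |x - y| V(x) / min(x, 1 - x) is contracted on average for close
   points, while V itself is a Lyapunov function, which gives tightness.

   Let U be the dual operator. Splitting U^n g(x) - U^n g(y) along the two
   branches costs, at distance t, at most the modulus of continuity of p0 at t;
   by the Dini condition this cost is summable along the contraction, so the
   functions U^n g are equicontinuous. Iterates of f1 o f0 send compact sets to
   a fixed point xs, so the chain started anywhere visits each neighbourhood of
   xs with a probability bounded below, and the oscillation of U^n g on compact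
   sets tends to 0. Thus U^n g converges pointwise to a constant L g; L is a
   tight positive functional, whose representing measure is the limit law. *)

Set Implicit Arguments.
Unset Strict Implicit.
Unset Printing Implicit Defensive.

Import Order.TTheory GRing.Theory Num.Theory.
Import numFieldNormedType.Exports.

Local Open Scope classical_set_scope.
Local Open Scope ring_scope.

(** * The dual operator *)

(** Both maps fix [0] and [1], so on the closed interval the Dirac masses there are invariant as
    well; uniqueness can only come from the open interval, where a bounded continuous [g] need not
    be uniformly continuous. The basic estimates therefore carry an error [e * V x], harmless
    because the mean of [V] stays bounded along the chain. The unweighted metric has Lipschitz ratio
    [1] also at the point [1/2]. The weight is raised by [eta] in a small window around [1/2], which
    both branches leave in one step for the zone where the weight is [1]. Distances shrink in the
    mean and not along every path, so the cost of splitting is measured by a concave function of the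
    distance, to which Jensen's inequality applies. One number [k] bounds the drift of [V] and the
    contraction of [D] and is also the ratio of the Dini scales, so a mean contraction moves the
    distance by one scale. The oscillation on one compact set is improved by knowing it on a larger
    one; this can be iterated only because the probability of visiting the neighbourhood of [xs] is
    bounded below independently of the compact set. *)

Lemma uniform_continuity_compactly_in01 (R : realType) (g : R -> R) (a e : R) :
  (forall x, 0 < x < 1 -> {for x, continuous g}) -> 0 < a -> 0 < e ->
  exists2 t : R, 0 < t & forall x y, a <= x <= 1 - a -> `|x - y| < t -> `|g x - g y| <= e.
Proof.
move=> gc a0 e0.
have cK : compact `[a, 1 - a]%classic := segment_compact (a := a) (b := 1 - a).
move/compact_near_coveringP : cK => /(_ _ (0^'+)%R
  (fun t x => forall y, `|x - y| < t -> `|g x - g y| <= e)) H.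
have /(H _) [t /= t0 Ht] : forall x, `[a, 1 - a]%classic x ->
    \forall x' \near x & i \near (0^'+)%R, forall y, `|x' - y| < i -> `|g x' - g y| <= e.
  move=> x; rewrite /= in_itv /= => /andP[ax xa].
  have xI : 0 < x < 1 by apply/andP; split; lra.
  have e20 : 0 < e / 2 by lra.
  have /cvgrPdist_le/(_ _ e20) /nbhs_ballP[d /= d0 Hd] := gc x xI.
  (* Half of [d] for the move of the base point, half for the distance to [y]: both points stay
     where [g] is within [e / 2] of [g x]. *)
  exists (ball x (d / 2), [set t | t <= d / 2]).
    split => /=; first by apply: nbhsx_ballx; lra.
    by apply: nbhs_right_le; lra.
  move=> [x' t] /= [xx' td] y yt.
  rewrite /ball/= in xx'.
  have -> : g x' - g y = (g x - g y) - (g x - g x') by ring.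
  apply: (le_trans (ler_normB _ _)).
  have : `|g x - g x'| <= e / 2 by apply: Hd; rewrite /ball/=; lra.
  have : `|g x - g y| <= e / 2.
    apply: Hd; rewrite /ball /=.
    have -> : x - y = (x - x') + (x' - y) by ring.
    by apply: (le_lt_trans (ler_normD _ _)); lra.
  lra.
exists (t / 2) => [|x y xa xy]; first by lra.
have t2 : ball_ Num.norm 0 t (t / 2) by rewrite /ball_ /= sub0r normrN ger0_norm; lra.
have /(_ x) Hx := Ht (t / 2) t2 ltac:(lra).
by apply: Hx => //=; rewrite in_itv.
Qed.

Section transfer_operator.
Context (R : realType) (f0 f1 p0 p1 : R -> R).
Implicit Types (x y : R) (h g : R -> R).

(** The expectation of [h] at the next state of the chain started at [x]; the [n]-th iterate is the
    expectation at time [n]. *)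
Definition transfer h x : R := p0 x * h (f0 x) + p1 x * h (f1 x).
Local Notation U n h := (iter n transfer h).

Hypothesis f0I : forall x, 0 < x < 1 -> 0 < f0 x < 1.
Hypothesis f1I : forall x, 0 < x < 1 -> 0 < f1 x < 1.
Hypothesis p0_ge0 : forall x, 0 < x < 1 -> 0 <= p0 x.
Hypothesis p1_ge0 : forall x, 0 < x < 1 -> 0 <= p1 x.
Hypothesis p_sum : forall x, 0 < x < 1 -> p0 x + p1 x = 1.

Lemma transfer_le h g : (forall x, 0 < x < 1 -> h x <= g x) ->
  forall x, 0 < x < 1 -> transfer h x <= transfer g x.
Proof.
move=> hg x xI; rewrite /transfer.
by apply: lerD; apply: ler_wpM2l; rewrite ?p0_ge0 ?p1_ge0// hg// ?f0I ?f1I.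
Qed.

Lemma iter_transfer_le n h g : (forall x, 0 < x < 1 -> h x <= g x) ->
  forall x, 0 < x < 1 -> U n h x <= U n g x.
Proof. by move=> hg; elim: n => [//|n IH] /=; exact: transfer_le. Qed.

Lemma iter_transfer_affine n (a b : R) h x : 0 < x < 1 ->
  U n (fun y => a * h y + b) x = a * U n h x + b.
Proof.
elim: n x => [//|n IH] x xI /=; rewrite /transfer !IH ?f0I ?f1I//.
by have := p_sum xI => /(congr1 ( *%R b)) H; lra.
Qed.

Lemma iter_transfer_lin n (a b : R) h g x : 0 < x < 1 ->
  U n (fun y => a * h y + b * g y) x = a * U n h x + b * U n g x.
Proof.
elim: n x => [//|n IH] x xI /=; rewrite /transfer !IH ?f0I ?f1I//; ring.
Qed.

Lemma iter_transfer_cst n (b : R) x : 0 < x < 1 -> U n (fun=> b) x = b.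
Proof.
elim: n x => [//|n IH] x xI /=; rewrite /transfer !IH ?f0I ?f1I//.
by rewrite -mulrDl p_sum// mul1r.
Qed.

Lemma iter_transfer_bounded n h (M : R) :
  (forall x, 0 < x < 1 -> `|h x| <= M) ->
  forall x, 0 < x < 1 -> `|U n h x| <= M.
Proof.
move=> hM x xI; rewrite ler_norml -{1}(@iter_transfer_cst n (- M) x xI).
rewrite -{2}(@iter_transfer_cst n M x xI).
by apply/andP; split; apply: iter_transfer_le => // y /hM; rewrite ler_norml => /andP[].
Qed.

Lemma iter_transfer_comp m n h : U (m + n) h = U m (U n h).
Proof. exact: iterD. Qed.

(** * Mean of the Lyapunov function along the chain *)

Section lyapunov.
Context (V : R -> R) (k C : R).
Hypothesis k01 : 0 < k < 1.
Hypothesis C_ge0 : 0 <= C.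
Hypothesis V_ge1 : forall x, 0 < x < 1 -> 1 <= V x.
Hypothesis V_drift : forall x, 0 < x < 1 -> transfer V x <= k * V x + C.

(** [C / (1 - k)] is the fixed point of [s |-> k * s + C], so the additive term of the drift does
    not accumulate. *)
Lemma iter_transfer_lyapunov n x : 0 < x < 1 -> U n V x <= k ^+ n * V x + C / (1 - k).
Proof.
have [k0 k1] := andP k01.
move=> xI; elim: n => [|n IH].
  by rewrite expr0 mul1r lerDl divr_ge0//; lra.
rewrite iterSr; apply: le_trans (iter_transfer_le _ V_drift xI) _.
rewrite iter_transfer_affine//.
apply: (@le_trans _ _ (k * (k ^+ n * V x + C / (1 - k)) + C)).
  by rewrite lerD2r ler_wpM2l// ltW.
rewrite mulrDr mulrA -exprS -addrA lerD2l.
by rewrite le_eqVlt; apply/orP; left; apply/eqP; field; lra.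
Qed.

Lemma iter_transfer_lyapunov_le n x : 0 < x < 1 -> U n V x <= V x + C / (1 - k).
Proof.
have [k0 k1] := andP k01.
move=> xI; apply: le_trans (iter_transfer_lyapunov n xI) _.
rewrite lerD2r ler_piMl ?exprn_ile1 ?ltW//.
by apply: lt_le_trans (V_ge1 xI).
Qed.

(** * Equicontinuity from the Dini condition *)

Section dini.
Context (w : R -> R) (b : nat -> R) (S r : R).
Hypothesis w_ge1 : forall x, 0 < x < 1 -> 1 <= w x.
Hypothesis r01 : 0 < r <= 1.
Let D x y := `|x - y| * w x.
Hypothesis D_contract : forall x y, 0 < x < 1 -> 0 < y < 1 -> D x y < r ->
  p0 x * D (f0 x) (f0 y) + p1 x * D (f1 x) (f1 y) <= k * D x y.
Hypothesis b_ge0 : forall n, 0 <= b n.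
Hypothesis b_osc : forall n x y, 0 < x < 1 -> 0 < y < 1 -> `|x - y| <= k ^+ n ->
  `|p0 x - p0 y| <= b n.
Hypothesis b_sum : forall N, \sum_(n < N) b n <= S.

(** A modulus built from the oscillations [b n] at the scales [k ^+ n]: a scale counts fully once
    [t] exceeds it and linearly below. The linear part makes each term concave in [t], as a
    contraction in the mean requires. Smallness in [t] will be uniform in the truncation [N]. *)
Definition dini_sum N (t : R) : R := \sum_(n < N) b n * Num.min 1 (t / k ^+ n).
Local Notation psi := dini_sum.

Let D_ge0 x y : 0 < x < 1 -> 0 <= D x y.
Proof. by move=> /w_ge1 w1; rewrite mulr_ge0//; lra. Qed.

Let D_dist x y : 0 < x < 1 -> `|x - y| <= D x y.
Proof. by move=> /w_ge1 w1; rewrite ler_peMr. Qed.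

Lemma dini_sum_ge0 N t : 0 <= t -> 0 <= psi N t.
Proof.
have [k0 k1] := andP k01.
move=> t0; apply: sumr_ge0 => i _; rewrite mulr_ge0// le_min ler01 /=.
by rewrite divr_ge0// exprn_ge0// ltW.
Qed.

Lemma dini_sum_le N s t : s <= t -> psi N s <= psi N t.
Proof.
have [k0 k1] := andP k01.
move=> st; apply: ler_sum => i _; rewrite ler_wpM2l//.
rewrite le_min ge_min lexx /= ge_min; apply/orP; right.
by rewrite ler_pM2r// invr_gt0 exprn_gt0.
Qed.

Lemma dini_sum_concave N (p q s t : R) : 0 <= p -> 0 <= q -> p + q = 1 ->
  p * psi N s + q * psi N t <= psi N (p * s + q * t).
Proof.
have [k0 k1] := andP k01.
move=> p0' q0 pq; rewrite /psi !mulr_sumr -big_split/=; apply: ler_sum => i _.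
rewrite !(mulrCA _ (b i)) -mulrDr ler_wpM2l//.
rewrite le_min; apply/andP; split.
  by rewrite -[leRHS]pq; apply: lerD; rewrite -[leRHS]mulr1 ler_wpM2l// ge_min lexx.
by rewrite mulrDl -!mulrA; apply: lerD; apply: ler_wpM2l => //; rewrite ge_min lexx orbT.
Qed.

(** The alternative [n = N] comes from the truncation: distances below [k ^+ N] have no level of
    their own. *)
Lemma dyadic_level N (t : R) : t <= 1 ->
  exists2 n, (n <= N)%N & t <= k ^+ n /\ (n = N \/ k ^+ n.+1 < t).
Proof.
move=> t1; elim: N => [|N [n nN [tn H]]]; first by exists 0%N; rewrite ?expr0//; split=> //; left.
have [tl|tg] := leP t (k ^+ n.+1); last by exists n; [exact: leqW|split=> //; right].
case: H => [nE|]; last by move=> /lt_le_trans/(_ tl); rewrite ltxx.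
by exists N.+1 => //; rewrite -nE; split => //; left.
Qed.

(* The gain [dini_sum N t - dini_sum N (k t)] pays for decoupling at distance [t]. *)
Lemma dini_sum_gap N (t e : R) : 0 <= t <= 1 ->
  (forall n, t <= k ^+ n -> e <= b n) ->
  (k * (1 - k)) * e <= psi N t - psi N (k * t) + b N.
Proof.
have [k0 k1] := andP k01.
move=> /andP[t0 t1] He; have [n nN [tn H]] := dyadic_level N t1.
have en := He _ tn.
have kt : psi N (k * t) <= psi N t by apply: dini_sum_le; rewrite ler_piMl// ltW.
have kk : k * (1 - k) <= 1 by apply: mulr_ile1; lra.
have kk0 : 0 <= k * (1 - k) by apply: mulr_ge0; lra.
(* At the last level the sum need not drop, and the spare [b N] pays. *)
case: H => [nE|kt'].
  rewrite nE in en; have bN := b_ge0 N.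
  suff: (k * (1 - k)) * e <= b N by lra.
  by apply: (le_trans (ler_wpM2l kk0 en)); rewrite ler_piMl.
move: nN; rewrite leq_eqVlt => /orP[/eqP nE|nN].
  rewrite nE in en; have bN := b_ge0 N.
  suff: (k * (1 - k)) * e <= b N by lra.
  by apply: (le_trans (ler_wpM2l kk0 en)); rewrite ler_piMl.
have bN := b_ge0 N.
(* One term suffices: from [t] to [k * t] the factor of [b n] falls from [a = t / k ^+ n], which is
   at least [k], to at most [k * a]. *)
suff: k * (1 - k) * b n <= psi N t - psi N (k * t).
  by have := ler_wpM2l kk0 en; lra.
rewrite /psi -sumrB (bigD1 (Ordinal nN))//= -[leLHS]addr0; apply: lerD; last first.
  apply: sumr_ge0 => i _; rewrite -mulrBr mulr_ge0// subr_ge0.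
  rewrite le_min ge_min lexx /= ge_min; apply/orP; right.
  rewrite ler_pM2r ?invr_gt0 ?exprn_gt0//.
  by rewrite ler_piMl// ltW.
have kn0 : 0 < k ^+ n by rewrite exprn_gt0.
have -> : Num.min 1 (t / k ^+ n) = t / k ^+ n.
  by apply/min_idPr; rewrite ler_pdivrMr// mul1r.
have : Num.min 1 (k * t / k ^+ n) <= k * t / k ^+ n by rewrite ge_min lexx orbT.
have : k <= t / k ^+ n by rewrite ler_pdivlMr// -exprS ltW.
rewrite -mulrA; set a := t / _; set m := Num.min _ _ => ka mk.
rewrite -mulrBr mulrC ler_wpM2l//.
have h : k * (1 - k) <= a * (1 - k) by apply: ler_wpM2r => //; lra.
lra.
Qed.

Lemma dini_sum_small (e : R) : 0 < e ->
  exists2 t0 : R, 0 < t0 & forall N t, 0 <= t <= t0 -> psi N t <= e.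
Proof.
have [k0 k1] := andP k01.
move=> e0.
pose s N := \sum_(n < N) b n.
have S0 : 0 <= S by have := b_sum 0; rewrite big_ord0.
(* Beyond [K] the coefficients alone are small, whatever [t] is; below [K] the ratios [t / k ^+ n]
   will be at most [q]. *)
have [K HK] : exists K, forall N, s N <= s K + e / 2.
  pose E : set R := range s.
  have hE : has_sup E.
    by split; [exists (s 0%N); exists 0%N|exists S => _ [N _ <-]; exact: b_sum].
  have e20 : 0 < e / 2 by lra.
  have [_ [K _ <-] HK] := sup_adherent e20 hE.
  exists K => N; have : s N <= sup E by apply: sup_ubound; [exact: hE.2|exists N].
  lra.
have kK : 0 < k ^+ K by rewrite exprn_gt0.
have [q q0 qS] : exists2 q : R, 0 < q & q * (S + 1) = e / 2.
  by exists (e / 2 / (S + 1)); [rewrite !divr_gt0//; lra|rewrite divfK//; lra].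
exists (q * k ^+ K) => [|N t /andP[t0 tle]]; first exact: mulr_gt0.
have head m : (m <= K)%N -> psi m t <= e / 2.
  move=> mK; apply: (@le_trans _ _ (\sum_(n < m) b n * q)).
    apply: ler_sum => i _; rewrite ler_wpM2l//.
    rewrite ge_min; apply/orP; right; rewrite ler_pdivrMr ?exprn_gt0//.
    apply: (le_trans tle); rewrite ler_pM2l//.
    by rewrite ler_wiXn2l// ?ltW//; exact: leq_trans (ltnW (ltn_ord i)) mK.
  by rewrite -mulr_suml -qS mulrC ler_pM2l//; have := b_sum m; lra.
have [NK|/ltnW KN] := leqP N K; first by have := head _ NK; lra.
have HKN := HK N; rewrite /s in HKN; rewrite /psi.
have split (F : nat -> R) :
    \sum_(n < N) F n = \sum_(n < K) F n + \sum_(K <= n < N) F n.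
  by rewrite -!(big_mkord xpredT) /= -big_cat_nat.
rewrite (split b) in HKN; rewrite (split (fun n => b n * Num.min 1 (t / k ^+ n))).
have tail : \sum_(K <= n < N) b n * Num.min 1 (t / k ^+ n) <= \sum_(K <= n < N) b n.
  by apply: ler_sum => i _; rewrite ler_piMr// ge_min lexx.
have hK := head _ (leqnn K); rewrite /psi in hK; lra.
Qed.

(** Induction on [n] with [dini_sum] as a potential. Two close points are moved along the same
    branch with the probabilities at [x]. The mismatch of the probabilities costs at most
    [2 * M * |p0 x - p0 y|], which is paid by the drop of the potential from [d] to [k * d] and by
    [b N]. Concavity and the mean contraction of [D] show that the branches together use at most the
    potential at [k * d]. The payments [b N] add up to [n%:R * b N]. *)
Lemma iter_transfer_dist n N (g : R -> R) (M e C1 : R) x y :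
  (forall x, 0 < x < 1 -> `|g x| <= M) -> 0 <= e ->
  (forall x y, 0 < x < 1 -> 0 < y < 1 -> `|g x - g y| <= e * V x + C1 * D x y) ->
  2 * M <= C1 * r -> 0 < x < 1 -> 0 < y < 1 ->
  `|U n g x - U n g y| <= e * U n V x + C1 * D x y
     + 2 * M / (k * (1 - k)) * (psi N (D x y) + n%:R * b N).
Proof.
have [k0 k1] := andP k01; have [r0 r1] := andP r01.
move=> gM e0 gD Mr.
have M0 : 0 <= M by apply: le_trans (gM 2^-1 _) => //; lra.
have C10 : 0 <= C1 by rewrite -(pmulr_lge0 _ r0); lra.
set C2 := 2 * M / _.
have kk : 0 < k * (1 - k) by apply: mulr_gt0; lra.
have C20 : 0 <= C2 by rewrite /C2 divr_ge0//; lra.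
elim: n x y => [|n IH] x y xI yI.
  rewrite mul0r addr0; apply: (le_trans (gD _ _ xI yI)).
  by rewrite lerDl mulr_ge0// dini_sum_ge0// D_ge0.
have UM : forall x, 0 < x < 1 -> `|U n g x| <= M by exact: iter_transfer_bounded.
have UV : 1 <= U n.+1 V x.
  by rewrite -(@iter_transfer_cst n.+1 1 x xI); exact: iter_transfer_le.
have bN := b_ge0 N.
(* No contraction is known for distant points, but for them [C1 * D x y] already covers the trivial
   bound [2 * M]. *)
have [rD|Dr] := leP r (D x y).
  apply: (@le_trans _ _ (2 * M)).
    have := @iter_transfer_bounded n.+1 _ _ gM.
    move=> H; have := H _ xI; have := H _ yI => {}H ?.
    by apply: le_trans (ler_normB _ _) _; lra.
  have : C1 * r <= C1 * D x y by rewrite ler_wpM2l.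
  have : 0 <= e * U n.+1 V x by rewrite mulr_ge0//; lra.
  have : 0 <= C2 * (psi N (D x y) + n.+1%:R * b N).
    by rewrite mulr_ge0// addr_ge0 ?mulr_ge0// dini_sum_ge0// D_ge0.
  lra.
have p0x := p0_ge0 xI; have p1x := p1_ge0 xI; have px := p_sum xI; have py := p_sum yI.
have p1xE : p1 x = 1 - p0 x by rewrite -px addrAC subrr add0r.
have p1yE : p1 y = 1 - p0 y by rewrite -py addrAC subrr add0r.
have := D_contract xI yI Dr.
have := IH _ _ (f0I xI) (f0I yI); have := IH _ _ (f1I xI) (f1I yI).
rewrite [U n.+1 g]iterS [U n.+1 V]iterS /transfer.
have := UM _ (f0I yI); have := UM _ (f1I yI).
set D0 := D _ (f0 y); set D1 := D _ (f1 y); set d := D x y.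
set G0 := U n g (f0 x); set G1 := U n g (f1 x).
set H0 := U n g (f0 y); set H1 := U n g (f1 y).
set V0 := U n V (f0 x); set V1 := U n V (f1 x).
move=> H1M H0M I1 I0 Dc.
have osc : `|p0 x - p0 y| * (2 * M) <= C2 * (psi N d - psi N (k * d) + b N).
  have := @dini_sum_gap N d `|p0 x - p0 y|.
  have d01 : 0 <= d <= 1 by rewrite D_ge0//= (le_trans (ltW Dr)).
  have dO m : d <= k ^+ m -> `|p0 x - p0 y| <= b m.
    by move=> dm; apply: b_osc => //; apply: le_trans dm; exact: D_dist.
  move=> /(_ d01 dO) /(ler_wpM2l C20); apply: le_trans.
  by rewrite /C2 le_eqVlt; apply/orP; left; apply/eqP; field; lra.
have psik : p0 x * psi N D0 + p1 x * psi N D1 <= psi N (k * d).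
  by apply: le_trans (dini_sum_concave N D0 D1 p0x p1x px) _; exact: dini_sum_le.
(* Common branches weighted at [x], plus a single mismatch term, because [p1 = 1 - p0]. *)
have -> : p0 x * G0 + p1 x * G1 - (p0 y * H0 + p1 y * H1)
    = p0 x * (G0 - H0) + p1 x * (G1 - H1) + (p0 x - p0 y) * (H0 - H1).
  by rewrite p1xE p1yE; ring.
have HH : `|H0 - H1| <= 2 * M.
  by rewrite mulr_natl mulr2n (le_trans (ler_normB _ _))// lerD.
apply: (le_trans (ler_normD _ _)).
apply: (le_trans (lerD (ler_normD _ _) (lexx _))).
rewrite !normrM (ger0_norm p0x) (ger0_norm p1x).
have := ler_wpM2l p0x I0; have := ler_wpM2l p1x I1.
have := ler_wpM2l (normr_ge0 (p0 x - p0 y)) HH.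
have := ler_wpM2l C20 psik.
have := ler_wpM2l C10 Dc.
have : C1 * (k * d) <= C1 * d by rewrite ler_wpM2l// ler_piMl ?D_ge0// ltW.
have E : (n%:R + 1) * b N = n.+1%:R * b N by rewrite -natr1.
rewrite -E.
rewrite !p1xE in psik *; move: osc.
set X := psi N D0; set Y := psi N D1; set Z := psi N d; set T := psi N (k * d); set B := b N.
move=> *; lra.
Qed.

Lemma dini_coeff_small (e : R) : 0 < e -> exists N, b N <= e.
Proof.
move=> e0; apply: contrapT => /forallNP H.
have He N : N%:R * e <= S.
  apply: le_trans (b_sum N); rewrite mulr_natl -[X in _ *+ X]card_ord -sumr_const.
  by apply: ler_sum => i _; have /negP := H i; rewrite -ltNge => /ltW.
have S0 : 0 <= S by have := He 0%N; rewrite mul0r.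
have := truncnS_gt (S / e); rewrite ltr_pdivrMr// ltNge.
by rewrite He.
Qed.

Hypothesis V_proper : forall M : R,
  exists2 a : R, 0 < a & forall x, 0 < x < 1 -> V x <= M -> a <= x <= 1 - a.

Section bounded_continuous.
Context (g : R -> R) (M : R).
Hypothesis g_cont : forall x, 0 < x < 1 -> {for x, continuous g}.
Hypothesis gM : forall x, 0 < x < 1 -> `|g x| <= M.

Let M_ge0 : 0 <= M.
Proof. by apply: le_trans (gM (x := 2^-1) _) => //; lra. Qed.

(** Where [V x > 2 * M / e] the term [e * V x] covers the trivial bound; the remaining [x] lie in a
    compact set, on which [g] is uniformly continuous. In the witness for [C1], the summand
    [2 * M / r] meets the first requirement and [2 * M / t] handles points at distance at least
    [t]. *)
Lemma continuous_dist_le (e : R) : 0 < e -> exists2 C1 : R, 2 * M <= C1 * r &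
  forall x y, 0 < x < 1 -> 0 < y < 1 -> `|g x - g y| <= e * V x + C1 * D x y.
Proof.
have [r0 r1] := andP r01.
move=> e0; have [a a0 Ha] := V_proper (2 * M / e).
have [t t0 Ht] := uniform_continuity_compactly_in01 g_cont a0 e0.
have C10 : 0 <= 2 * M / r + 2 * M / t.
  by rewrite addr_ge0// divr_ge0 ?mulr_ge0// ltW.
exists (2 * M / r + 2 * M / t).
  rewrite [leRHS]mulrDl divfK ?gt_eqF// lerDl mulr_ge0 ?(ltW r0)//.
  by rewrite divr_ge0 ?mulr_ge0// ltW.
move=> x y xI yI.
have gg : `|g x - g y| <= 2 * M.
  by apply: le_trans (ler_normB _ _) _; have := gM xI; have := gM yI; lra.
have Vx := V_ge1 xI.
have eV : e <= e * V x by rewrite ler_peMr// ltW.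
have D0 := D_ge0 y xI.
have CD : 0 <= (2 * M / r + 2 * M / t) * D x y by exact: mulr_ge0.
have [VM|VM] := leP (V x) (2 * M / e); last first.
  by move: VM; rewrite ltr_pdivrMr// [V x * _]mulrC; lra.
have [xy|xy] := ltP `|x - y| t.
  by have := Ht _ _ (Ha _ xI VM) xy; lra.
apply: (le_trans gg).
have : t <= D x y by apply: le_trans xy (D_dist _ xI).
have tM : 0 <= 2 * M / t by rewrite divr_ge0 ?mulr_ge0// ltW.
move=> /(ler_wpM2l tM); rewrite divfK ?gt_eqF// [(_ + _ / t) * D x y]mulrDl => ?.
have : 0 <= 2 * M / r * D x y by rewrite mulr_ge0// divr_ge0 ?mulr_ge0// ltW.
lra.
Qed.

Lemma iter_transfer_equicontinuous x (e : R) : 0 < x < 1 -> 0 < e ->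
  exists2 t : R, 0 < t & forall y, 0 < y < 1 -> `|x - y| < t ->
    forall n, `|U n g x - U n g y| <= e.
Proof.
have [k0 k1] := andP k01; have [r0 r1] := andP r01.
move=> xI e0.
have wx := w_ge1 xI; have Vx := V_ge1 xI.
pose Q := V x + C / (1 - k).
have Q1 : 1 <= Q.
  by have : 0 <= C / (1 - k) by [rewrite divr_ge0//; lra]; rewrite /Q; lra.
have e1 : 0 < e / 4 / Q by rewrite !divr_gt0//; lra.
have [C1 C1r HC1] := continuous_dist_le e1.
have C10 : 0 <= C1.
  by rewrite -(pmulr_lge0 _ r0); apply: le_trans C1r; rewrite mulr_ge0.
pose C2 := 2 * M / (k * (1 - k)).
have kk : 0 < k * (1 - k) by apply: mulr_gt0; lra.
have C20 : 0 <= C2 by apply: divr_ge0; [exact: mulr_ge0|exact: ltW].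
have e2 : 0 < e / 4 / (C2 + 1) by rewrite !divr_gt0//; lra.
have [t0 t00 Ht0] := dini_sum_small e2.
have e3 : 0 < e / 4 / (C1 + 1) by rewrite !divr_gt0//; lra.
exists (Num.min t0 (e / 4 / (C1 + 1)) / w x).
  by rewrite divr_gt0// ?lt_min ?t00 ?e3//; lra.
move=> y yI; rewrite ltr_pdivlMr; last by lra.
rewrite lt_min => /andP[/ltW Dt /ltW De] n.
have n1 : 0 < n%:R + 1 :> R by rewrite ltr_wpDl.
(* [N] may depend on [n], since [t0] works for all truncations; it makes the accumulated
   [n%:R * b N] small. *)
have [N HN] := dini_coeff_small (divr_gt0 e2 n1).
apply: (le_trans (iter_transfer_dist n N gM (ltW e1) HC1 C1r xI yI)).
rewrite -/C2.
have : e / 4 / Q * U n V x <= e / 4.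
  by rewrite -[leRHS](@divfK _ Q) ?ler_pM2l ?iter_transfer_lyapunov_le//; lra.
have : C1 * D x y <= e / 4.
  apply: (@le_trans _ _ ((C1 + 1) * (e / 4 / (C1 + 1)))); last first.
    by rewrite mulrC divfK//; lra.
  by apply: ler_pM => //; [exact: D_ge0|lra].
have : C2 * (psi N (D x y) + n%:R * b N) <= e / 2.
  apply: (@le_trans _ _ ((C2 + 1) * (e / 4 / (C2 + 1) + e / 4 / (C2 + 1)))); last first.
    by rewrite mulrDr mulrC divfK//; lra.
  apply: ler_pM => //; [|lra|].
    by rewrite addr_ge0 ?mulr_ge0// dini_sum_ge0// D_ge0.
  apply: lerD; first by apply: Ht0; rewrite D_ge0.
  move: HN; rewrite ler_pdivlMr// [b N * _]mulrC; apply: le_trans.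
  by rewrite ler_wpM2r// lerDl.
lra.
Qed.

(** * Decay of the oscillation on compact sets, and convergence *)

Section convergence.
Context (delta c xs : R).
Hypothesis delta_gt0 : 0 < delta.
Hypothesis p0_ge : forall x, 0 < x < 1 -> delta <= p0 x.
Hypothesis p1_ge : forall x, 0 < x < 1 -> delta <= p1 x.
Hypothesis c_gt0 : 0 < c.
Hypothesis f0_confine : forall a x, 0 < a -> a <= x <= 1 - a -> c * a <= f0 x <= 1 - c * a.
Hypothesis f1_confine : forall a x, 0 < a -> a <= x <= 1 - a -> c * a <= f1 x <= 1 - c * a.
Hypothesis xsI : 0 < xs < 1.
Hypothesis merging : forall a t : R, 0 < a -> 0 < t ->
  exists N, forall x, a <= x <= 1 - a -> `|iter N (f1 \o f0) x - xs| < t.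
Hypothesis V_bounded : forall a : R, 0 < a ->
  exists B : R, forall x, a <= x <= 1 - a -> V x <= B.

Let inI (a x : R) : 0 < a -> a <= x <= 1 - a -> 0 < x < 1.
Proof. by move=> a0 /andP[ax xa]; apply/andP; split; lra. Qed.

(** [n] steps from [[a, 1 - a]] cannot leave the larger compact interval of the hypothesis, so only
    the values there matter. *)
Lemma iter_transfer_le_on n a h1 h2 : 0 < a ->
  (forall x, c ^+ n * a <= x <= 1 - c ^+ n * a -> h1 x <= h2 x) ->
  forall x, a <= x <= 1 - a -> U n h1 x <= U n h2 x.
Proof.
elim: n a => [|n IH] a a0 hh x xa /=; first by apply: hh; rewrite expr0 mul1r.
have xI := inI a0 xa; rewrite /transfer.
have ca : 0 < c * a by exact: mulr_gt0.
have {}IH y : c * a <= y <= 1 - c * a -> U n h1 y <= U n h2 y.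
  by apply: IH => // z; rewrite mulrA -exprSr; exact: hh.
by apply: lerD; apply: ler_wpM2l; rewrite ?p0_ge0 ?p1_ge0// IH ?f0_confine ?f1_confine.
Qed.

Let near_xs (t : R) : R -> R := fun y => if `|y - xs| < t then 1 else 0.

(** The alternating word [f0, f1, f0, f1, ...] of length [N.*2] has probability at least
    [delta ^+ N.*2]; all other words are discarded, as [h] is nonnegative. *)
Lemma iter_transfer_word N h x : (forall x, 0 < x < 1 -> 0 <= h x) -> 0 < x < 1 ->
  delta ^+ (N.*2) * h (iter N (f1 \o f0) x) <= U N.*2 h x.
Proof.
move=> h0; elim: N x => [|N IH] x xI; first by rewrite expr0 mul1r.
have U0 m y : 0 < y < 1 -> 0 <= U m h y.
  by move=> yI; rewrite -(@iter_transfer_cst m 0 y yI); exact: iter_transfer_le.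
rewrite doubleS iterSr /=.
have fI := f0I xI; have ffI := f1I fI.
have {IH} := IH _ ffI; set X := delta ^+ _ * _ => HX.
have T1 : delta * U N.*2 h (f1 (f0 x)) <= transfer (U N.*2 h) (f0 x).
  rewrite /transfer -[leLHS]add0r; apply: lerD.
    by rewrite mulr_ge0 ?p0_ge0 ?U0 ?f0I.
  by rewrite ler_wpM2r ?U0 ?p1_ge.
have T2 : delta * transfer (U N.*2 h) (f0 x) <= transfer (transfer (U N.*2 h)) x.
  rewrite {2}/transfer -[leLHS]addr0; apply: lerD.
    by rewrite ler_wpM2r ?p0_ge//; exact: (U0 N.*2.+1).
  by rewrite mulr_ge0 ?p1_ge0//; apply: (U0 N.*2.+1); exact: f1I.
apply: le_trans T2; rewrite exprS -mulrA ler_pM2l//.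
by apply: le_trans T1; rewrite exprS -mulrA ler_pM2l.
Qed.

(** [eta] must not depend on [a], which only influences the waiting time. Once the mean of [V] has
    fallen to [Q], Markov's inequality gives [V <= 2 * Q] with probability at least [1/2], and from
    this fixed compact set a word of fixed length reaches the neighbourhood of [xs]. *)
Lemma doeblin_near_xs (t : R) : 0 < t ->
  exists2 eta : R, 0 < eta <= 1 & forall a : R, 0 < a ->
    exists m, forall x, a <= x <= 1 - a -> eta <= U m (near_xs t) x.
Proof.
have [k0 k1] := andP k01.
move=> t0; pose Q := C / (1 - k) + 1.
have Q1 : 1 <= Q by rewrite lerDr divr_ge0//; lra.
have [a1 a10 Ha1] := V_proper (2 * Q).
have [N HN] := merging a10 t0.
have dN : 0 < delta ^+ N.*2 by rewrite exprn_gt0.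
have d1 : delta <= 1.
  by have := p_sum xsI; have := p0_ge xsI; have := p1_ge0 xsI; lra.
have dN1 : delta ^+ N.*2 <= 1 by rewrite exprn_ile1// ltW.
have Q0 : 0 < Q := lt_le_trans ltr01 Q1.
have cQ : 0 < delta ^+ N.*2 / (2 * Q) by rewrite divr_gt0// mulr_gt0.
exists (delta ^+ N.*2 / 2); first by apply/andP; split; lra.
move=> a a0; have [B HB] := V_bounded a0.
have B0 : 0 < `|B| + 1 by rewrite ltr_wpDl.
have [m Hm] : exists m, k ^+ m * (`|B| + 1) <= 1.
  have kn : `|k| < 1 by rewrite ger0_norm// ltW.
  have /cvgrPdist_le/(_ (`|B| + 1)^-1) := cvg_expr kn.
  rewrite invr_gt0 => /(_ B0) [m _ /(_ m (leqnn m))] /=.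
  rewrite sub0r normrN ger0_norm ?exprn_ge0 ?(ltW k0)// => ?.
  by exists m; rewrite -ler_pdivlMr// mul1r.
exists (m + N.*2)%N => x xa; have xI := inI a0 xa.
rewrite iter_transfer_comp.
have nx0 y : 0 <= near_xs t y by rewrite /near_xs; case: ifP.
(* Markov's inequality in affine form: the left side is below the probability of the word where
   [V y <= 2 * Q], and negative elsewhere. *)
have key y : 0 < y < 1 ->
    - (delta ^+ N.*2 / (2 * Q)) * V y + delta ^+ N.*2 <= U N.*2 (near_xs t) y.
  move=> yI; have Vy := V_ge1 yI.
  have [VQ|VQ] := leP (V y) (2 * Q).
    apply: le_trans (iter_transfer_word N (fun x _ => nx0 x) yI).
    rewrite /near_xs HN ?Ha1// mulr1.
    by rewrite mulNr gerDr oppr_le0 mulr_ge0 ?(ltW cQ)// (le_trans ler01).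
  apply: (@le_trans _ _ 0); last first.
    by rewrite -(@iter_transfer_cst N.*2 0 y yI); exact: iter_transfer_le.
  have : delta ^+ N.*2 / (2 * Q) * (2 * Q) <= delta ^+ N.*2 / (2 * Q) * V y.
    by rewrite ler_wpM2l ?(ltW cQ)// ltW.
  by rewrite divfK ?gt_eqF ?mulr_gt0// mulNr addrC subr_le0.
apply: le_trans (iter_transfer_le m key xI).
rewrite iter_transfer_affine//.
have VB : k ^+ m * V x <= 1.
  apply: le_trans Hm; rewrite ler_pM2l ?exprn_gt0//.
  by apply: (le_trans (HB _ xa)); have := ler_norm B; lra.
have UVQ : U m V x <= Q.
  by apply: (le_trans (iter_transfer_lyapunov m xI)); rewrite /Q addrC lerD2l.
have : delta ^+ N.*2 / (2 * Q) * U m V x <= delta ^+ N.*2 / (2 * Q) * Q.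
  by rewrite ler_wpM2l ?(ltW cQ).
have -> : delta ^+ N.*2 / (2 * Q) * Q = delta ^+ N.*2 / 2.
  by rewrite invfM mulrA divfK ?gt_eqF.
lra.
Qed.

Let osc_le (s : R) := forall a : R, 0 < a -> exists n0, forall n, (n0 <= n)%N ->
  exists l : R, forall x, a <= x <= 1 - a -> l <= U n g x <= l + s.

(** Read [U n g] as [m] steps applied to [G = U (n - m) g]. A mass at least [eta] arrives near [xs],
    where equicontinuity confines [G] to a range of length [e]; the rest sees the oscillation [s] on
    the larger compact set reachable in [m] steps, which is why [osc_le] quantifies over all compact
    sets. Since [eta] is fixed before [s], the step can be iterated. *)
Lemma osc_le_contract (e : R) : 0 < e -> exists2 eta : R, 0 < eta <= 1 &
  forall s, osc_le s -> osc_le ((1 - eta) * s + eta * e).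
Proof.
move=> e0; have e20 : 0 < e / 2 by lra.
have [t t0 Ht] := iter_transfer_equicontinuous xsI e20.
have [eta /andP[eta0 eta1] Heta] := doeblin_near_xs t0.
exists eta => [|s Hs a a0]; first by rewrite eta0.
have [m Hm] := Heta _ a0.
have ca : 0 < c ^+ m * a by rewrite mulr_gt0// exprn_gt0.
have [n0 Hn0] := Hs _ ca.
exists (m + n0)%N => n mn.
have mn' : (m <= n)%N by apply: leq_trans mn; exact: leq_addr.
have [l Hl] := Hn0 (n - m)%N ltac:(by rewrite leq_subRL).
pose G := U (n - m) g.
(* Bounds of [G] near [xs], clipped so that the coefficients [gm - l] and [l + s - gp] are
   nonnegative. *)
pose gm := Num.max l (G xs - e / 2); pose gp := Num.min (l + s) (G xs + e / 2).
have gml : l <= gm by rewrite le_max lexx.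
have gpl : gp <= l + s by rewrite ge_min lexx.
have gpm : gp - gm <= e.
  have : gp <= G xs + e / 2 by rewrite ge_min lexx orbT.
  have : G xs - e / 2 <= gm by rewrite le_max lexx orbT.
  lra.
have nearG y : 0 < y < 1 -> `|y - xs| < t -> G xs - e / 2 <= G y <= G xs + e / 2.
  move=> yI; rewrite distrC => /(Ht _ yI)/(_ (n - m)%N).
  by rewrite -/G ler_distlC.
exists (l + (gm - l) * eta) => x xa; have xI := inI a0 xa.
rewrite -(subnKC mn') iter_transfer_comp -/G.
have Hx := Hm _ xa.
apply/andP; split.
  apply: (@le_trans _ _ (U m (fun y => (gm - l) * near_xs t y + l) x)).
    by rewrite iter_transfer_affine// addrC lerD2r ler_wpM2l// subr_ge0.
  apply: iter_transfer_le_on xa => // y yc; have yI := inI ca yc.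
  have /andP[ly _] := Hl _ yc.
  rewrite /near_xs; case: ifPn => yxs; last by rewrite mulr0 add0r.
  by rewrite mulr1 subrK ge_max ly; have /andP[] := nearG _ yI yxs.
apply: (@le_trans _ _ (U m (fun y => - (l + s - gp) * near_xs t y + (l + s)) x)).
  apply: iter_transfer_le_on xa => // y yc; have yI := inI ca yc.
  have /andP[_ yl] := Hl _ yc.
  rewrite /near_xs; case: ifPn => yxs; last by rewrite mulr0 add0r.
  rewrite mulr1 opprB subrK le_min yl.
  by have /andP[] := nearG _ yI yxs.
rewrite iter_transfer_affine//.
have : (l + s - gp) * eta <= (l + s - gp) * U m (near_xs t) x.
  by rewrite ler_wpM2l// subr_ge0.
have : (gp - gm) * eta <= e * eta by rewrite ler_pM2r.
lra.
Qed.

Lemma osc_le_pos (e : R) : 0 < e -> osc_le e.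
Proof.
move=> e0; have e20 : 0 < e / 2 by lra.
have [eta /andP[eta0 eta1] Heta] := osc_le_contract e20.
(* The affine map of [osc_le_contract] has fixed point [e / 2] and rate [1 - eta]; the iteration
   starts from the trivial oscillation [2 * M]. *)
have step j : osc_le (e / 2 + (1 - eta) ^+ j * (2 * M)).
  elim: j => [|j IH].
    move=> a a0; exists 0%N => n _; exists (- M) => x xa.
    have := iter_transfer_bounded n gM (inI a0 xa).
    by rewrite ler_norml expr0 mul1r => /andP[? ?]; apply/andP; split; lra.
  have := Heta _ IH; rewrite exprS.
  by congr (osc_le _); ring.
have e1 : `|1 - eta| < 1 by rewrite ger0_norm; lra.
have M1 : 0 < 2 * M + 1 by have := M_ge0; lra.
have /cvgrPdist_le/(_ (e / 2 / (2 * M + 1))) := cvg_expr e1.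
rewrite divr_gt0// => /(_ isT) [j _ /(_ j (leqnn j))] /=.
have ej : 0 <= (1 - eta) ^+ j by rewrite exprn_ge0//; lra.
rewrite sub0r normrN ger0_norm// ler_pdivlMr// => Hj.
move=> a a0; have [n0 Hn0] := step j a a0.
exists n0 => n /Hn0[l Hl]; exists l => x /Hl /andP[-> /=] /le_trans; apply.
by lra.
Qed.

(** At [x = 2^-1] this is the Cauchy property; for other [x] it identifies the limit with the one at
    [2^-1]. The [m] extra steps average [U n g], which is almost constant where [V <= B]; the rest
    is bounded by a multiple of the mean of [V], uniformly in [m]. *)
Lemma iter_transfer_cauchy x (e : R) : 0 < x < 1 -> 0 < e ->
  exists n0, forall n m, (n0 <= n)%N -> `|U (m + n) g x - U n g 2^-1| <= e.
Proof.
have [k0 k1] := andP k01.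
move=> xI e0.
have hI : 0 < (2^-1 : R) < 1 by apply/andP; split; lra.
pose Q := V x + C / (1 - k).
have Q1 : 1 <= Q.
  by have : 0 <= C / (1 - k) by [rewrite divr_ge0//; lra]; have := V_ge1 xI; rewrite /Q; lra.
(* The first summand gives [2 * M / B * Q <= e / 2]; the second places [2^-1] in the compact set
   [V <= B]. *)
pose B := 4 * M * Q / e + V 2^-1.
have B0 : 1 <= B.
  have : 0 <= 4 * M * Q / e by rewrite divr_ge0 ?mulr_ge0//; lra.
  by have := V_ge1 hI; rewrite /B; lra.
have [a a0 Ha] := V_proper B.
have ha : a <= 2^-1 <= 1 - a.
  by apply: Ha => //; rewrite lerDr divr_ge0 ?mulr_ge0//; lra.
have e20 : 0 < e / 2 by lra.
have [n0 Hn0] := osc_le_pos e20 a0.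
exists n0 => n m /Hn0[l Hl].
have key y : 0 < y < 1 -> `|U n g y - U n g 2^-1| <= 2 * M / B * V y + e / 2.
  move=> yI; have Vy := V_ge1 yI.
  have [VB|VB] := leP (V y) B.
    have /Hl /andP[] := Ha _ yI VB; have /andP[] := Hl _ ha => *.
    have : 0 <= 2 * M / B * V y by rewrite !mulr_ge0 ?invr_ge0//; lra.
    by rewrite ler_norml => ?; apply/andP; split; lra.
  have := iter_transfer_bounded n gM yI; have := iter_transfer_bounded n gM hI.
  have : 2 * M / B * B <= 2 * M / B * V y.
    by apply: ler_wpM2l; [rewrite divr_ge0 ?mulr_ge0//; lra|exact: ltW].
  rewrite divfK; last by lra.
  by move=> ? ? ?; apply: (le_trans (ler_normB _ _)); lra.
have VQ := iter_transfer_lyapunov_le m xI.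
have MB : 0 <= 2 * M / B by rewrite divr_ge0 ?mulr_ge0//; lra.
have VQB : 2 * M / B * U m V x <= e / 2.
  apply: (@le_trans _ _ (2 * M / B * Q)); first by rewrite ler_wpM2l.
  rewrite mulrAC ler_pdivrMr; last by lra.
  have : e / 2 * (4 * M * Q / e) = 2 * M * Q by field; lra.
  have : 0 <= e / 2 * V 2^-1 by rewrite mulr_ge0//; have := V_ge1 hI; lra.
  rewrite /B; lra.
rewrite iter_transfer_comp ler_norml; apply/andP; split.
  have : U m (fun y => - (2 * M / B) * V y + (U n g 2^-1 - e / 2)) x <= U m (U n g) x.
    by apply: iter_transfer_le => // y /key; rewrite ler_norml => /andP[? ?]; lra.
  by rewrite iter_transfer_affine//; lra.
have : U m (U n g) x <= U m (fun y => 2 * M / B * V y + (U n g 2^-1 + e / 2)) x.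
  by apply: iter_transfer_le => // y /key; rewrite ler_norml => /andP[? ?]; lra.
by rewrite iter_transfer_affine//; lra.
Qed.

Lemma iter_transfer_cvg : exists l : R, forall x, 0 < x < 1 ->
  U n g x @[n --> \oo] --> l.
Proof.
have hI : 0 < (2^-1 : R) < 1 by apply/andP; split; lra.
have cv : cvgn (fun n => U n g 2^-1).
  apply/cauchy_cvgP/cauchy_exP => e e0.
  have e20 : 0 < e / 2 by lra.
  have [n0 Hn0] := iter_transfer_cauchy hI e20.
  exists (U n0 g 2^-1); exists n0 => // n /= n0n.
  rewrite /ball/= distrC; have := Hn0 n0 (n - n0)%N (leqnn _); rewrite subnK//; lra.
exists (limn (fun n => U n g 2^-1)) => x xI.
apply/cvgrPdist_le => e e0; have e20 : 0 < e / 2 by lra.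
have [n0 Hn0] := iter_transfer_cauchy xI e20.
have /cvgrPdist_le/(_ _ e20) [n1 _ Hn1] := cv.
exists (n0 + n1)%N => // n /= nn.
pose N := (n0 + n1)%N.
have := Hn0 N (n - N)%N (leq_addr _ _); rewrite subnK// => H1.
have := Hn1 N (leq_addl _ _) => /= H2.
rewrite -[X in `|X|](@subrKA _ (U N g 2^-1)).
by apply: (le_trans (ler_normD _ _)); rewrite [X in _ + X]distrC; lra.
Qed.

End convergence.
End bounded_continuous.
End dini.
End lyapunov.
End transfer_operator.

(** * The maps *)

Lemma exists_le3 (R : realType) (a b c : R) : 0 < a -> 0 < b -> 0 < c ->
  exists2 s : R, 0 < s & [/\ s <= a, s <= b & s <= c].
Proof.
move=> a0 b0 c0; exists (Num.min a (Num.min b c)).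
  by rewrite !lt_min a0 b0.
by rewrite !ge_min !lexx !orbT.
Qed.

(** A point that approaches [xs] without crossing it remains in [[b, 1 - b]], so the step estimate
    can be iterated; the initial distance is at most [1]. *)
Lemma iter_one_sided_contraction (R : realType) (f : R -> R) (xs b q : R) :
  0 < q < 1 -> b <= xs <= 1 - b ->
  (forall x, b <= x <= 1 - b ->
    (x <= xs -> 0 <= xs - f x <= q * (xs - x)) /\
    (xs <= x -> 0 <= f x - xs <= q * (x - xs))) ->
  0 < b -> forall n x, b <= x <= 1 - b ->
    b <= iter n f x <= 1 - b /\ `|iter n f x - xs| <= q ^+ n.
Proof.
move=> /andP[q0 q1] /andP[bxs bxs'] step b0 n x xb.
elim: n => [|n [IHb IHq]].
  split=> //=; rewrite expr0 ler_norml.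
  by move: xb => /andP[? ?]; apply/andP; split; lra.
rewrite iterS exprS; move: IHb IHq; set y := iter n _ x => yb yq.
have /andP[yb1 yb2] := yb; have [lo hi] := step _ yb.
have [yl|/ltW yl] := leP y xs.
  have /andP[h1 h2] := lo yl.
  have h3 : q * (xs - y) <= q * q ^+ n.
    by rewrite ler_pM2l//; move: yq; rewrite distrC ger0_norm//; lra.
  have h4 : q * (xs - y) <= xs - y by rewrite ler_piMl//; lra.
  split; first by apply/andP; split; lra.
  by rewrite distrC ger0_norm//; lra.
have /andP[h1 h2] := hi yl.
have h3 : q * (y - xs) <= q * q ^+ n.
  by rewrite ler_pM2l//; move: yq; rewrite ger0_norm//; lra.
have h4 : q * (y - xs) <= y - xs by rewrite ler_piMl//; lra.
split; first by apply/andP; split; lra.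
by rewrite ger0_norm//; lra.
Qed.

Section maps.
Context (R : realType) (x0 y0 : R).
Hypothesis x0_itv : 2^-1 < x0 < 1.
Hypothesis y0_itv : 2^-1 <= y0 < x0.
Local Notation a0 := (slope0 x0 y0).
Local Notation a1 := (slope1 x0 y0).
Local Notation f0 := (map0 x0 y0).
Local Notation f1 := (map1 x0 y0).

Lemma slopes : [/\ 0 < a0, a0 < 1, 1 < a1, a0 * x0 = y0 & a1 * (1 - x0) = 1 - y0].
Proof.
have /andP[? ?] := x0_itv; have /andP[? ?] := y0_itv; rewrite /slope0 /slope1; split.
- by rewrite divr_gt0//; lra.
- by rewrite ltr_pdivrMr; lra.
- by rewrite ltr_pdivlMr; lra.
- by rewrite divfK//; lra.
- by rewrite divfK//; lra.
Qed.

Lemma map0_lo x : x <= x0 -> f0 x = a0 * x.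
Proof. by rewrite /map0 => ->. Qed.

Lemma map0_hi x : x0 <= x -> f0 x = 1 - a1 * (1 - x).
Proof.
have [? ? ? E0 E1] := slopes.
rewrite le_eqVlt /map0 => /orP[/eqP <-|]; first by rewrite lexx; lra.
by rewrite ltNge => /negbTE ->; ring.
Qed.

Lemma map0_dist x y : `|f0 x - f0 y| <= a1 * `|x - y|.
Proof.
have [? ? ? E0 E1] := slopes.
wlog xy : x y / x <= y => [H|].
  by have [|/ltW] := leP x y => /H//; rewrite distrC (distrC x).
rewrite distrC (distrC x) (ger0_norm (_ : 0 <= y - x)) ?subr_ge0//.
have g0 : 0 <= a0 * (y - x) by rewrite mulr_ge0//; lra.
have g1 : 0 <= (a1 - a0) * (y - x) by rewrite mulr_ge0//; lra.
rewrite ler_norml.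
have [yx|/ltW yx] := leP y x0; first by rewrite !map0_lo//; [apply/andP; split; lra|lra].
rewrite (map0_hi yx); have [xx|/ltW xx] := leP x x0.
  have h1 : 0 <= (a1 - a0) * (x0 - x) by rewrite mulr_ge0//; lra.
  have h2 : 0 <= a0 * (x0 - x) by rewrite mulr_ge0//; lra.
  have h3 : 0 <= a1 * (y - x0) by rewrite mulr_ge0//; lra.
  by rewrite (map0_lo xx); apply/andP; split; lra.
by rewrite (map0_hi xx); apply/andP; split; lra.
Qed.

Lemma map1_dist x y : `|f1 x - f1 y| <= a1 * `|x - y|.
Proof.
rewrite /map1; have -> : 1 - f0 (1 - x) - (1 - f0 (1 - y)) = f0 (1 - y) - f0 (1 - x) by ring.
have -> : x - y = (1 - y) - (1 - x) by ring.
exact: map0_dist.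
Qed.

Lemma map0_confine a x : 0 < a -> a <= x <= 1 - a -> a0 * a <= f0 x <= 1 - a0 * a.
Proof.
have [a00 a01 a11 E0 E1] := slopes => ap /andP[ax xa].
have h0 : 0 <= a0 * (x - a) by rewrite mulr_ge0//; lra.
have h1 : 0 <= a0 * (1 - x - a) by rewrite mulr_ge0//; lra.
have [xx|/ltW xx] := leP x x0.
  by rewrite map0_lo//; apply/andP; split; lra.
have h2 : 0 <= (a1 - a0) * (x - x0) by rewrite mulr_ge0//; lra.
have h3 : 0 <= (a1 - a0) * (1 - x) by rewrite mulr_ge0//; lra.
by rewrite map0_hi//; apply/andP; split; lra.
Qed.

Lemma map1_confine a x : 0 < a -> a <= x <= 1 - a -> a0 * a <= f1 x <= 1 - a0 * a.
Proof.
move=> a0' /andP[ax xa]; rewrite /map1.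
have /(map0_confine a0') /andP[] : a <= 1 - x <= 1 - a by apply/andP; split; lra.
by move=> *; apply/andP; split; lra.
Qed.

Lemma map0_01 x : 0 < x < 1 -> 0 < f0 x < 1.
Proof.
have [a00 a01 a11 E0 E1] := slopes.
move=> /andP[x0' x1]; pose a := Num.min x (1 - x).
have a_gt0 : 0 < a by rewrite lt_min x0'; lra.
have aa : 0 < a0 * a by exact: mulr_gt0.
have ax : a <= x by rewrite ge_min lexx.
have ax' : a <= 1 - x by rewrite ge_min lexx orbT.
have : a <= x <= 1 - a by apply/andP; split; lra.
by move=> /(map0_confine a_gt0) /andP[? ?]; apply/andP; split; lra.
Qed.

Lemma map1_01 x : 0 < x < 1 -> 0 < f1 x < 1.
Proof.
move=> /andP[x0' x1]; rewrite /map1.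
have /map0_01 /andP[? ?] : 0 < 1 - x < 1 by apply/andP; split; lra.
by apply/andP; split; lra.
Qed.

(** [xs] is the fixed point of [x |-> 1 - a0 * (1 - a0 * x)], the branch of [f1 \o f0] with slope
    [a0 * a0], and [y0 >= 1/2] places it in the domain of that branch. The two outer branches have
    slope [a0 * a1 > 1], but they start at the fixed endpoints and so push points towards [xs]. *)
Lemma map10_merging : exists2 xs : R, 0 < xs < 1 & forall a t : R, 0 < a -> 0 < t ->
  exists N, forall x, a <= x <= 1 - a -> `|iter N (f1 \o f0) x - xs| < t.
Proof.
have /andP[x0l x0r] := x0_itv; have /andP[y0l y0r] := y0_itv.
have [a00 a01 a11 E0 E1] := slopes.
pose xs := (1 + a0)^-1.
have xsE : xs * (1 + a0) = 1 by rewrite mulVf//; lra.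
have xs0 : 0 < xs by rewrite invr_gt0; lra.
have xs1 : xs < 1 by rewrite invf_lt1; lra.
have y0xs : 1 - y0 <= xs.
  have h : 2^-1 * (1 + a0) <= y0 * (1 + a0) by apply: ler_wpM2r => //; lra.
  have : (1 - y0) * (1 + a0) <= xs * (1 + a0) by lra.
  by rewrite ler_pM2r//; lra.
have xsx0 : xs <= x0.
  have : xs * (1 + a0) <= x0 * (1 + a0) by lra.
  by rewrite ler_pM2r//; lra.
(* Equivalent to [x0 * (1 - x0) < y0 * (1 - y0)], which follows from [1/2 <= y0 < x0]. *)
have a01m : 1 < a0 * a1.
  have h : 0 < (x0 - y0) * (x0 + y0 - 1) by apply: mulr_gt0; lra.
  have : x0 * (1 - x0) < y0 * (1 - y0) by lra.
  rewrite -E1 -[X in _ < X * _]E0.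
  have -> : a0 * x0 * (a1 * (1 - x0)) = (a0 * a1) * (x0 * (1 - x0)) by ring.
  by rewrite ltr_pMl// mulr_gt0//; lra.
exists xs => [|a t a_gt0 t_gt0]; first by rewrite xs0.
pose b := Num.min a (Num.min xs (1 - xs)).
have b0 : 0 < b by rewrite !lt_min a_gt0 xs0/=; lra.
have bxs : b <= xs by rewrite !ge_min lexx orbT.
have bxs' : b <= 1 - xs by rewrite !ge_min lexx !orbT.
have ba : b <= a by rewrite !ge_min lexx.
(* The first entry is for the branch of [xs]. On an outer branch the distance to [xs] drops by
   [a0 * a1 - 1] times the distance to the endpoint; the latter is at least [b], hence at least [b]
   times the distance to [xs]. *)
pose q := Num.max (a0 * a0) (1 - (a0 * a1 - 1) * b).
have q1 : q < 1.
  rewrite gt_max; apply/andP; split; first by rewrite (lt_trans _ a01)// gtr_pMl.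
  have : 0 < (a0 * a1 - 1) * b by rewrite mulr_gt0//; lra.
  lra.
have q0 : 0 < q by rewrite lt_max mulr_gt0.
have aa0 : 0 <= a0 * a0 by rewrite mulr_ge0// ltW.
have qa : a0 * a0 <= q by rewrite le_max lexx.
have qb : 1 - (a0 * a1 - 1) * b <= q by rewrite le_max lexx orbT.
have xl : 1 - x0 <= a0 * xs.
  have : (1 - x0) * (1 + a0) <= a0 * xs * (1 + a0) by rewrite -mulrA xsE; lra.
  by rewrite ler_pM2r//; lra.
have a10 : 0 < a1 by exact: lt_trans a11.
have c0 : 0 <= a0 * a1 - 1 by rewrite subr_ge0 ltW.
have step x : b <= x <= 1 - b ->
    (x <= xs -> 0 <= xs - (f1 \o f0) x <= q * (xs - x)) /\
    (xs <= x -> 0 <= (f1 \o f0) x - xs <= q * (x - xs)).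
  move=> /andP[bx xb] /=.
  have f1lo u : u <= 1 - x0 -> f1 u = a1 * u.
    by move=> ?; rewrite /map1 map0_hi; [ring|rewrite lerBrDr -lerBrDl].
  have f1hi u : 1 - x0 <= u -> f1 u = 1 - a0 * (1 - u).
    by move=> ?; rewrite /map1 map0_lo// lerBlDr -lerBlDl.
  have core u : xs - (1 - a0 * (1 - a0 * u)) = a0 * a0 * (xs - u).
    have -> : 1 = xs * (1 + a0) :> R by []. ring.
  split=> xxs.
    have xx : 0 <= xs - x by rewrite subr_ge0.
    rewrite (map0_lo (le_trans xxs xsx0)).
    have /orP[lo|hi] := le_total (a0 * x) (1 - x0).
      rewrite f1lo//.
      have h1 : a1 * (a0 * x) <= a1 * (1 - x0) by rewrite ler_pM2l.
      apply/andP; split; first by rewrite subr_ge0 (le_trans h1)// E1.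
      have h4 : (1 - (a0 * a1 - 1) * b) * (xs - x) <= q * (xs - x) by exact: ler_wpM2r.
      have h5 : (a0 * a1 - 1) * (b * (xs - x)) <= (a0 * a1 - 1) * x.
        rewrite ler_wpM2l// (le_trans _ bx)// ler_piMr ?(ltW b0)//.
        by rewrite lerBlDr (le_trans (ltW xs1))// lerDl (le_trans (ltW b0)).
      by clear -h4 h5; lra.
    by rewrite f1hi// core mulr_ge0//= ler_wpM2r.
  have xx : 0 <= x - xs by rewrite subr_ge0.
  have /orP[lo|hi] := le_total x x0.
    rewrite (map0_lo lo) f1hi; last by apply: (le_trans xl); rewrite ler_pM2l.
    have -> : 1 - a0 * (1 - a0 * x) - xs = a0 * a0 * (x - xs).
      by rewrite -opprB core -mulrN opprB.
    by rewrite mulr_ge0//= ler_wpM2r.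
  have xx0 : 1 - x <= 1 - x0 by rewrite lerD2l lerN2.
  rewrite (map0_hi hi) f1hi; last first.
    rewrite lerD2l lerN2 (@le_trans _ _ (a1 * (1 - x0)))//; first by rewrite ler_pM2l.
    by rewrite E1 (le_trans y0xs).
  have -> : 1 - a0 * (1 - (1 - a1 * (1 - x))) - xs = (1 - xs) - a0 * a1 * (1 - x) by ring.
  have h0 : a0 * a1 * (1 - x) <= a0 * a1 * (1 - x0) by rewrite ler_pM2l// mulr_gt0.
  have h1 : a0 * a1 * (1 - x0) = a0 * (1 - y0) by rewrite -mulrA E1.
  have h2 : a0 * (1 - y0) <= 1 - xs.
    have -> : 1 - xs = a0 * xs by rewrite -[in LHS]xsE; ring.
    by rewrite ler_pM2l.
  apply/andP; split; first by rewrite subr_ge0 (le_trans h0)// h1.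
  have h4 : (1 - (a0 * a1 - 1) * b) * (x - xs) <= q * (x - xs) by exact: ler_wpM2r.
  have h5 : (a0 * a1 - 1) * (b * (x - xs)) <= (a0 * a1 - 1) * (1 - x).
    have bx1 : b <= 1 - x by rewrite lerBrDr -lerBrDl.
    rewrite ler_wpM2l// (le_trans _ bx1)// ler_piMr ?(ltW b0)//.
    by rewrite lerBlDr (le_trans xb)// lerD2l (le_trans _ (ltW xs0))// oppr_le0 ltW.
  by clear -h4 h5; lra.
have bx : b <= xs <= 1 - b by rewrite bxs lerBrDr -lerBrDl.
have q01 : 0 < q < 1 by apply/andP.
have iterq := iter_one_sided_contraction q01 bx step b0.
have qn : `|q| < 1 by rewrite gtr0_norm.
have t2 : 0 < t / 2 by rewrite divr_gt0.
have /cvgrPdist_le/(_ _ t2) [N _ /(_ N (leqnn N))] := cvg_expr qn.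
rewrite /= sub0r normrN (ger0_norm (exprn_ge0 N (ltW q0))) => HN.
exists N => x /andP[ax xa].
have /(iterq N) [_] : b <= x <= 1 - b.
  by rewrite (le_trans ba ax) (le_trans xa)// lerD2l lerN2.
by move=> /le_lt_trans; apply; apply: le_lt_trans HN _; rewrite gtr_pMr// invf_lt1// ltr1n.
Qed.

End maps.

(** * Lyapunov weight *)

Section drift.
Context (R : realFieldType) (P : R -> R) (n : nat).
Variables (delta a0 a1 al0 al1 A la l zM : R).
Hypothesis delta_gt0 : 0 < delta.
Hypothesis a0_gt0 : 0 < a0.
Hypothesis a1_gt0 : 0 < a1.
Hypothesis growth : 2 <= delta * a1 ^+ n.
Hypothesis al1_gt0 : 0 < al1.
Hypothesis al10 : al1 <= al0.
Hypothesis P_a1 : forall z, 0 < z -> P (a1 * z) = al1 * P z.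
Hypothesis P_a0 : forall z, 0 < z -> P (a0 * z) = al0 * P z.
Hypothesis P_ge0 : forall z, 0 <= P z.
Hypothesis P_ge1 : forall z, 0 < z <= 1 -> 1 <= P z.
Hypothesis P_noninc : forall z t, 0 < z -> z <= t -> P t <= P z.
Hypothesis A_ge0 : 0 <= A.
Hypothesis zM_gt0 : 0 < zM.
Hypothesis A_zM : A * zM ^+ n = 1 + P (a0 * zM).
Hypothesis l_gt0 : 0 < l.
Hypothesis l_near : l * (A + 1) <= la.
Hypothesis l_far : l * (A + P zM) <= 1.

Let F z := A * (1 - z ^+ n) + P z.

Let F_le z : 0 < z -> F z <= A + P z.
Proof.
move=> z0; rewrite lerD2r -[leRHS]mulr1 ler_wpM2l// gerBl exprn_ge0//.
exact: ltW.
Qed.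

Let drift_near (X Z b c Q S f : R) : 0 <= Z -> Z * 2 <= Z * X ->
  c * Q <= (1 - la) * Q -> f <= la * Q -> X = S -> c = b ->
  A - Z * S + b * Q <= A - Z + Q - f.
Proof. by move=> Z0 h1 h2 h3 <- <-; lra. Qed.

Let drift_far (X Z b c Q S f g : R) : 0 <= Q -> Z * 2 <= Z * X ->
  c * Q <= g -> 1 + g <= Z -> f <= 1 -> X = S -> c = b ->
  A - Z * S + b * Q <= A - Z + Q - f.
Proof. by move=> Q0 h1 h2 h3 h4 <- <-; lra. Qed.

(** [z] is the distance to an endpoint and [q] the probability of the branch that expands it. By
    [growth] the mean of [z ^+ n] at least doubles, so the first part of [F] falls by at least
    [A * z ^+ n]. For [z < zM] the mean of [P] falls by [la * P z], which exceeds [l * F z]. For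
    [z >= zM] the new mean of [P] is at most [P (a0 * zM)], and [A] is chosen to pay this and leave
    [1 >= l * F z]. *)
Lemma drift_ineq (q z : R) : 0 < z < 1 -> delta <= q <= 1 ->
  (z < zM -> q * al1 + (1 - q) * al0 <= 1 - la) ->
  q * F (a1 * z) + (1 - q) * F (a0 * z) <= (1 - l) * F z.
Proof.
move=> /andP[z0 z1] /andP[dq q1] near.
have q0 : 0 <= q by exact: le_trans (ltW delta_gt0) dq.
have q1' : 0 <= 1 - q by rewrite subr_ge0.
have Azn : 0 <= A * z ^+ n by rewrite mulr_ge0// exprn_ge0// ltW.
have qa : 2 <= q * a1 ^+ n + (1 - q) * a0 ^+ n.
  apply: (le_trans growth); apply: (@le_trans _ _ (q * a1 ^+ n)).
    by rewrite ler_wpM2r// exprn_ge0// ltW.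
  by rewrite lerDl mulr_ge0 ?exprn_ge0 ?(ltW a0_gt0).
have Fz := F_le z0.
have AX := ler_wpM2l Azn qa.
have -> : q * F (a1 * z) + (1 - q) * F (a0 * z) =
    A - A * z ^+ n * (q * a1 ^+ n + (1 - q) * a0 ^+ n) +
      (q * al1 + (1 - q) * al0) * P z.
  by rewrite /F P_a1// P_a0// !exprMn; ring.
have -> : (1 - l) * F z = A - A * z ^+ n + P z - l * F z by rewrite /F; ring.
have [zlt|zge] := ltP z zM.
  have Pz1 : 1 <= P z by apply: P_ge1; rewrite z0 ltW.
  apply: (drift_near Azn AX (ler_wpM2r (P_ge0 z) (near zlt))) => //.
  apply: (@le_trans _ _ (l * ((A + 1) * P z))).
    rewrite ler_pM2l//; apply: (le_trans Fz).
    by rewrite mulrDl mul1r lerD2r ler_peMr.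
  by rewrite mulrA ler_wpM2r.
apply: (drift_far (P_ge0 z) AX (g := P (a0 * zM))) => //.
- rewrite P_a0//; apply: ler_pM => //; last exact: P_noninc.
    by rewrite addr_ge0// mulr_ge0// ltW// (lt_le_trans al1_gt0).
  have : q * al1 <= q * al0 by rewrite ler_wpM2l.
  by rewrite mulrBl mul1r -lerBrDr subKr.
- by rewrite -A_zM ler_wpM2l// lerXn2r ?nnegrE// ltW.
- apply: le_trans l_far; rewrite ler_pM2l//; apply: (le_trans Fz).
  by rewrite lerD2l P_noninc.
Qed.

End drift.

(** * Construction of the barrier from the Lyapunov exponents *)

Section barrier.
Context (R : realType).

(** From [1 - t <= expR (- t)] one gets [expR t <= (1 - t)^-1], which the quadratic dominates for
    [t <= 1/2]. *)
Lemma expR_le_quadratic (t : R) : t <= 2^-1 -> expR t <= 1 + t + 2 * t ^+ 2.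
Proof.
move=> t2; have t1 : 0 < 1 - t by lra.
have : 1 - t <= expR (- t) by apply: le_trans (expR_ge1Dx (- t)); lra.
rewrite expRN => H.
have : expR t <= (1 - t)^-1 by rewrite -[leLHS]invrK lef_pV2 ?posrE// invr_gt0 expR_gt0.
move=> /le_trans; apply; rewrite -div1r ler_pdivrMr//.
have : 0 <= t ^+ 2 * (1 - 2 * t) by rewrite mulr_ge0 ?sqr_ge0//; lra.
by rewrite !expr2; lra.
Qed.

(** Laplace transform of the logarithmic displacement, [l1] with probability [q] and [- l0]
    otherwise. Its mean, at least [m], gives the first-order term [e * m]; the smallness of [e]
    keeps the quadratic terms below half of it. *)
Lemma mean_expR_lt1 (q l1 l0 m e : R) : 0 <= q <= 1 -> 0 <= l1 -> 0 <= l0 ->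
  m <= q * l1 - (1 - q) * l0 -> 0 < e -> e * l0 <= 2^-1 ->
  4 * e * (l1 ^+ 2 + l0 ^+ 2) <= m ->
  q * expR (- (e * l1)) + (1 - q) * expR (e * l0) <= 1 - e * m / 2.
Proof.
move=> /andP[q0 q1] l10 l00 mq e0 el0 eK.
have el1 : 0 <= e * l1 by apply: mulr_ge0; [exact: ltW|].
have h1 : expR (- (e * l1)) <= 1 - e * l1 + 2 * (e * l1) ^+ 2.
  by rewrite -[(e * l1) ^+ 2]sqrrN; apply: expR_le_quadratic; lra.
have h0 : expR (e * l0) <= 1 + e * l0 + 2 * (e * l0) ^+ 2 by exact: expR_le_quadratic.
have q1' : 0 <= 1 - q by lra.
have := ler_wpM2l q0 h1; have := ler_wpM2l q1' h0.
have := ler_wpM2l (ltW e0) mq; have := ler_wpM2l (ltW e0) eK.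
have s1 : q * (e * l1) ^+ 2 <= (e * l1) ^+ 2 by rewrite ler_piMl ?sqr_ge0.
have s0 : (1 - q) * (e * l0) ^+ 2 <= (e * l0) ^+ 2 by rewrite ler_piMl ?sqr_ge0//; lra.
move: s1 s0; rewrite !exprMn.
set u := l1 ^+ 2; set v := l0 ^+ 2; rewrite expr2 => *; lra.
Qed.

Variables (a0 a1 delta : R) (p0 p1 : R -> R).
Hypothesis a0_itv : 0 < a0 < 1.
Hypothesis a1_gt1 : 1 < a1.
Hypothesis delta_gt0 : 0 < delta.
Hypothesis p0_ge : forall x, 0 < x < 1 -> delta <= p0 x.
Hypothesis p1_ge : forall x, 0 < x < 1 -> delta <= p1 x.
Hypothesis p_sum : forall x, 0 <= x <= 1 -> p0 x + p1 x = 1.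
Hypothesis p0_pos : forall x, 0 <= x <= 1 -> 0 < p0 x.
Hypothesis p1_pos : forall x, 0 <= x <= 1 -> 0 < p1 x.
Hypothesis p_lim0 : forall e : R, 0 < e ->
  exists2 z : R, 0 < z & forall x, 0 < x < 1 -> x < z -> `|p0 x - p0 0| <= e.
Hypothesis p_lim1 : forall e : R, 0 < e ->
  exists2 z : R, 0 < z & forall x, 0 < x < 1 -> 1 - x < z -> `|p0 x - p0 1| <= e.
Hypothesis L0 : 0 < p0 0 * ln a0 + p1 0 * ln a1.
Hypothesis L1 : 0 < p0 1 * ln a1 + p1 1 * ln a0.

Let powR_step (a e z : R) : 0 < a -> 0 < z ->
  (a * z) `^ (- e) = expR (- (e * ln a)) * z `^ (- e).
Proof.
move=> a0' z0; rewrite powRM ?ltW//; congr (_ * _).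
by rewrite /powR gt_eqF// mulNr.
Qed.

(* Near an endpoint [z^-e] decreases on average thanks to the positive
   exponents; away from the endpoints [- z^n] does, for [n] large. *)
Lemma barrier_exists : exists (F : R -> R) (l : R),
  [/\ 0 < l <= 1,
      forall z, 0 < z <= 1 -> 1 <= F z,
      forall a : R, 0 < a -> exists B : R, forall z, a <= z <= 1 -> F z <= B,
      forall M : R, exists2 a : R, 0 < a & forall z, 0 < z <= 1 -> F z <= M -> a <= z &
      forall x, 0 < x < 1 ->
        p0 x * F (a1 * (1 - x)) + p1 x * F (a0 * (1 - x)) <= (1 - l) * F (1 - x) /\
        p1 x * F (a1 * x) + p0 x * F (a0 * x) <= (1 - l) * F x].
Proof.
have /andP[a00 a01] := a0_itv.
have a10 : 0 < a1 by exact: lt_trans a1_gt1.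
have I0 : 0 <= (0 : R) <= 1 by lra.
have I1 : 0 <= (1 : R) <= 1 by lra.
have l1 : 0 < ln a1 by rewrite ln_gt0.
have l0 : 0 < - ln a0 by rewrite oppr_gt0 ln_lt0.
have L0' := L0; have L1' := L1.
set l1' := ln a1 in l1 L0' L1'; set l0' := - ln a0 in l0.
pose m := Num.min (p0 0 * ln a0 + p1 0 * l1') (p0 1 * l1' + p1 1 * ln a0).
have m0 : 0 < m by rewrite lt_min L0'.
pose K := l1' ^+ 2 + l0' ^+ 2.
have K0 : 0 < K by rewrite addr_gt0// exprn_gt0.
(* The first bound keeps [e * l0'] in the range of the quadratic estimate, the second lets the
   first-order gain dominate. *)
pose e := Num.min (2^-1 / l0') (m / (4 * K)).
have e0 : 0 < e by rewrite lt_min !divr_gt0// mulr_gt0.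
have el0 : e * l0' <= 2^-1 by rewrite -ler_pdivlMr// ge_min lexx.
have eK : 4 * e * K <= m.
  rewrite mulrAC mulrC -ler_pdivlMr ?mulr_gt0// ge_min lexx orbT//.
pose al1 := expR (- (e * l1')); pose al0 := expR (e * l0').
have al1_0 : 0 < al1 by exact: expR_gt0.
have al0_1 : 1 <= al0 by rewrite -expR0 ler_expR mulr_ge0// ltW.
have al1_1 : al1 <= 1 by rewrite expR_le1 oppr_le0 mulr_ge0// ltW.
pose P z := z `^ (- e).
have P1 z : 0 < z -> P (a1 * z) = al1 * P z by move=> z0; rewrite /P powR_step//; exact: lt_trans a1_gt1.
have P0 z : 0 < z -> P (a0 * z) = al0 * P z.
  by move=> z0; rewrite /P powR_step// /al0 /l0' mulrN.
have Pge0 z : 0 <= P z by exact: powR_ge0.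
have Ple z t : 0 < z -> z <= t -> P t <= P z.
  move=> z0 zt; rewrite /P !powRN lef_pV2 ?posrE ?powR_gt0//; last exact: lt_le_trans zt.
  have t0 : 0 < t by exact: lt_le_trans zt.
  by apply: ge0_ler_powR; rewrite ?nnegrE// ltW.
have Pge1 z : 0 < z <= 1 -> 1 <= P z.
  by move=> /andP[z0 z1]; have := Ple _ _ z0 z1; rewrite {1}/P powR1.
have m_le0 : m <= p1 0 * l1' - (1 - p1 0) * l0'.
  have p00 := p_sum I0; have -> : 1 - p1 0 = p0 0 by lra.
  by rewrite /m ge_min; apply/orP; left; rewrite /l0'; lra.
have m_le1 : m <= p0 1 * l1' - (1 - p0 1) * l0'.
  have p11 := p_sum I1; have -> : 1 - p0 1 = p1 1 by lra.
  by rewrite /m ge_min; apply/orP; right; rewrite /l0'; lra.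
(* Half of the gain [e * m / 2] available at the endpoints; the other half absorbs the variation of
   the probabilities up to distance [zM]. *)
pose la := e * m / 4.
have la0 : 0 < la by rewrite divr_gt0// mulr_gt0.
have q0 : p1 0 * al1 + (1 - p1 0) * al0 <= 1 - 2 * la.
  have -> : 2 * la = e * m / 2 by rewrite /la; field.
  apply: mean_expR_lt1 => //; try exact: ltW.
  by rewrite ltW ?p1_pos//= -(p_sum I0) lerDr ltW ?p0_pos.
have q1 : p0 1 * al1 + (1 - p0 1) * al0 <= 1 - 2 * la.
  have -> : 2 * la = e * m / 2 by rewrite /la; field.
  apply: mean_expR_lt1 => //; try exact: ltW.
  by rewrite ltW ?p0_pos//= -[leRHS](p_sum I1) lerDl ltW ?p1_pos.
have al0_0 : 0 < al0 by exact: lt_le_trans al0_1.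
have la_al : 0 < la / al0 by rewrite divr_gt0.
have [z0 z00 Hz0] := p_lim0 la_al.
have [z1 z10 Hz1] := p_lim1 la_al.
have pert q q' : q' * al1 + (1 - q') * al0 <= 1 - 2 * la -> `|q - q'| <= la / al0 ->
    q * al1 + (1 - q) * al0 <= 1 - la.
  move=> H; rewrite ler_pdivlMr//.
  have : (q' - q) * (al0 - al1) <= `|q - q'| * al0.
    rewrite distrC; apply: (@le_trans _ _ (`|q' - q| * (al0 - al1))).
      by rewrite ler_wpM2r ?ler_norm// subr_ge0 (le_trans al1_1).
    by rewrite ler_wpM2l// gerBl ltW.
  by lra.
pose zM := Num.min 1 (Num.min z0 z1).
have zM0 : 0 < zM by rewrite !lt_min ltr01 z00.
have zM1 : zM <= 1 by rewrite ge_min lexx.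
have near0 x : 0 < x < 1 -> x < zM -> p1 x * al1 + (1 - p1 x) * al0 <= 1 - la.
  move=> xI; rewrite !lt_min => /and3P[_ xz0 _].
  apply: pert q0 _; have := Hz0 _ xI xz0.
  have xI' : 0 <= x <= 1 by case/andP: xI => ? ?; rewrite !ltW.
  have E0 : p0 0 = 1 - p1 0 by rewrite -(p_sum I0) addrK.
  have Ex : p0 x = 1 - p1 x by rewrite -(p_sum xI') addrK.
  by rewrite E0 Ex distrC opprB addrC addrA subrK.
have near1 x : 0 < x < 1 -> 1 - x < zM -> p0 x * al1 + (1 - p0 x) * al0 <= 1 - la.
  move=> xI; rewrite !lt_min => /and3P[_ _ xz1].
  by apply: pert q1 _; exact: Hz1.
clear m_le0 m_le1 q0 q1 Hz0 Hz1 pert L0' L1'.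
clearbody la; clearbody zM.
(* For such [n] the expanding branch alone doubles the mean of [z ^+ n], however small its
   probability. *)
have [n Hn] : exists n, 2 <= delta * a1 ^+ n.
  have a1i : `|a1^-1| < 1 by rewrite gtr0_norm ?invr_gt0 ?invf_lt1.
  have /cvgrPdist_le/(_ (delta / 2)) := cvg_expr a1i.
  rewrite divr_gt0// => /(_ isT) [n _ /(_ n (leqnn n))] /=.
  have an : 0 < a1 ^+ n by rewrite exprn_gt0.
  rewrite sub0r normrN exprVn gtr0_norm ?invr_gt0// => H; exists n.
  have : (a1 ^+ n)^-1 * a1 ^+ n <= delta / 2 * a1 ^+ n by rewrite ler_wpM2r// ltW.
  by rewrite mulVf ?gt_eqF// mulrAC ler_pdivlMr// mul1r.
have zn : 0 < zM ^+ n by rewrite exprn_gt0.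
pose A := (1 + P (a0 * zM)) / zM ^+ n.
have A0 : 0 <= A by apply: divr_ge0; [exact: addr_ge0|exact: ltW].
have AzM : A * zM ^+ n = 1 + P (a0 * zM) by rewrite /A divfK// gt_eqF.
pose F z := A * (1 - z ^+ n) + P z.
pose l := Num.min 1 (Num.min (la / (A + 1)) (A + P zM)^-1).
have APz : 0 < A + P zM by rewrite ltr_wpDl// (lt_le_trans ltr01)// Pge1// zM0.
have A10 : 0 < A + 1 by rewrite ltr_wpDl.
have ll : 0 < l by rewrite !lt_min ltr01 divr_gt0 ?invr_gt0.
have l_1 : l <= 1 by rewrite ge_min lexx.
have l_la : l * (A + 1) <= la.
  by rewrite -ler_pdivlMr ?ltr_wpDl// !ge_min lexx orbT.
have l_P : l * (A + P zM) <= 1.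
  by rewrite -ler_pdivlMr// mul1r !ge_min lexx !orbT.
have F_ge1 z : 0 < z <= 1 -> 1 <= F z.
  move=> zI; have /andP[z0' z1'] := zI; apply: ler_wpDl; last exact: Pge1.
  by rewrite mulr_ge0// subr_ge0 exprn_ile1// ltW.
have F_le z : 0 < z -> F z <= A + P z.
  move=> z0'; rewrite lerD2r -[leRHS]mulr1 ler_wpM2l// gerBl exprn_ge0//.
  exact: ltW.
have drift q z := @drift_ineq _ P n delta a0 a1 al0 al1 A la l zM delta_gt0 a00 a10 Hn al1_0
  (le_trans al1_1 al0_1) P1 P0 Pge0 Pge1 Ple A0 zM0 AzM ll l_la l_P q z.
exists F, l; split => //.
- by rewrite ll.
- move=> a a0'; exists (A + P a) => z /andP[az z1'].
  apply: (le_trans (F_le _ (lt_le_trans a0' az))).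
  by rewrite lerD2l Ple.
- move=> M; exists ((`|M| + 1) `^ (- e^-1)).
    by rewrite powR_gt0// ltr_wpDl.
  move=> z /andP[z0' z1'] FM.
  have PM : P z <= `|M| + 1.
    apply: (@le_trans _ _ (F z)); last by rewrite (le_trans FM)// (le_trans (ler_norm M))// lerDl.
    by rewrite lerDr mulr_ge0// subr_ge0 exprn_ile1// ltW.
  have -> : z = (P z) `^ (- e^-1).
    by rewrite /P -powRrM mulrNN mulfV ?gt_eqF// powRr1// ltW.
  have M0 : 0 < `|M| + 1 by rewrite ltr_wpDl.
  have Pz0 : 0 < P z by rewrite powR_gt0.
  rewrite !powRN lef_pV2 ?posrE ?powR_gt0//.
  by apply: ge0_ler_powR; rewrite ?nnegrE ?invr_ge0// ltW.
- move=> x xI; have /andP[x0 x1] := xI; have xI' : 0 <= x <= 1 by rewrite !ltW.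
  have E := p_sum xI'.
  have E0 : p1 x = 1 - p0 x by rewrite -E addrAC subrr add0r.
  have E1 : p0 x = 1 - p1 x by rewrite -E addrK.
  have le1 : p0 x <= 1 /\ p1 x <= 1.
    by rewrite -E lerDl lerDr !ltW// ?p0_pos ?p1_pos.
  split.
    rewrite E0; apply: drift; last exact: near1.
      by rewrite subr_gt0 x1 gtrBl.
    by rewrite p0_ge//; case: le1.
  rewrite E1; apply: drift => //; last exact: near0.
  by rewrite p1_ge//; case: le1.
Qed.

End barrier.

(** * Averaging inequalities for the zones of the weight *)

Section weight_algebra.
Context (R : realType).
Implicit Types (eta l k q s e g : R).

(** [d] and [d'] are distances before and after a step, [z] and [z'] the corresponding gaps. A
    Lipschitz ratio [s] for distance over gap passes to the weighted distance, where the new weight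
    [v'] is only a factor. *)
Lemma ratio_le (d d' z z' s v' : R) : 0 < z -> 0 < z' -> 0 <= v' ->
  d' * z <= s * d * z' -> d' * (v' / z') <= d / z * (s * v').
Proof.
move=> z0 z'0 v0 H.
have -> : d' * (v' / z') = (d' * z) * (v' / (z * z')) by field; lra.
have -> : d / z * (s * v') = (s * d * z') * (v' / (z * z')) by field; lra.
by apply: ler_wpM2r => //; rewrite divr_ge0// mulr_ge0// ltW.
Qed.

(** The drift yields [eta * l * Fz]. Half of it pays the slack [2 * e], and half the rate [k], since
    [1 + eta * Fz <= 2 * Fz]. *)
Lemma outer_mean_le eta l k q s e (Fz F1 F0 v' va : R) :
  0 < eta <= 1 -> 0 < l -> 0 <= q <= 1 -> 1 <= Fz -> 0 <= e -> 4 * e <= eta * l ->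
  1 - eta * l / 4 <= k ->
  q * F1 + (1 - q) * F0 <= (1 - l) * Fz ->
  s * v' <= 1 + eta * F1 + 2 * e -> va <= 1 + eta * F0 ->
  q * (s * v') + (1 - q) * va <= k * (1 + eta * Fz).
Proof.
move=> /andP[eta0 eta1] l0 /andP[q0 q1] Fz1 e0 el kl drift h1 h0.
have h2 := ler_wpM2l q0 h1.
have h3 : (1 - q) * va <= (1 - q) * (1 + eta * F0) by apply: ler_wpM2l => //; lra.
have h4 := ler_wpM2l (ltW eta0) drift.
have el0 : 0 < eta * l by exact: mulr_gt0.
have h5 : eta * l <= eta * l * Fz by rewrite ler_peMr// ltW.
have h6 : eta * (eta * l * Fz) <= eta * l * Fz by rewrite ler_piMl//; lra.
have h7 : q * e <= e by rewrite ler_piMl.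
have vz : 0 <= 1 + eta * Fz by rewrite addr_ge0// mulr_ge0//; lra.
have h8 := ler_wpM2r vz kl.
lra.
Qed.

(** The factor [g] acts with probability at least [delta] and gains [delta * (1 - g)]; half of this
    covers the excess [eta * CJ] of the weights over [1]. *)
Lemma middle_mean_le (eta g k q delta CJ v' va : R) :
  delta <= q <= 1 -> 0 <= g <= 1 -> 0 <= eta * CJ ->
  eta * CJ <= delta * (1 - g) / 2 -> 1 - delta * (1 - g) / 2 <= k ->
  v' <= 1 + eta * CJ -> va <= 1 + eta * CJ -> 0 <= delta ->
  q * (g * v') + (1 - q) * va <= k.
Proof.
move=> /andP[dq q1] /andP[g0 g1] C0 eC kd hv ha d0.
have q0 : 0 <= q by lra.
have h1 := ler_wpM2l (mulr_ge0 q0 g0) hv.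
have h2 : (1 - q) * va <= (1 - q) * (1 + eta * CJ) by apply: ler_wpM2l => //; lra.
have g1' : 0 <= 1 - g by lra.
have h4 := ler_wpM2r g1' dq.
have h5 := mulr_ge0 (mulr_ge0 q0 g1') C0.
lra.
Qed.

Lemma center_mean_le (eta l k : R) : 0 < eta <= 1 -> 0 < l <= 1 -> 1 - eta * l / 4 <= k ->
  1 <= k * (1 + eta).
Proof.
move=> /andP[eta0 eta1] /andP[l0 l1] kl.
have h4 : (1 - eta * l / 4) * (1 + eta) <= k * (1 + eta) by rewrite ler_wpM2r//; lra.
have h6 : eta * l <= eta by rewrite ler_piMr// ltW.
have h5 : eta * (eta * l) <= eta * l by rewrite ler_piMl// mulr_ge0// ltW.
lra.
Qed.

End weight_algebra.

(** * The weighted metric and its contraction in the mean *)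

Definition gap (R : realType) (u : R) : R := Num.min u (1 - u).

(** [z] is the distance to the nearest endpoint. In the outer zone the metric is at best preserved
    and the drift of [F] contracts. In the middle zone one branch contracts strictly, which permits
    the weight [1]. In the centre the ratio is again close to [1], but both images fall into the
    middle zone and the factor [1 + eta] is lost. *)
Definition weight (R : realType) (eta z1 zc : R) (F : R -> R) (z : R) : R :=
  if z <= z1 then 1 + eta * F z else if z < zc then 1 else 1 + eta.

Section weight.
Context (R : realType) (x0 y0 : R).
Hypothesis x0_itv : 2^-1 < x0 < 1.
Hypothesis y0_itv : 2^-1 <= y0 < x0.
Local Notation a0 := (slope0 x0 y0).
Local Notation a1 := (slope1 x0 y0).
Local Notation f0 := (map0 x0 y0).
Local Notation f1 := (map1 x0 y0).

Lemma gap_lo (u : R) : u <= 2^-1 -> gap u = u.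
Proof. by move=> ?; apply/min_idPl; lra. Qed.

Lemma gap_hi (u : R) : 2^-1 <= u -> gap u = 1 - u.
Proof. by move=> ?; apply/min_idPr; lra. Qed.

Context (F : R -> R) (l delta : R).
Hypothesis l01 : 0 < l <= 1.
Hypothesis delta_gt0 : 0 < delta.
Hypothesis F_ge1 : forall z, 0 < z <= 1 -> 1 <= F z.

Section parameters.
(** [e] is the half-width of the central window, [ep] a margin below the breakpoint [x0], [g] the
    contraction ratio in the middle zone, [CJ] a bound of [F] on the gaps reached from there, and
    [r] the radius for which a close [y] stays on the intended branches. *)
Context (e g eta ep r k CJ : R).
Hypothesis e_gt0 : 0 < e.
Hypothesis e_le : a0 * (2^-1 + e) < 2^-1 - e.
Hypothesis ep_gt0 : 0 < ep.
Hypothesis ep_le : 1 - x0 + ep < a0 * (2^-1 - e).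
Hypothesis ep_eta : ep * (a1 + 2) <= eta * l / 4 * (1 - y0).
Hypothesis ep_xy : 4 * ep <= x0 - y0.
Hypothesis g_itv : 0 < g <= 1.
Hypothesis g_ge : a0 <= g.
Hypothesis g_half : 2^-1 - e <= g * (2^-1 + e).
Hypothesis eta01 : 0 < eta <= 1.
Hypothesis CJ_ge1 : 1 <= CJ.
Hypothesis F_CJ : forall z, a0 * (1 - x0) <= z <= 1 -> F z <= CJ.
Hypothesis eta_CJ : eta * CJ <= delta * (1 - g) / 2.
Hypothesis r_gt0 : 0 < r.
Hypothesis r_ep : r <= ep.
Hypothesis r_x0 : r <= 2 * x0 - 1.
Hypothesis k_l : 1 - eta * l / 4 <= k.
Hypothesis k_delta : 1 - delta * (1 - g) / 2 <= k.

Let z1 := 1 - x0 + ep.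
Let zc := 2^-1 - e.
Let v := weight eta z1 zc F.

Lemma weight_ge1 z : 0 < z <= 1 -> 1 <= v z.
Proof.
move=> /F_ge1 Fz; have /andP[eta0 _] := eta01; rewrite /v /weight.
have : 0 <= eta * F z by rewrite mulr_ge0//; lra.
by case: ifP => _ ?; [lra|case: ifP => _; lra].
Qed.

Lemma weight_le z : 0 < z <= 1 -> v z <= 1 + eta * F z.
Proof.
move=> /F_ge1 Fz; have /andP[eta0 _] := eta01; rewrite /v /weight.
have : eta <= eta * F z by rewrite ler_peMr// ltW.
by case: ifP => _ ?; [lra|case: ifP => _; lra].
Qed.

Let weight_outer z : z <= z1 -> v z = 1 + eta * F z.
Proof. by rewrite /v /weight => ->. Qed.

Let weight_middle z : z1 < z -> z < zc -> v z = 1.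
Proof. by rewrite /v /weight ltNge => /negbTE -> ->. Qed.

Let weight_center z : z1 < z -> zc <= z -> v z = 1 + eta.
Proof. by rewrite /v /weight ltNge => /negbTE -> ; rewrite leNgt => /negbTE ->. Qed.

Let weight_le_eta z : z1 < z -> v z <= 1 + eta.
Proof.
have /andP[eta0 _] := eta01.
by rewrite /v /weight ltNge => /negbTE ->; case: ifP => _; lra.
Qed.

Let a0h : 0 < a0 < 1. Proof. by have [-> ->] := slopes x0_itv y0_itv. Qed.

Let z1_gt0 : 0 < z1.
Proof. by have /andP[_ ?] := x0_itv; have := ep_gt0; rewrite /z1 => ?; lra. Qed.

Let weight_CJ z : a0 * (1 - x0) <= z <= 1 -> v z <= 1 + eta * CJ.
Proof.
move=> zI; have /andP[eta0 _] := eta01; have /andP[_ x1] := x0_itv.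
have /andP[zl zr] := zI; have /andP[a00 _] := a0h.
have x1' : 0 < 1 - x0 by lra.
have z0 : 0 < z := lt_le_trans (mulr_gt0 a00 x1') zl.
have zI' : 0 < z <= 1 by rewrite z0.
by apply: (le_trans (weight_le zI')); rewrite lerD2l ler_pM2l// F_CJ.
Qed.

(* The local Lipschitz constant [s] of [f0] for the metric [|x - y| / gap x]. *)
Let side_conclusion q x s :=
  let z := 1 - x in let z' := gap (f0 x) in
  [/\ q * v z' + (1 - q) * v (a0 * z) <= k * v z + (1 + eta * CJ),
      q * (s * v z') + (1 - q) * v (a0 * z) <= k * v z &
      forall y, 0 < y < 1 -> `|x - y| < r * z -> `|f0 x - f0 y| * z <= s * `|x - y| * z'].

Let C0 : 0 <= eta * CJ.
Proof. by have /andP[? _] := eta01; have := CJ_ge1 => ?; rewrite mulr_ge0//; lra. Qed.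

Let azI z : 0 < z <= 1 -> 0 < a0 * z <= 1.
Proof.
move=> /andP[z0 zr]; have /andP[a00 a01] := a0h.
by rewrite mulr_gt0//= (le_trans _ zr)// ler_piMl// ltW.
Qed.

Let side_outer q x : delta <= q <= 1 -> 2^-1 <= x < 1 -> x0 <= x ->
  q * F (a1 * (1 - x)) + (1 - q) * F (a0 * (1 - x)) <= (1 - l) * F (1 - x) ->
  side_conclusion q x 1.
Proof.
have [_ _ a11 _ E1] := slopes x0_itv y0_itv.
have /andP[_ x0r] := x0_itv; have /andP[y0l _] := y0_itv; have e0 := ep_gt0.
move=> qI /andP[x2 x1] x0x drift; rewrite /side_conclusion.
set z := 1 - x in drift *.
have z0 : 0 < z by rewrite /z; lra.
have a1z : a1 * z <= a1 * (1 - x0) by rewrite ler_pM2l /z; lra.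
have a1z0 : 0 < a1 * z by rewrite mulr_gt0// (lt_trans ltr01).
have zI : 0 < z <= 1 by apply/andP; split => //; rewrite /z; lra.
have zz1 : z <= z1 by rewrite /z1 /z; lra.
have z'E : gap (f0 x) = a1 * z.
  by rewrite map0_hi// -/z gap_hi; [ring|lra].
have a1zI : 0 < a1 * z <= 1 by apply/andP; split => //; lra.
have qI' : 0 <= q <= 1.
  by have /andP[dq ->] := qI; rewrite (le_trans (ltW delta_gt0)).
have H : q * (1 * v (gap (f0 x))) + (1 - q) * v (a0 * z) <= k * v z.
  rewrite z'E (weight_outer zz1).
  have /andP[eta0 _] := eta01; have /andP[l0 _] := l01.
  apply: (outer_mean_le (e := 0) eta01 l0 qI' (F_ge1 zI)) k_l drift _ _ => //.
  - by rewrite mulr0 mulr_ge0// ltW.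
  - by rewrite mul1r mulr0 addr0; exact: weight_le.
  - exact/weight_le/azI.
split => //.
  by rewrite mul1r in H; have := C0 => ?; lra.
move=> y yI xy; rewrite z'E mul1r mulrCA mulrA ler_wpM2r//; first exact: ltW.
exact: map0_dist.
Qed.

(** Just below [x0] a close [y] may lie beyond [x0], where the slope is [a1]. The ratio then exceeds
    [1], by at most [eta * l / 4] when [ep] is small, and the drift of [F] pays for it. *)
Let side_border q x : delta <= q <= 1 -> 2^-1 <= x < 1 -> x <= x0 -> 1 - x <= z1 ->
  q * F (a1 * (1 - x)) + (1 - q) * F (a0 * (1 - x)) <= (1 - l) * F (1 - x) ->
  side_conclusion q x (1 + eta * l / 4).
Proof.
have [_ _ a11 E0 E1] := slopes x0_itv y0_itv; have /andP[a00 a01] := a0h.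
have /andP[_ x0r] := x0_itv; have /andP[y0l y0r] := y0_itv; have ep0 := ep_gt0.
have /andP[eta0 eta1] := eta01; have /andP[l0 l1] := l01.
move=> qI /andP[x2 x1] xx0 zz1 drift; rewrite /side_conclusion.
set z := 1 - x in zz1 drift *; set e' := eta * l / 4.
have el0 : 0 < eta * l by exact: mulr_gt0.
have el1 : eta * l <= 1 by rewrite mulr_ile1// ltW.
have e'0 : 0 < e' by rewrite /e'; lra.
have e'1 : e' <= 4^-1 by rewrite /e'; lra.
have z0 : 0 < z by rewrite /z; lra.
have zI : 0 < z <= 1 by apply/andP; split => //; rewrite /z; lra.
have xep : x0 - ep <= x by move: zz1; rewrite /z /z1; lra.
have aep0 : 0 < a0 * ep by exact: mulr_gt0.
have aep1 : a0 * ep < ep by rewrite gtr_pMl.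
have axep : a0 * (x0 - ep) <= a0 * x by rewrite ler_pM2l.
have ax0 : a0 * x <= y0 by rewrite -[leRHS]E0 ler_pM2l.
have z'lo : 1 - y0 - a0 * ep <= gap (f0 x).
  rewrite map0_lo// le_min; apply/andP; split; last by lra.
  by move: axep; rewrite mulrBr E0; lra.
have z'hi : gap (f0 x) <= 1.
  by rewrite map0_lo// ge_min (le_trans ax0)// ltW// (lt_trans y0r).
have epxy := ep_xy.
have z1z' : z1 < gap (f0 x) by rewrite /z1; lra.
have a1z1 : a1 * z <= a1 * z1 by rewrite ler_pM2l// (lt_trans ltr01).
have a1z1E : a1 * z1 = 1 - y0 + a1 * ep by rewrite /z1 mulrDr E1.
have epe := ep_eta; rewrite -/e' in epe.
have a1z : a1 * z <= (1 + e') * gap (f0 x).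
  have h2 : (1 + e') * (1 - y0 - a0 * ep) <= (1 + e') * gap (f0 x).
    by rewrite ler_wpM2l// addr_ge0// ltW.
  have h4 : e' * (a0 * ep) <= a0 * ep.
    by rewrite ler_piMl ?(ltW aep0)// (le_trans e'1)// invf_le1// ler1n.
  lra.
have a1z0 : 0 < a1 * z by rewrite mulr_gt0// (lt_trans ltr01).
have a1zI : 0 < a1 * z <= 1.
  have e'4 : e' * (1 - y0) <= 4^-1 * (1 - y0) by rewrite ler_wpM2r// subr_ge0 ltW// (lt_trans y0r).
  by rewrite a1z0; lra.
have z'I : 0 < gap (f0 x) <= 1.
  by rewrite z'hi andbT; exact: lt_trans z1z'.
have qI' : 0 <= q <= 1.
  by have /andP[dq ->] := qI; rewrite (le_trans (ltW delta_gt0)).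
have vz'2 := weight_le_eta z1z'.
have H : q * ((1 + e') * v (gap (f0 x))) + (1 - q) * v (a0 * z) <= k * v z.
  rewrite (weight_outer zz1).
  apply: (outer_mean_le (e := e') eta01 l0 qI' (F_ge1 zI)) k_l drift _ _ => //.
  - exact: ltW.
  - by rewrite /e' mulrC divfK.
  - have h1 : e' * v (gap (f0 x)) <= e' * 2.
      by rewrite ler_pM2l// (le_trans vz'2)// -[2]/(1 + 1) lerD2l.
    have h2 : eta <= eta * F (a1 * z) by rewrite ler_peMr ?F_ge1// ltW.
    rewrite mulrDl mul1r; apply: lerD; last by rewrite [leRHS]mulrC.
    by apply: (le_trans vz'2); rewrite lerD2l.
  - exact/weight_le/azI.
split => //.
  have h1 : 0 <= q * (e' * v (gap (f0 x))).
    have /andP[? _] := qI'; rewrite mulr_ge0// mulr_ge0 ?ltW//.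
    exact: lt_le_trans (weight_ge1 z'I).
  apply: (@le_trans _ _ (k * v z)); last by rewrite lerDl addr_ge0.
  by apply: le_trans H; rewrite lerD2r mulrDl mul1r mulrDr lerDl.
move=> y yI xy.
apply: (@le_trans _ _ (a1 * `|x - y| * z)).
  by apply: ler_wpM2r; [exact: ltW|exact: map0_dist].
by rewrite mulrAC [leRHS]mulrAC; exact: ler_wpM2r.
Qed.

(** [r <= ep] keeps [y] below [x0], so both points move with slope [a0]. If the image has gap
    [a0 * x], the ratio is [(1 - x) / x]; otherwise its gap is at least [1 - x] and the ratio at
    most [a0]. *)
Let inner_dist s x y : 0 <= s -> 2^-1 <= x -> x <= x0 - ep -> 1 - x <= s * x -> a0 <= s ->
  `|x - y| < r * (1 - x) -> `|f0 x - f0 y| * (1 - x) <= s * `|x - y| * gap (f0 x).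
Proof.
have /andP[a00 a01] := a0h.
move=> s0 x2 xx0 zsx as0 xy.
have rz : r * (1 - x) <= r * 2^-1 by rewrite ler_pM2l//; lra.
have yx0 : y <= x0.
  have := r_ep; have := ep_gt0; move: xy; rewrite ltr_norml => /andP[? _] *; lra.
have xx0' : x <= x0 by have := ep_gt0 => ?; lra.
rewrite !map0_lo// -mulrBr normrM (ger0_norm (ltW a00)) mulrAC [leRHS]mulrAC.
apply: ler_wpM2r => //.
have axx : a0 * x <= x by rewrite ler_piMl//; [lra|exact: ltW].
rewrite /gap; case: (leP (a0 * x) (1 - a0 * x)) => _.
  by rewrite [leRHS]mulrCA ler_pM2l.
apply: (@le_trans _ _ (s * (1 - x))).
  by apply: ler_wpM2r => //; have /andP[_ ?] := x0_itv; lra.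
by apply: ler_wpM2l => //; lra.
Qed.

Let side_middle q x : delta <= q <= 1 -> 2^-1 <= x < 1 -> z1 < 1 - x < zc ->
  side_conclusion q x g.
Proof.
have [_ _ a11 E0 E1] := slopes x0_itv y0_itv; have /andP[a00 a01] := a0h.
have /andP[x0l x0r] := x0_itv; have /andP[y0l y0r] := y0_itv; have ep0 := ep_gt0.
move=> qI /andP[x2 x1] /andP[zz1 zzc]; rewrite /side_conclusion.
have xx0 : x <= x0 - ep by move: zz1; rewrite /z1; lra.
have xx0' : x <= x0 by lra.
have ax2 : a0 * 2^-1 <= a0 * x by rewrite ler_pM2l.
have ax0 : a0 * x <= y0 by rewrite -[leRHS]E0 ler_pM2l.
have half : 1 - x0 < a0 * 2^-1.
  have h := ep_le; have : a0 * (2^-1 - e) <= a0 * 2^-1.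
    by rewrite ler_pM2l// gerBl ltW.
  by move=> H; apply: le_lt_trans (lt_le_trans h H); rewrite lerDl ltW.
have az' : a0 * (1 - x0) < 1 - x0 by rewrite gtr_pMl//; lra.
have z'J : a0 * (1 - x0) <= gap (f0 x) <= 1.
  rewrite map0_lo// le_min ge_min; apply/andP; split; [apply/andP; split|apply/orP; left].
  - by rewrite (le_trans (ltW az'))// (le_trans (ltW half)).
  - by lra.
  - by rewrite (le_trans ax0)// ltW// (lt_trans y0r).
have azJ : a0 * (1 - x0) <= a0 * (1 - x) <= 1.
  rewrite ler_pM2l// lerD2l lerN2 xx0'/=.
  have /azI/andP[//] : 0 < 1 - x <= 1 by rewrite subr_gt0 x1 gerBl (le_trans _ x2).
have vJ := weight_CJ z'J; have vJ' := weight_CJ azJ.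
have /andP[g0 g1] := g_itv; have /andP[dq q1] := qI; have d0 := delta_gt0.
have gI : 0 <= g <= 1 by rewrite (ltW g0).
have H := middle_mean_le qI gI C0 eta_CJ k_delta vJ vJ' (ltW d0).
have kge0 : 0 <= k.
  have /andP[eta0 eta1] := eta01; have /andP[l0 l1] := l01.
  have el1 : eta * l <= 1 by rewrite mulr_ile1// ltW.
  by apply: le_trans k_l; rewrite subr_ge0 ler_pdivrMr// mul1r (le_trans el1)// ler1n.
rewrite (weight_middle zz1 zzc) mulr1; split => //.
  have h1 := ler_wpM2l (le_trans (ltW d0) dq) vJ.
  have h2 : (1 - q) * v (a0 * (1 - x)) <= (1 - q) * (1 + eta * CJ).
    by rewrite ler_wpM2l// subr_ge0.
  by apply: (le_trans (lerD h1 h2)); rewrite -mulrDl addrC subrK mul1r lerDr.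
move=> y _ xy; apply: inner_dist => //; first exact: ltW.
have h : g * (2^-1 + e) <= g * x by rewrite ler_pM2l//; move: zzc; rewrite /zc; lra.
by apply: le_trans h; apply: le_trans g_half; exact: ltW.
Qed.

(** [e_le] and [ep_le] put the gaps of both images strictly between [z1] and [zc], so the weight
    drops from [1 + eta] to [1]. *)
Let side_center q x : delta <= q <= 1 -> 2^-1 <= x < 1 -> zc <= 1 - x ->
  side_conclusion q x 1.
Proof.
have /andP[a00 a01] := a0h; have e0 := e_gt0; have ep0 := ep_gt0; have epl := ep_le.
have el := e_le; have /andP[x0l x0r] := x0_itv.
move=> qI /andP[x2 x1] zzc; rewrite /side_conclusion.
have z1zc : z1 < a0 * zc by [].
have zc0 : 0 < zc by rewrite -(pmulr_rgt0 _ a00); exact: lt_trans z1zc.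
have azc : a0 * zc < zc by rewrite gtr_pMl.
have xe : x <= 2^-1 + e by move: zzc; rewrite /zc; lra.
have zz1 : z1 < 1 - x by lra.
have xx0 : x <= x0 - ep by move: zz1; rewrite /z1; lra.
have axe : a0 * x <= a0 * (2^-1 + e) by rewrite ler_pM2l.
have ax2 : a0 * 2^-1 <= a0 * x by rewrite ler_pM2l.
have azc2 : a0 * zc <= a0 * 2^-1 by rewrite ler_pM2l// /zc; lra.
have f0x : gap (f0 x) = a0 * x.
  rewrite map0_lo; last by lra.
  by rewrite gap_lo//; lra.
have vz' : v (a0 * x) = 1.
  by apply: weight_middle; [lra|rewrite /zc; lra].
have vaz : v (a0 * (1 - x)) = 1.
  apply: weight_middle; first by apply: (lt_le_trans z1zc); rewrite ler_pM2l.
  have h : a0 * (1 - x) <= a0 * x by rewrite ler_pM2l//; lra.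
  by rewrite /zc; lra.
have H := center_mean_le eta01 l01 k_l.
rewrite f0x vz' vaz (weight_center zz1 zzc); split.
- by have := C0; move=> ?; lra.
- by lra.
- move=> y _ xy; rewrite -f0x; apply: inner_dist => //.
  + by rewrite mul1r; lra.
  + exact: ltW.
Qed.

(** For [x >= 1/2] the map [f1] multiplies distance and gap alike by [a0], where [r <= 2 * x0 - 1]
    keeps [y] on the same branch; only [f0] needs the four zones. The other half follows later by
    reflection. *)
Lemma weight_contract q x : delta <= q <= 1 -> 2^-1 <= x < 1 ->
  q * F (a1 * (1 - x)) + (1 - q) * F (a0 * (1 - x)) <= (1 - l) * F (1 - x) ->
  q * v (gap (f0 x)) + (1 - q) * v (gap (f1 x)) <= k * v (gap x) + (1 + eta * CJ) /\
  forall y, 0 < y < 1 -> `|x - y| < r * gap x ->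
    q * (`|f0 x - f0 y| * (v (gap (f0 x)) / gap (f0 x)))
    + (1 - q) * (`|f1 x - f1 y| * (v (gap (f1 x)) / gap (f1 x)))
    <= k * (`|x - y| * (v (gap x) / gap x)).
Proof.
have /andP[a00 a01] := a0h; have /andP[x0l x0r] := x0_itv.
move=> qI x2I drift; have /andP[x2 x1] := x2I.
have [s [H1 H2 H3]] : exists s, side_conclusion q x s.
  have [x0x|/ltW xx0] := leP x0 x; first by exists 1; exact: side_outer.
  have [zlo|zhi] := leP (1 - x) z1.
    by exists (1 + eta * l / 4); exact: side_border.
  have [zlt|zge] := ltP (1 - x) zc.
    by exists g; apply: side_middle; rewrite ?zhi.
  by exists 1; exact: side_center.
have f1x : f1 x = 1 - a0 * (1 - x) by rewrite /map1 map0_lo//; lra.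
have z0 : 0 < 1 - x by lra.
have zI : 0 < 1 - x <= 1 by rewrite z0/=; lra.
have /andP[az0 az1] := azI zI.
have gx : gap x = 1 - x by rewrite gap_hi.
have azz : a0 * (1 - x) < 1 - x by rewrite gtr_pMl.
have gf1 : gap (f1 x) = a0 * (1 - x).
  by rewrite f1x gap_hi; [ring|lra].
rewrite gx gf1; split => // y yI xy.
have /andP[h1 h2] : 0 < f0 x < 1.
  by apply: (map0_01 x0_itv y0_itv); rewrite x1 andbT; lra.
have g0 : 0 < gap (f0 x) by rewrite lt_min h1/=; lra.
have gI : 0 < gap (f0 x) <= 1 by rewrite g0/= ge_min (ltW h2).
have f1y : f1 y = 1 - a0 * (1 - y).
  rewrite /map1 map0_lo//.
  have rz : r * (1 - x) <= r * 2^-1 by rewrite ler_pM2l//; lra.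
  have rx := r_x0; move: xy; rewrite ltr_norml => /andP[_ ?]; lra.
have f1xy : `|f1 x - f1 y| = a0 * `|x - y|.
  rewrite f1x f1y; have -> : 1 - a0 * (1 - x) - (1 - a0 * (1 - y)) = a0 * (x - y) by ring.
  by rewrite normrM (ger0_norm (ltW a00)).
have hh := ratio_le z0 g0 (le_trans ler01 (weight_ge1 gI)) (H3 y yI xy).
have /andP[dq _] := qI; have q0 : 0 <= q := le_trans (ltW delta_gt0) dq.
have hq := ler_wpM2l q0 hh.
rewrite f1xy; set d := `|x - y| in hq *.
have e1 : a0 * d * (v (a0 * (1 - x)) / (a0 * (1 - x))) = d / (1 - x) * v (a0 * (1 - x)).
  by field; rewrite (gt_eqF a00) (gt_eqF z0).
have e2 : k * (d * (v (1 - x) / (1 - x))) = d / (1 - x) * (k * v (1 - x)).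
  by field; rewrite (gt_eqF z0).
have dz : 0 <= d / (1 - x) by apply: divr_ge0; [exact: normr_ge0|exact: ltW].
have hd := ler_wpM2l dz H2.
rewrite e1 e2; apply: le_trans hd; rewrite [leRHS]mulrDr; apply: lerD.
  by rewrite [leRHS]mulrCA.
by rewrite [leRHS]mulrCA.
Qed.

End parameters.
End weight.

(** Order of the choices: the window [e]; then [g] and [CJ], which do not involve [eta]; [eta]
    against [CJ]; the margin [ep] against [eta]; finally [r] and [k]. *)
Lemma weight_exists (R : realType) (x0 y0 : R) (F : R -> R) (l delta : R) :
  2^-1 < x0 < 1 -> 2^-1 <= y0 < x0 -> 0 < l <= 1 -> 0 < delta <= 1 ->
  (forall z, 0 < z <= 1 -> 1 <= F z) ->
  (forall a : R, 0 < a -> exists B : R, forall z, a <= z <= 1 -> F z <= B) ->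
  exists (v : R -> R) (k r C z1 eta : R),
  [/\ 0 < k < 1, 0 < r <= 1, 0 <= C, 0 < z1 & 0 < eta] /\
  [/\ forall z, 0 < z <= 1 -> 1 <= v z <= 1 + F z,
      forall z, 0 < z <= z1 -> eta * F z <= v z &
      forall q x, delta <= q <= 1 -> 2^-1 <= x < 1 ->
        q * F (slope1 x0 y0 * (1 - x)) + (1 - q) * F (slope0 x0 y0 * (1 - x))
          <= (1 - l) * F (1 - x) ->
        q * v (gap (map0 x0 y0 x)) + (1 - q) * v (gap (map1 x0 y0 x)) <= k * v (gap x) + C /\
        forall y, 0 < y < 1 -> `|x - y| < r * gap x ->
          q * (`|map0 x0 y0 x - map0 x0 y0 y| * (v (gap (map0 x0 y0 x)) / gap (map0 x0 y0 x)))
          + (1 - q) * (`|map1 x0 y0 x - map1 x0 y0 y| * (v (gap (map1 x0 y0 x)) / gap (map1 x0 y0 x)))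
          <= k * (`|x - y| * (v (gap x) / gap x))].
Proof.
move=> x0I y0I l01 d01 F_ge1 F_bd.
have [a00 a01 a11 E0 E1] := slopes x0I y0I.
set a0 := slope0 x0 y0 in a00 a01 E0 *; set a1 := slope1 x0 y0 in a11 E1 *.
have /andP[x0l x0r] := x0I; have /andP[y0l y0r] := y0I.
have /andP[l0 l1] := l01; have /andP[d0 d1] := d01.
have [e e0 [e1 e2 _]] : exists2 e : R, 0 < e &
    [/\ e <= (1 - a0) / 8, e <= (a0 / 2 - (1 - x0)) / 2 & e <= 1].
  apply: exists_le3; [lra| |lra].
  (* Images of the centre have gap near [a0 / 2], which must exceed [1 - x0]: indeed
     [x0 * (1 - x0) < 1/4 <= y0 / 2]. *)
  have h : 0 < (x0 - 2^-1) * (x0 - 2^-1) by apply: mulr_gt0; lra.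
  have : (1 - x0) * x0 < a0 / 2 * x0 by lra.
  by rewrite ltr_pM2r//; lra.
have aee : a0 * e < e by rewrite gtr_pMl.
have e_le : a0 * (2^-1 + e) < 2^-1 - e by lra.
have ep_pos : 0 < a0 * (2^-1 - e) - (1 - x0) by lra.
have a12 : 0 < a1 + 2 by rewrite addr_gt0// (lt_trans ltr01).
have y01 : 0 < 1 - y0 by rewrite subr_gt0 (lt_trans y0r).
have x02 : 0 < 2 * x0 - 1 by lra.
have [g [g0 g1 ga0 ghalf]] : exists g : R,
    [/\ 0 < g, g < 1, a0 <= g & 2^-1 - e <= g * (2^-1 + e)].
  exists (Num.max a0 ((2^-1 - e) / (2^-1 + e))); split.
  - by rewrite lt_max a00.
  - by rewrite gt_max a01/= ltr_pdivrMr; lra.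
  - by rewrite le_max lexx.
  - by rewrite -ler_pdivrMr ?le_max ?lexx ?orbT//; lra.
have [CJ CJ1 HCJ] : exists2 CJ : R, 1 <= CJ & forall z, a0 * (1 - x0) <= z <= 1 -> F z <= CJ.
  have a0x0 : 0 < a0 * (1 - x0) by rewrite mulr_gt0// subr_gt0.
  have [CJ HCJ] := F_bd _ a0x0; exists CJ => //.
  apply: (le_trans (F_ge1 1 _)); first by rewrite ltr01 lexx.
  by apply: HCJ; rewrite lexx andbT mulr_ile1 ?gerBl ?subr_ge0 ?ltW// (lt_trans _ x0l).
have CJ_gt0 : 0 < CJ by exact: lt_le_trans CJ1.
have dg : 0 < delta * (1 - g) by rewrite mulr_gt0// subr_gt0.
have dg1 : delta * (1 - g) <= 1.
  by rewrite mulr_ile1 ?gerBl// ?subr_ge0 ltW.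
have [eta eta0 [eta1 etaC _]] : exists2 eta : R, 0 < eta &
    [/\ eta <= 1, eta <= delta * (1 - g) / 2 / CJ & eta <= 1].
  by apply: exists_le3 => //; rewrite !divr_gt0.
have {}etaC : eta * CJ <= delta * (1 - g) / 2 by rewrite -ler_pdivlMr.
have el0 : 0 < eta * l by exact: mulr_gt0.
have el1 : eta * l <= 1 by rewrite mulr_ile1// ltW.
have [ep ep0 [ep1 ep2 ep3]] : exists2 ep : R, 0 < ep &
    [/\ ep <= (a0 * (2^-1 - e) - (1 - x0)) / 2, ep <= eta * l / 4 * (1 - y0) / (a1 + 2) &
        ep <= (x0 - y0) / 4].
  by apply: exists_le3; rewrite !(divr_gt0, mulr_gt0)// subr_gt0.
have {}ep2 : ep * (a1 + 2) <= eta * l / 4 * (1 - y0) by rewrite -ler_pdivlMr.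
have [r r0 [r1 r2 r3]] : exists2 r : R, 0 < r & [/\ r <= 1, r <= ep & r <= 2 * x0 - 1].
  exact: exists_le3.
have [k k1 [kl kd]] : exists2 k : R, k < 1 &
    1 - eta * l / 4 <= k /\ 1 - delta * (1 - g) / 2 <= k.
  exists (Num.max (1 - eta * l / 4) (1 - delta * (1 - g) / 2)).
    by rewrite gt_max !gtrBl !divr_gt0.
  by rewrite !le_max !lexx orbT.
have eta01 : 0 < eta <= 1 by rewrite eta0.
have CJ0 : 0 <= eta * CJ by rewrite mulr_ge0 ?ltW// (lt_le_trans _ CJ1).
exists (weight eta (1 - x0 + ep) (2^-1 - e) F), k, r, (1 + eta * CJ), (1 - x0 + ep), eta.
have k0 : 0 < k.
  apply: lt_le_trans kl; rewrite subr_gt0 ltr_pdivrMr// mul1r.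
  by rewrite (le_lt_trans el1)// ltr1n.
have z10 : 0 < 1 - x0 + ep by rewrite addr_gt0// subr_gt0.
have C0 : 0 <= 1 + eta * CJ by rewrite addr_ge0.
split; first by rewrite k0 r0.
split.
- move=> z zI; have Fz := F_ge1 z zI.
  rewrite (weight_ge1 _ F_ge1 _ _ eta01 zI)/=.
  apply: (le_trans (weight_le _ F_ge1 _ _ eta01 zI)).
  by rewrite lerD2l ler_piMl// (le_trans _ Fz).
- by move=> z /andP[z0 zz1]; rewrite /weight zz1 lerDr.
have ep_le : 1 - x0 + ep < a0 * (2^-1 - e).
  by rewrite addrC -ltrBrDr (le_lt_trans ep1)// ltr_pdivrMr// ltr_pMr// ltr1n.
have ep_xy : 4 * ep <= x0 - y0 by rewrite mulrC -ler_pdivlMr.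
have gI : 0 < g <= 1 by rewrite g0 ltW.
- move=> q x qI xI drift.
  exact: (@weight_contract _ _ _ x0I y0I F l delta l01 d0 F_ge1 e g eta ep r k CJ).
Qed.

Lemma gapC (R : realType) (u : R) : gap (1 - u) = gap u.
Proof. by rewrite /gap minC; congr Num.min; ring. Qed.

Lemma lyapunov_exists (R : realType) (x0 y0 delta : R) (p0 p1 : R -> R) :
  2^-1 < x0 < 1 -> 2^-1 <= y0 < x0 -> 0 < delta ->
  (forall x, 0 < x < 1 -> delta <= p0 x) -> (forall x, 0 < x < 1 -> delta <= p1 x) ->
  (forall x, 0 <= x <= 1 -> p0 x + p1 x = 1) ->
  (forall x, 0 <= x <= 1 -> 0 < p0 x) -> (forall x, 0 <= x <= 1 -> 0 < p1 x) ->
  (forall e : R, 0 < e ->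
    exists2 z : R, 0 < z & forall x, 0 < x < 1 -> x < z -> `|p0 x - p0 0| <= e) ->
  (forall e : R, 0 < e ->
    exists2 z : R, 0 < z & forall x, 0 < x < 1 -> 1 - x < z -> `|p0 x - p0 1| <= e) ->
  0 < lyapunov0 x0 y0 p0 p1 -> 0 < lyapunov1 x0 y0 p0 p1 ->
  exists (V w : R -> R) (k r C : R),
  [/\ 0 < k < 1, 0 < r <= 1, 0 <= C, forall x, 0 < x < 1 -> 1 <= V x &
      forall x, 0 < x < 1 -> 1 <= w x] /\
  [/\ forall x, 0 < x < 1 -> transfer (map0 x0 y0) (map1 x0 y0) p0 p1 V x <= k * V x + C,
      forall x y, 0 < x < 1 -> 0 < y < 1 -> `|x - y| * w x < r ->
        p0 x * (`|map0 x0 y0 x - map0 x0 y0 y| * w (map0 x0 y0 x))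
        + p1 x * (`|map1 x0 y0 x - map1 x0 y0 y| * w (map1 x0 y0 x)) <= k * (`|x - y| * w x),
      forall M : R, exists2 a : R, 0 < a & forall x, 0 < x < 1 -> V x <= M -> a <= x <= 1 - a &
      forall a : R, 0 < a -> exists B : R, forall x, a <= x <= 1 - a -> V x <= B].
Proof.
move=> x0I y0I d0 p0d p1d psum p0p p1p lim0 lim1 L0 L1.
have [a00 a01 a11 E0 E1] := slopes x0I y0I.
have a0I : 0 < slope0 x0 y0 < 1 by rewrite a00.
have [F [l [l01 F1 Fbd Fprop Fdrift]]] :=
  barrier_exists a0I a11 d0 p0d p1d psum p0p p1p lim0 lim1 L0 L1.
have half : (2^-1 : R) <= 1 - 2^-1 by lra.
have hI : 0 < (2^-1 : R) < 1 by rewrite invr_gt0 invf_lt1// ltr0n ltr1n.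
have hI' : 0 <= (2^-1 : R) <= 1 by have /andP[? ?] := hI; rewrite !ltW.
have d01 : 0 < delta <= 1.
  by rewrite d0 (le_trans (p0d _ hI))// -[leRHS](psum _ hI') lerDl ltW// p1p.
have [v [k [r [C [z1 [eta [[k01 r01 C0 z10 eta0] [v_itv v_lo v_contract]]]]]]]] :=
  weight_exists x0I y0I l01 d01 F1 Fbd.
have gI (x : R) : 0 < x < 1 -> 0 < gap x <= 1.
  by move=> /andP[x0' x1]; rewrite lt_min ge_min x0' subr_gt0 x1 ltW.
have /andP[r0 r1] := r01.
(* One function [v] serves for the Lyapunov function and, divided by the gap, for the metric; its
   growth at the endpoints makes the former proper. *)
exists (fun x => v (gap x)), (fun x => v (gap x) / gap x), k, r, C; split.
  split => // x xI; have /andP[g0 g1] := gI _ xI; have /andP[v1 _] := v_itv _ (gI _ xI) => //.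
  by rewrite ler_pdivlMr// mul1r; exact: le_trans v1.
have close (x y : R) : 0 < x < 1 -> `|x - y| * (v (gap x) / gap x) < r -> `|x - y| < r * gap x.
  move=> xI; have /andP[g0 g1] := gI _ xI; have /andP[v1 _] := v_itv _ (gI _ xI).
  rewrite mulrA ltr_pdivrMr//; apply: le_lt_trans; rewrite ler_peMr//.
have both (x : R) : 0 < x < 1 ->
    p0 x * v (gap (map0 x0 y0 x)) + p1 x * v (gap (map1 x0 y0 x)) <= k * v (gap x) + C /\
    forall y, 0 < y < 1 -> `|x - y| < r * gap x ->
      p0 x * (`|map0 x0 y0 x - map0 x0 y0 y| * (v (gap (map0 x0 y0 x)) / gap (map0 x0 y0 x)))
      + p1 x * (`|map1 x0 y0 x - map1 x0 y0 y| * (v (gap (map1 x0 y0 x)) / gap (map1 x0 y0 x)))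
      <= k * (`|x - y| * (v (gap x) / gap x)).
  move=> xI; have /andP[xgt0 xlt1] := xI; have xI' : 0 <= x <= 1 by rewrite !ltW.
  have E := psum _ xI'; have P0 := p0p _ xI'; have P1 := p1p _ xI'.
  have D0 := p0d _ xI; have D1 := p1d _ xI; have [H0 H1] := Fdrift _ xI.
  have [x2|/ltW x2] := leP 2^-1 x.
    have E' : p1 x = 1 - p0 x by rewrite -E addrAC subrr add0r.
    rewrite E' in H0 *; apply: v_contract => //; last by rewrite x2.
    by rewrite D0 -E lerDl ltW.
  (* Left half: [x |-> 1 - x] exchanges the two maps and keeps the gap, so [p1 x] takes the role of
     [q]. *)
  have qI : delta <= p1 x <= 1 by rewrite D1 -E lerDr ltW.
  have xI2 : 2^-1 <= 1 - x < 1.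
    by rewrite gtrBl xgt0 andbT lerBrDr -lerBrDl (le_trans x2).
  have M0 : map0 x0 y0 (1 - x) = 1 - map1 x0 y0 x by rewrite /map1; ring.
  have N0 y : map0 x0 y0 (1 - y) = 1 - map1 x0 y0 y by rewrite /map1; ring.
  have N1 y : map1 x0 y0 (1 - y) = 1 - map0 x0 y0 y by rewrite /map1 subKr.
  have E' : 1 - p1 x = p0 x by rewrite -E addrK.
  have := v_contract (p1 x) (1 - x) qI xI2.
  rewrite N0 N1 !gapC E' subKr => /(_ H1) [G0 G1].
  split; first by rewrite addrC.
  move=> y yI xy; have := G1 (1 - y); rewrite N0 N1.
  have dd (u t : R) : `|1 - u - (1 - t)| = `|u - t|.
    by rewrite distrC; congr `|_|; ring.
  have yI' : 0 < 1 - y < 1 by rewrite subr_gt0 gtrBl andbC.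
  by rewrite !dd => /(_ yI' xy); rewrite addrC.
split.
- by move=> x xI; have [] := both x xI.
- by move=> x y xI yI xy; have [_] := both x xI; apply => //; exact: close.
- move=> M; have [a a0 Ha] := Fprop (M / eta).
  exists (Num.min a z1); first by rewrite lt_min a0.
  move=> x xI vM; have gx := gI _ xI; have /andP[g0 g1] := gx.
  suff : Num.min a z1 <= gap x by rewrite le_min lerBrDr -lerBrDl.
  rewrite ge_min; have [gz|gz] := leP (gap x) z1; last by rewrite (ltW gz) orbT.
  rewrite Ha// ler_pdivlMr// mulrC; apply: le_trans vM.
  by apply: v_lo; rewrite g0.
- move=> a a0; have [B HB] := Fbd _ a0; exists (1 + B) => x /andP[ax xa].
  have xI : 0 < x < 1.
    by rewrite (lt_le_trans a0 ax) (le_lt_trans xa)// gtrBl.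
  have /andP[_ ] := v_itv _ (gI _ xI); move=> /le_trans; apply; rewrite lerD2l; apply: HB.
  by have /andP[_ ->] := gI _ xI; rewrite andbT le_min ax lerBrDr -lerBrDl.
Qed.

(** * The Dini condition *)

Section dini_modulus.
Context (R : realType) (p0 p1 : R -> R).

(** The Dini condition with [C = 1] and [t = k]: the scales are those of the contraction rate. *)
Lemma dini_coefficients (k : R) : dini p0 p1 -> 0 < k < 1 ->
  exists (b : nat -> R) (S : R),
  [/\ forall n, 0 <= b n, forall N, \sum_(n < N) b n <= S &
      forall n x y, 0 < x < 1 -> 0 <= y <= 1 -> `|x - y| <= k ^+ n ->
        `|p0 x - p0 y| <= b n /\ `|p1 x - p1 y| <= b n].
Proof.
move=> D /andP[k0 k1].
have kn n : 0 <= k ^+ n by rewrite exprn_ge0// ltW.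
pose m n : \bar R := modulus p0 p1 (k ^+ n).
have osc_ge0 (p : R -> R) n : (0 <= oscillation p (k ^+ n))%E.
  apply: ereal_sup_ubound; exists 2^-1, 0.
  by rewrite normr0 addr0 subrr normr0; split => //; apply/andP; split; lra.
have m0 n : (0 <= m n)%E by rewrite le_max osc_ge0.
have msum : (\sum_(0 <= n <oo) m n < +oo)%E.
  have := D 1 k ler01; rewrite (ltW k0) k1 => /(_ isT).
  by congr (_ < _)%E; apply: eq_eseriesr => n _; rewrite mul1r.
have part N : (\sum_(0 <= n < N) m n <= \sum_(0 <= n <oo) m n)%E.
  by apply: nneseries_lim_ge => n _ _; exact: m0.
have mfin n : m n \is a fin_num.
  rewrite ge0_fin_numE//; apply: le_lt_trans msum; apply: le_trans (part n.+1).
  by rewrite big_nat_recr//= leeDr// sume_ge0.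
have sfin : (\sum_(0 <= n <oo) m n)%E \is a fin_num.
  by rewrite ge0_fin_numE// nneseries_ge0.
exists (fun n => fine (m n)), (fine (\sum_(0 <= n <oo) m n)%E); split.
- by move=> n; rewrite fine_ge0.
- move=> N; rewrite -lee_fin fineK// -sumEFin.
  apply: le_trans (part N); rewrite big_mkord.
  by apply: lee_sum => i _; rewrite fineK.
move=> n x y xI yI xy; rewrite -!lee_fin !fineK//.
have osc (p : R -> R) : (`|p x - p y|%:E <= oscillation p (k ^+ n))%E.
  apply: ereal_sup_ubound; exists x, (y - x).
  rewrite subrKC distrC; split => //; by rewrite distrC.
by split; rewrite le_max osc ?orbT.
Qed.

Lemma dini_uniform (e : R) : dini p0 p1 -> 0 < e ->
  exists2 d : R, 0 < d & forall x y, 0 <= x <= 1 -> 0 <= y <= 1 -> `|x - y| < d ->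
    `|p0 x - p0 y| <= e /\ `|p1 x - p1 y| <= e.
Proof.
move=> D e0.
have [|b [S [b0 bS bo]]] := dini_coefficients D (_ : 0 < 2^-1 < 1).
  by apply/andP; split; lra.
have [n bn] := dini_coeff_small bS e0.
have hn : 0 < (2^-1 : R) ^+ n by rewrite exprn_gt0.
have hn1 : (2^-1 : R) ^+ n <= 1 by rewrite exprn_ile1//; lra.
exists (2^-1 ^+ n) => // x y xI yI xy.
have [xI'|xI'] := boolP (0 < x < 1).
  by have [h0 h1] := bo n x y xI' yI (ltW xy); split; lra.
have [yI'|yI'] := boolP (0 < y < 1).
  have yx : `|y - x| <= 2^-1 ^+ n by rewrite distrC ltW.
  by have [h0 h1] := bo n y x yI' xI yx; rewrite (distrC (p0 x)) (distrC (p1 x)); split; lra.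
(* [oscillation] needs one interior point; two endpoints at distance less than [1] coincide. *)
suff -> : x = y by rewrite !subrr normr0 ltW.
have xy1 : `|x - y| < 1 by exact: lt_le_trans hn1.
move: xy1 xI' yI'; rewrite ltr_norml !negb_and -!leNgt => /andP[? ?].
by move=> /orP[?|?] /orP[?|?]; lra.
Qed.

Lemma dini_lower_bound : dini p0 p1 ->
  (forall x, 0 <= x <= 1 -> 0 < p0 x /\ 0 < p1 x) ->
  exists2 delta : R, 0 < delta & forall x, 0 <= x <= 1 -> delta <= p0 x /\ delta <= p1 x.
Proof.
move=> D pp.
have cont (p : R -> R) : (forall e : R, 0 < e -> exists2 d : R, 0 < d &
    forall x y, 0 <= x <= 1 -> 0 <= y <= 1 -> `|x - y| < d -> `|p x - p y| <= e) ->
    {within `[0, 1], continuous p}.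
  move=> H; apply/subspace_continuousP => x; rewrite /= in_itv/= => xI.
  apply/cvgrPdist_le => e /H[d d0 Hd]; rewrite near_withinE.
  exists d => //= y xy; rewrite in_itv/= => yI; exact: Hd.
have min (p : R -> R) : {within `[0, 1], continuous p} ->
    (forall x, 0 <= x <= 1 -> 0 < p x) ->
    exists2 d : R, 0 < d & forall x, 0 <= x <= 1 -> d <= p x.
  move=> cp pos; have [c cI Hc] := EVT_min ler01 cp.
  exists (p c); first by apply: pos; move: cI; rewrite in_itv.
  by move=> x xI; apply: Hc; rewrite in_itv.
have [||d0 d00 H0] := min p0.
- apply: cont => e e0; have [d d0 H] := dini_uniform D e0.
  by exists d => // x y xI yI xy; have [] := H x y xI yI xy.
- by move=> x /pp[].
have [||d1 d10 H1] := min p1.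
- apply: cont => e e0; have [d d0' H] := dini_uniform D e0.
  by exists d => // x y xI yI xy; have [] := H x y xI yI xy.
- by move=> x /pp[].
exists (Num.min d0 d1); first by rewrite lt_min d00.
by move=> x xI; rewrite !ge_min H0// H1// orbT.
Qed.

Lemma dini_continuous : dini p0 p1 -> forall x, 0 < x < 1 ->
  {for x, continuous p0} /\ {for x, continuous p1}.
Proof.
move=> D x xI.
have I01 : \forall y \near x, 0 < y < 1.
  by have := @near_in_itvoo R 0 1 x; rewrite in_itv/= => /(_ xI); apply: filterS => y; rewrite in_itv.
by split; apply/cvgrPdist_le => e e0; have [d d0 H] := dini_uniform D e0;
  apply: filterS2 I01 (nbhsx_ballx x d d0) => y yI xy; have [||//] := H x y _ _ xy; lra.
Qed.

End dini_modulus.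

(** * The operator on measures *)

Section weighted_pushforward.
Context (R : realType).
Local Notation T := (measurableTypeR R).
Local Notation D := (`]0%R, 1%R[%classic : set T).

Variables (mu : {measure set T -> \bar R}) (p f : R -> R).
Hypothesis mp : measurable_fun D p.
Hypothesis p0 : forall x, 0 < x < 1 -> 0 <= p x.
Hypothesis mf : measurable_fun [set: T] (f : T -> T).

Let mD : measurable D. Proof. exact: measurable_itv. Qed.

Let mfA (A : set T) : measurable A -> measurable (D `&` f @^-1` A).
Proof. by move=> mA; apply: measurableI => //; rewrite -[X in measurable X]setTI; exact: mf. Qed.

Let Dp (A : set T) x : (D `&` A) x -> (0 <= (p x)%:E)%E.
Proof. by move=> [/=]; rewrite in_itv/= => xI _; rewrite lee_fin p0. Qed.

(** The equality holds for all sets, measurable or not, so that [markov_operator] equals a measure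
    as a function and can be rewritten inside [iter]. *)
Lemma weighted_pushforward_exists : exists nu : {measure set T -> \bar R},
  forall A, nu A = (\int[mu]_(x in D `&` f @^-1` A) (p x)%:E)%E.
Proof.
pose phi (A : set T) : \bar R := (\int[mu]_(x in D `&` f @^-1` A) (p x)%:E)%E.
have phi0 : phi set0 = 0%E by rewrite /phi preimage_set0 setI0 integral_set0.
have phi_ge0 A : (0 <= phi A)%E by apply: integral_ge0 => x /Dp.
have phi_sa : semi_sigma_additive phi.
  move=> F mF tF mUF; apply: cvg_toP.
    apply: ereal_nondecreasing_is_cvgn => m n mn.
    by apply: lee_sum_nneg_natr => // k _ _; exact: phi_ge0.
  rewrite /phi preimage_bigcup setI_bigcupr ge0_integral_bigcup//.
  - by move=> k; exact: mfA.
  - apply/measurable_EFinP; apply: measurable_funS mp => //.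
    by move=> x [n _ []].
  - by move=> x [n _ /Dp].
  - by move=> i j _ _ [x [[_ Fi] [_ Fj]]]; apply: tF => //; exists (f x).
pose m := isMeasure.Build _ T R phi phi0 phi_ge0 phi_sa.
by exists (HB.pack_for {measure set T -> \bar R} phi m).
Qed.

Import HBNNSimple.

(** Change of variables, passing from indicators to simple functions and then to monotone limits. *)
Lemma integral_weighted_pushforward (nu : {measure set T -> \bar R}) (g : T -> \bar R) :
  (forall A, measurable A -> nu A = (\int[mu]_(x in D `&` f @^-1` A) (p x)%:E)%E) ->
  measurable_fun [set: T] g -> (forall x, 0 <= g x)%E ->
  (\int[nu]_x g x = \int[mu]_(x in D) ((p x)%:E * g (f x)))%E.
Proof.
move=> nuE mg g0.
have mpE : measurable_fun D (EFin \o p) by exact/measurable_EFinP.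
have indic A : measurable A -> (nu A = \int[mu]_(x in D) ((p x)%:E * (\1_A (f x))%:E))%E.
  move=> mA; rewrite nuE// integral_mkcondr; apply: eq_integral => x xD.
  rewrite /patch indicE; have -> : (x \in f @^-1` A) = (f x \in A) by [].

  by case: (f x \in A); rewrite ?mule1 ?mule0.
have simple (h : {nnsfun T >-> R}) :
    (\int[nu]_x (h x)%:E = \int[mu]_(x in D) ((p x)%:E * (h (f x))%:E))%E.
  have mI r : measurable_fun D (fun x => \1_(h @^-1` [set r]) (f x) : R).
    apply: measurable_funTS.
    by apply: (measurableT_comp _ mf); exact: measurable_indic.
  rewrite integralT_nnsfun sintegralE.
  under [RHS]eq_integral => x _.
    rewrite fimfunE -fsumEFin// ge0_mule_fsumr; last first.
      by move=> r; rewrite EFinM nnfun_muleindic_ge0.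
    over.
  rewrite /= ge0_integral_fsum//; last 2 first.
  - move=> r; apply: emeasurable_funM => //.
    by apply/measurable_EFinP; apply: measurable_funM => //; exact: mI.
  - move=> r x; rewrite /= in_itv/= => xI; rewrite mule_ge0 ?lee_fin//; first exact: p0.
    by rewrite -lee_fin EFinM nnfun_muleindic_ge0.
  apply: eq_fsbigr => r /[!inE] -[z _ <-].
  rewrite indic// -ge0_integralZl ?lee_fin//.
  - by apply: eq_integral => x _; rewrite EFinM muleCA.
  - by apply: emeasurable_funM => //; apply/measurable_EFinP; exact: mI.
  - by move=> x; rewrite /= in_itv/= => xI; rewrite mule_ge0 ?lee_fin//; exact: p0.
pose g_ := nnsfun_approx measurableT mg.
transitivity (\int[nu]_x (limn (fun n => (g_ n x)%:E)))%E.
  by apply/eq_integral => z _; apply/esym/cvg_lim => //=; exact: cvg_nnsfun_approx.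
rewrite monotone_convergence//; last 3 first.
  by move=> n; exact/measurable_EFinP.
  by move=> n z _; rewrite lee_fin.
  by move=> z _ a b ab; rewrite lee_fin; exact/lefP/nd_nnsfun_approx.
under eq_fun do rewrite simple.
rewrite -monotone_convergence//.
- apply: eq_integral => x /[!inE]/= xD.
  by apply/cvg_lim => //; apply: cvgeZl => //; exact: cvg_nnsfun_approx.
- move=> n; apply: emeasurable_funM => //; apply/measurable_EFinP.
  by apply: measurable_funTS; apply: (measurableT_comp _ mf).
- move=> n x; rewrite /= in_itv/= => xI; rewrite mule_ge0 ?lee_fin//; exact: p0.
- move=> x; rewrite /= in_itv/= => xI m n mn; apply: lee_wpmul2l; first by rewrite lee_fin p0.
  by rewrite lee_fin; have /lefP/(_ (f x)) := nd_nnsfun_approx measurableT mg mn.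
Qed.

End weighted_pushforward.

Section markov_operator_measure.
Context (R : realType) (x0 y0 : R) (p0 p1 : R -> R).
Local Notation T := (measurableTypeR R).
Local Notation D := (`]0%R, 1%R[%classic : set T).
Local Notation f0 := (map0 x0 y0).
Local Notation f1 := (map1 x0 y0).
Local Notation P := (markov_operator x0 y0 p0 p1).
Local Notation U := (transfer f0 f1 p0 p1).

Hypothesis mp0 : measurable_fun D p0.
Hypothesis mp1 : measurable_fun D p1.
Hypothesis p0_ge0 : forall x, 0 < x < 1 -> 0 <= p0 x.
Hypothesis p1_ge0 : forall x, 0 < x < 1 -> 0 <= p1 x.
Hypothesis p_sum : forall x, 0 < x < 1 -> p0 x + p1 x = 1.
Hypothesis mf0 : measurable_fun [set: T] (f0 : T -> T).
Hypothesis mf1 : measurable_fun [set: T] (f1 : T -> T).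
Hypothesis f0I : forall x, 0 < x < 1 -> 0 < f0 x < 1.
Hypothesis f1I : forall x, 0 < x < 1 -> 0 < f1 x < 1.

Let mD : measurable D. Proof. exact: measurable_itv. Qed.

Lemma markov_operator_probability (mu : probability T R) : carried_by_01 mu ->
  exists nu : probability T R,
  [/\ carried_by_01 nu, (nu : set T -> \bar R) = P mu &
      forall h : R -> R, measurable_fun D h -> (forall x, 0 < x < 1 -> 0 <= h x) ->
        (\int[nu]_(x in D) (h x)%:E = \int[mu]_(x in D) (U h x)%:E)%E].
Proof.
move=> mu1.
have [nu0 nu0E] := weighted_pushforward_exists mu mp0 p0_ge0 mf0.
have [nu1 nu1E] := weighted_pushforward_exists mu mp1 p1_ge0 mf1.
pose nu := measure_add nu0 nu1.
have nuP : (nu : set T -> \bar R) = P mu.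
  by apply/funext => A; rewrite /nu measure_addE nu0E nu1E.
have total A : D `<=` A -> P mu A = 1%E.
  move=> DA; rewrite /markov_operator.
  have -> : D `&` f0 @^-1` A = D.
    by apply/setIidPl => x /=; rewrite in_itv/= => /f0I xI; apply: DA; rewrite /= in_itv.
  have -> : D `&` f1 @^-1` A = D.
    by apply/setIidPl => x /=; rewrite in_itv/= => /f1I xI; apply: DA; rewrite /= in_itv.
  have q0 x : D x -> (0 <= (p0 x)%:E)%E by rewrite /= in_itv/= lee_fin; exact: p0_ge0.
  have q1 x : D x -> (0 <= (p1 x)%:E)%E by rewrite /= in_itv/= lee_fin; exact: p1_ge0.
  have m0 : measurable_fun D (EFin \o p0) by exact/measurable_EFinP.
  have m1 : measurable_fun D (EFin \o p1) by exact/measurable_EFinP.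
  rewrite -(ge0_integralD _ mD q0 m0 q1 m1) -[RHS]mu1 -[RHS]mul1e -integral_cst//.
  apply: eq_integral => x.
  by rewrite inE/= in_itv/= => xI; rewrite -EFinD p_sum.
have nuT : nu setT = 1%E by rewrite nuP total.
pose mm := Measure_isProbability.Build _ _ _ nu nuT.
pose Nu := HB.pack_for (probability T R) (Measure.sort nu) mm.
exists Nu; split => //.
  by rewrite /carried_by_01 -[LHS]/(nu D) nuP total.
move=> h mh h0.
(* Only the values of [h] on [D] are controlled, while the two pushforwards are integrated over the
   whole line. *)
pose g : T -> \bar R := (EFin \o h) \_ D.
have mg : measurable_fun [set: T] g.
  by apply/(measurable_restrictT _ mD); exact/measurable_EFinP.
have g0 x : (0 <= g x)%E.
  by apply: erestrict_ge0 => y /=; rewrite in_itv/= lee_fin; exact: h0.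
have gE x : 0 < x < 1 -> g x = (h x)%:E.
  by move=> xI; rewrite /g patchT//; apply/mem_set; rewrite /= in_itv.
have mhf (f : R -> R) : measurable_fun [set: T] (f : T -> T) ->
    (forall x, 0 < x < 1 -> 0 < f x < 1) -> measurable_fun D (fun x => h (f x)).
  move=> mf fI; apply: (measurable_comp mD _ mh); last exact: measurable_funTS.
  by move=> _ [x /= + <-]; rewrite !in_itv/=; exact: fI.
rewrite integral_mkcond -[LHS]/(\int[nu]_x g x)%E.
rewrite ge0_integral_measure_add//.
rewrite (integral_weighted_pushforward mp0 p0_ge0 mf0 (fun A _ => nu0E A) mg g0).
rewrite (integral_weighted_pushforward mp1 p1_ge0 mf1 (fun A _ => nu1E A) mg g0).
have E0 : (\int[mu]_(x in D) ((p0 x)%:E * g (f0 x)) =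
    \int[mu]_(x in D) (p0 x * h (f0 x))%:E)%E.
  by apply: eq_integral => x; rewrite inE/= in_itv/= => /f0I /gE ->; rewrite EFinM.
have E1 : (\int[mu]_(x in D) ((p1 x)%:E * g (f1 x)) =
    \int[mu]_(x in D) (p1 x * h (f1 x))%:E)%E.
  by apply: eq_integral => x; rewrite inE/= in_itv/= => /f1I /gE ->; rewrite EFinM.
have q0 x : D x -> (0 <= (p0 x * h (f0 x))%:E)%E.
  by rewrite /= in_itv/= lee_fin => xI; rewrite mulr_ge0 ?p0_ge0 ?h0 ?f0I.
have q1 x : D x -> (0 <= (p1 x * h (f1 x))%:E)%E.
  by rewrite /= in_itv/= lee_fin => xI; rewrite mulr_ge0 ?p1_ge0 ?h0 ?f1I.
have m0 : measurable_fun D (EFin \o (fun x => p0 x * h (f0 x))).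
  by apply/measurable_EFinP; apply: measurable_funM => //; exact: mhf.
have m1 : measurable_fun D (EFin \o (fun x => p1 x * h (f1 x))).
  by apply/measurable_EFinP; apply: measurable_funM => //; exact: mhf.
by rewrite E0 E1 -(ge0_integralD _ mD q0 m0 q1 m1).
Qed.

Lemma measurable_transfer h : measurable_fun D h -> measurable_fun D (U h).
Proof.
move=> mh.
have mhf (f : R -> R) : measurable_fun [set: T] (f : T -> T) ->
    (forall x, 0 < x < 1 -> 0 < f x < 1) -> measurable_fun D (fun x => h (f x)).
  move=> mf fI; apply: (measurable_comp mD _ mh); last exact: measurable_funTS.
  by move=> _ [x /= + <-]; rewrite !in_itv/=; exact: fI.
by apply: measurable_funD; apply: measurable_funM => //; exact: mhf.
Qed.

Lemma iter_markov_operator n (mu : probability T R) : carried_by_01 mu ->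
  exists nu : probability T R,
  [/\ carried_by_01 nu, (nu : set T -> \bar R) = iter n P mu &
      forall h : R -> R, measurable_fun D h -> (forall x, 0 < x < 1 -> 0 <= h x) ->
        (\int[nu]_(x in D) (h x)%:E = \int[mu]_(x in D) (iter n U h x)%:E)%E].
Proof.
move=> mu1; elim: n => [|n [nu [nu1 nuE nuU]]]; first by exists mu.
have [nu' [nu'1 nu'E nu'U]] := markov_operator_probability nu1.
exists nu'; split => //; first by rewrite iterS -nuE.
move=> h mh h0; rewrite nu'U// nuU.
- by rewrite iterSr.
- exact: measurable_transfer.
- by move=> x xI; rewrite addr_ge0 ?mulr_ge0 ?p0_ge0 ?p1_ge0 ?h0 ?f0I ?f1I.
Qed.

End markov_operator_measure.

(** * Positive functionals and their representing measures *)

Lemma lipschitz_continuous_at (R : realType) (f : R -> R) (K : R) :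
  (forall x y, `|f x - f y| <= K * `|x - y|) -> continuous f.
Proof.
move=> fK x; apply/cvgrPdist_le => e e0.
have K1 : 0 < `|K| + 1 by rewrite ltr_wpDl.
apply: filterS (nbhsx_ballx x _ (divr_gt0 e0 K1)) => y.
rewrite /ball/= ltr_pdivlMr// mulrC => xy; apply: (le_trans (fK x y)).
by apply: le_trans (ltW xy); rewrite ler_wpM2r//; have := ler_norm K; lra.
Qed.

(** * Continuous substitutes for indicators of half-lines *)

Section ramp.
Context (R : realType).
Implicit Types t h x : R.

Definition clamp (u : R) : R := if u <= 0 then 0 else if 1 <= u then 1 else u.

Lemma clamp_itv u : 0 <= clamp u <= 1.
Proof. by rewrite /clamp; case: (leP u 0) => ?; last case: (leP 1 u) => ?; lra. Qed.

Lemma clamp_le u v : u <= v -> clamp u <= clamp v.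
Proof.
by rewrite /clamp => ?; case: (leP u 0) => ?; case: (leP v 0) => ?;
  case: (leP 1 u) => ?; case: (leP 1 v) => ?; lra.
Qed.

Lemma clamp_shift u s : 0 <= s -> clamp (u + s) <= clamp u + s.
Proof.
by rewrite /clamp => ?; case: (leP u 0) => ?; case: (leP (u + s) 0) => ?;
  case: (leP 1 u) => ?; case: (leP 1 (u + s)) => ?; lra.
Qed.

Lemma clamp_ge1 u : 1 <= u -> clamp u = 1.
Proof. by move=> u1; rewrite /clamp u1 leNgt (lt_le_trans ltr01 u1). Qed.

Lemma clamp_le0 u : u <= 0 -> clamp u = 0.
Proof. by rewrite /clamp => ->. Qed.

(** Equal to [1] up to [t], then falling linearly to [0] at [t + h]. *)
Definition ramp t h x : R := clamp (1 - (x - t) / h).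

Lemma ramp_itv t h x : 0 <= ramp t h x <= 1.
Proof. exact: clamp_itv. Qed.

Lemma ramp_le t t' h x : 0 < h -> t <= t' -> ramp t h x <= ramp t' h x.
Proof.
by move=> h0 tt; apply: clamp_le; rewrite lerD2l lerN2 ler_pM2r ?invr_gt0//; lra.
Qed.

Lemma ramp_eq1 t h x : 0 < h -> x <= t -> ramp t h x = 1.
Proof.
move=> h0 xt; apply: clamp_ge1; rewrite lerDl oppr_ge0 pmulr_lle0 ?invr_gt0//; lra.
Qed.

Lemma ramp_eq0 t h x : 0 < h -> t + h <= x -> ramp t h x = 0.
Proof.
by move=> h0 xt; apply: clamp_le0; rewrite subr_le0 ler_pdivlMr//; lra.
Qed.

Lemma ramp_step t t' h h' x : 0 < h -> 0 < h' -> t + h <= t' -> ramp t h x <= ramp t' h' x.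
Proof.
move=> h0 h0' tt; have [xt|/ltW xt] := leP x t'.
  by rewrite (ramp_eq1 h0' xt); have /andP[] := ramp_itv t h x.
by rewrite ramp_eq0//; [have /andP[] := ramp_itv t' h' x|lra].
Qed.

Lemma ramp_shift t h s x : 0 < h -> 0 <= s -> ramp (t + s) h x <= ramp t h x + s / h.
Proof.
move=> h0 s0; rewrite /ramp; have -> : 1 - (x - (t + s)) / h = 1 - (x - t) / h + s / h by field; lra.
by apply: clamp_shift; rewrite divr_ge0// ltW.
Qed.

Lemma ramp_lipschitz t h x y : 0 < h -> `|ramp t h x - ramp t h y| <= h^-1 * `|x - y|.
Proof.
move=> h0; wlog xy : x y / x <= y => [H|].
  by have [|/ltW] := leP x y => /H//; rewrite distrC (distrC x).
have -> : `|x - y| = y - x by rewrite distrC ger0_norm// subr_ge0.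
have s0 : 0 <= (y - x) / h by rewrite divr_ge0 ?subr_ge0// ltW.
have E : 1 - (x - t) / h = 1 - (y - t) / h + (y - x) / h by field; lra.
rewrite mulrC ger0_norm; last first.
  by rewrite subr_ge0; apply: clamp_le; rewrite E lerDl.
by rewrite /ramp E; have := clamp_shift (1 - (y - t) / h) s0; lra.
Qed.

End ramp.

(** * Normalized positive functionals on bounded continuous functions *)

Section bounded_continuous01.
Context (R : realType).
Implicit Types f g : R -> R.

Definition bounded_continuous01 g :=
  (forall x, 0 < x < 1 -> {for x, continuous g}) /\
  exists M : R, forall x, 0 < x < 1 -> `|g x| <= M.

Lemma bounded_continuous01_cst (c : R) : bounded_continuous01 (fun=> c).
Proof. by split; [move=> x _; exact: cvg_cst|exists `|c|]. Qed.

Lemma bounded_continuous01_lin (a b : R) f g : bounded_continuous01 f -> bounded_continuous01 g ->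
  bounded_continuous01 (fun x => a * f x + b * g x).
Proof.
move=> [fc [M fM]] [gc [N gN]]; split.
  move=> x xI; apply: cvgD; apply: cvgM; [exact: cvg_cst|exact: fc|exact: cvg_cst|exact: gc].
exists (`|a| * M + `|b| * N) => x xI; apply: (le_trans (ler_normD _ _)).
by rewrite !normrM lerD// ler_wpM2l// ?fM ?gN.
Qed.

Lemma bounded_continuous01_ramp t h : 0 < h -> bounded_continuous01 (@ramp R t h).
Proof.
move=> h0; split.
  by move=> x _; apply: (@lipschitz_continuous_at _ _ h^-1) => y z; exact: ramp_lipschitz.
by exists 1 => x _; have /andP[? ?] := ramp_itv t h x; rewrite ger0_norm.
Qed.

Lemma bounded_continuous01_sum n (c : nat -> R) (f : nat -> R -> R) :
  (forall i, bounded_continuous01 (f i)) ->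
  bounded_continuous01 (fun x => \sum_(i < n) c i * f i x).
Proof.
move=> fb; elim: n => [|n IH].
  have := bounded_continuous01_cst 0; congr bounded_continuous01.
  by apply/funext => x; rewrite big_ord0.
have := bounded_continuous01_lin 1 (c n) IH (fb n); congr bounded_continuous01.
by apply/funext => x; rewrite big_ord_recr/= mul1r.
Qed.

Definition positive_functional01 (L : (R -> R) -> R) :=
  [/\ forall a b f g, bounded_continuous01 f -> bounded_continuous01 g ->
        L (fun x => a * f x + b * g x) = a * L f + b * L g,
      forall f g, bounded_continuous01 f -> bounded_continuous01 g ->
        (forall x, 0 < x < 1 -> f x <= g x) -> L f <= L g &
      L (fun=> 1) = 1].

Lemma positive_functional01_sum L n (c : nat -> R) (f : nat -> R -> R) :
  positive_functional01 L -> (forall i, bounded_continuous01 (f i)) ->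
  L (fun x => \sum_(i < n) c i * f i x) = \sum_(i < n) c i * L (f i).
Proof.
move=> [Llin _ _] fb; elim: n => [|n IH].
  rewrite big_ord0.
  have c0 := bounded_continuous01_cst 0.
  have := Llin 0 0 _ _ c0 c0; rewrite !mul0r addr0 => E; rewrite -[RHS]E.
  by congr L; apply/funext => x; rewrite big_ord0.
rewrite big_ord_recr/= -IH -[X in X + _]mul1r -Llin//; last exact: bounded_continuous01_sum.
by congr L; apply/funext => x; rewrite big_ord_recr/= mul1r.
Qed.

Lemma positive_functional01_dist L f g h : positive_functional01 L ->
  bounded_continuous01 f -> bounded_continuous01 g -> bounded_continuous01 h ->
  (forall x, 0 < x < 1 -> `|f x - g x| <= h x) -> `|L f - L g| <= L h.
Proof.
move=> [Llin Lle _] fb gb hb H.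
have E (a : R) : L (fun x => 1 * f x + a * g x) = L f + a * L g by rewrite Llin// mul1r.
have fgb (a : R) : bounded_continuous01 (fun x => 1 * f x + a * g x).
  exact: bounded_continuous01_lin.
have hN : L (fun x => (-1) * h x + 0 * h x) = - L h by rewrite Llin//; ring.
have h1 : L (fun x => 1 * f x + (-1) * g x) <= L h.
  by apply: Lle => // x /H; rewrite ler_norml => /andP[? ?]; lra.
have h2 : L (fun x => (-1) * h x + 0 * h x) <= L (fun x => 1 * f x + (-1) * g x).
  apply: Lle => //; first exact: bounded_continuous01_lin.
  by move=> x /H; rewrite ler_norml => /andP[? ?]; lra.
by move: h1 h2; rewrite hN E => ? ?; rewrite ler_norml; apply/andP; split; lra.
Qed.

End bounded_continuous01.

(** * Functionals with the same distribution function agree *)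

Section functional_determined_by_ramps.
Context (R : realType) (F : R -> R) (L1 L2 : (R -> R) -> R).
Hypothesis L1_pos : positive_functional01 L1.
Hypothesis L2_pos : positive_functional01 L2.
Hypothesis F_nd : forall s t, s <= t -> F s <= F t.
Hypothesis F_rc : forall t e : R, 0 < e -> exists2 h : R, 0 < h & F (t + h) <= F t + e.
Hypothesis F_tight : forall e : R, 0 < e ->
  exists2 a : R, 0 < a < 2^-1 & F (2 * a) <= e /\ 1 - e <= F (1 - a).
Hypothesis L1_F : forall t h : R, 0 < t -> 0 < h -> F t <= L1 (ramp t h) <= F (t + h).
Hypothesis L2_F : forall t h : R, 0 < t -> 0 < h -> F t <= L2 (ramp t h) <= F (t + h).

Let F_rc_seq (t : nat -> R) n (e : R) : 0 < e ->
  exists2 h : R, 0 < h & forall i, (i <= n)%N -> F (t i + h) <= F (t i) + e.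
Proof.
move=> e0; elim: n => [|n [h h0 Hh]].
  by have [h h0 Hh] := F_rc (t 0%N) e0; exists h => // i; rewrite leqn0 => /eqP ->.
have [h' h'0 Hh'] := F_rc (t n.+1) e0.
exists (Num.min h h'); first by rewrite lt_min h0.
move=> i; rewrite leq_eqVlt => /orP[/eqP ->|]; [apply: le_trans Hh'|move=> /Hh; apply: le_trans];
  by apply: F_nd; rewrite lerD2l ge_min lexx ?orbT.
Qed.

(* Approximate [g] by [\sum_i g (t_i) (ramp t_(i+1) h - ramp t_i h)]. *)
Lemma functional_eq g : bounded_continuous01 g -> L1 g = L2 g.
Proof.
move=> gb; have [gc [M gM]] := gb.
have M0 : 0 <= M by apply: le_trans (gM 2^-1 _) => //; apply/andP; split; lra.
(* Each functional is within [(1 + 2 * M) * e] of its Riemann sum, and the two sums differ by at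
   most [e]. *)
suff H (e : R) : 0 < e -> `|L1 g - L2 g| <= (3 + 4 * M) * e.
  apply/eqP; rewrite -subr_eq0 -normr_le0; apply/ler_addgt0Pl => e e0; rewrite addr0.
  have c0 : 0 < 3 + 4 * M by lra.
  have E : (3 + 4 * M) * (e / (3 + 4 * M)) = e by rewrite mulrC divfK// gt_eqF.
  by have := H _ (divr_gt0 e0 c0); rewrite E.
move=> e0; have [a /andP[a0 a1] [Fa F1a]] := F_tight e0.
have [d d0 Hd] := uniform_continuity_compactly_in01 gc a0 e0.
(* Each increment [w i] will live on an interval of length at most twice the mesh, since the ramps
   have width [h <= dl]. *)
have [m m0 md] : exists2 m : nat, (0 < m)%N & 2 * ((1 - 2 * a) / m%:R) < d.
  exists (Num.truncn (2 * (1 - 2 * a) / d)).+1 => //.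
  have := truncnS_gt (2 * (1 - 2 * a) / d); rewrite ltr_pdivrMr// => ?.
  by rewrite mulrA ltr_pdivrMr ?ltr0n// [ltRHS]mulrC.
have mR : 0 < m%:R :> R by rewrite ltr0n.
pose dl := (1 - 2 * a) / m%:R.
have dl0 : 0 < dl by rewrite divr_gt0//; lra.
pose t i := a + i%:R * dl.
have tS i : t i.+1 = t i + dl by rewrite /t -natr1; ring.
have t_m : t m = 1 - a by rewrite /t mulrC divfK ?gt_eqF//; ring.
have t_0 : t 0%N = a by rewrite /t; ring.
have t_ge i : a <= t i by rewrite lerDl mulr_ge0 ?ler0n// ltW.
have t_le i : (i <= m)%N -> t i <= 1 - a.
  by move=> im; rewrite -t_m lerD2l ler_pM2r// ler_nat.
have em : 0 < e / (m%:R * (2 * M + 1)) by rewrite divr_gt0// mulr_gt0//; lra.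
(* On the ramp at a grid point both functionals lie between [F (t i)] and [F (t i + h)]; right
   continuity at all grid points makes their total discrepancy over [m] increments at most [e]. *)
have [h' h'0 Hh'] := F_rc_seq t m em.
pose h := Num.min h' (Num.min dl a).
have h0 : 0 < h by rewrite !lt_min h'0 dl0.
have hh' : h <= h' by rewrite ge_min lexx.
have hdl : h <= dl by rewrite !ge_min lexx orbT.
have ha : h <= a by rewrite !ge_min lexx !orbT.
pose r i := ramp (t i) h.
have rb i : bounded_continuous01 (r i) by exact: bounded_continuous01_ramp.
pose w i x := 1 * r i.+1 x + (-1) * r i x.
have wb i : bounded_continuous01 (w i) by exact: bounded_continuous01_lin.
have w0 i x : 0 <= w i x.
  rewrite /w mul1r mulN1r subr_ge0; apply: ramp_le => //; rewrite tS; lra.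
have wsum x : \sum_(i < m) w i x = r m x - r 0%N x.
  rewrite -(big_mkord xpredT (fun i => w i x)) (eq_bigr (fun i => r i.+1 x - r i x)).
    by rewrite telescope_sumr.
  by move=> i _; rewrite /w mul1r mulN1r.
pose s x := \sum_(i < m) g (t i) * w i x.
have sb : bounded_continuous01 s by exact: (@bounded_continuous01_sum _ m (fun i => g (t i))).
(* That is, [e] plus [M] times the part of [1] not covered by the increments [w i]. *)
pose q x := 1 * (e + M) + M * (1 * r 0%N x + (-1) * r m x).
have rm_b : bounded_continuous01 (fun x => 1 * r 0%N x + (-1) * r m x).
  exact: bounded_continuous01_lin.
have qb : bounded_continuous01 q.
  by apply: bounded_continuous01_lin => //; exact: bounded_continuous01_cst.
have gs x : 0 < x < 1 -> `|g x - s x| <= q x.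
  move=> xI.
  have wle i : (i < m)%N -> `|g x - g (t i)| * w i x <= e * w i x.
    move=> im; have [xt|tx] := leP x (t i).
      suff -> : w i x = 0 by rewrite !mulr0.
      by rewrite /w /r !ramp_eq1 ?tS//; [ring|lra].
    have [tx'|xt'] := leP (t i.+1 + h) x.
      suff -> : w i x = 0 by rewrite !mulr0.
      by rewrite /w /r !ramp_eq0//; [ring|rewrite tS in tx'; lra].
    rewrite ler_wpM2r// distrC; apply: Hd.
      by rewrite t_ge t_le// ltnW.
    rewrite distrC ger0_norm ?subr_ge0 ?(ltW tx)//.
    by rewrite tS in xt'; move: md; rewrite -/dl; lra.
  have -> : g x - s x = g x * (1 - (r m x - r 0%N x)) + \sum_(i < m) (g x - g (t i)) * w i x.
    have -> : \sum_(i < m) (g x - g (t i)) * w i x = g x * (r m x - r 0%N x) - s x.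
      by rewrite -wsum mulr_sumr /s -sumrB; apply: eq_bigr => i _; rewrite mulrBl.
    ring.
  apply: (le_trans (ler_normD _ _)).
  have /andP[r00 _] := ramp_itv (t 0%N) h x; have /andP[_ rm1] := ramp_itv (t m) h x.
  have rr : r m x - r 0%N x <= 1 by rewrite /r; lra.
  have h1 : `|g x * (1 - (r m x - r 0%N x))| <= M * (1 - (r m x - r 0%N x)).
    by rewrite normrM (ger0_norm (_ : 0 <= 1 - _)) ?subr_ge0// ler_wpM2r ?subr_ge0// gM.
  have h2 : `|\sum_(i < m) (g x - g (t i)) * w i x| <= e.
    apply: (le_trans (ler_norm_sum _ _ _)).
    apply: (@le_trans _ _ (\sum_(i < m) e * w i x)).
      by apply: ler_sum => i _; rewrite normrM (ger0_norm (w0 _ _)) wle.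
    by rewrite -mulr_sumr wsum ler_piMr// ltW.
  rewrite /q; lra.
have Ldist L : positive_functional01 L ->
    (forall t h : R, 0 < t -> 0 < h -> F t <= L (ramp t h) <= F (t + h)) ->
    `|L g - \sum_(i < m) g (t i) * (L (r i.+1) - L (r i))| <= (1 + 2 * M) * e.
  move=> Lp LF; have [Llin Lle Lone] := Lp.
  have -> : \sum_(i < m) g (t i) * (L (r i.+1) - L (r i)) = L s.
    rewrite (@positive_functional01_sum _ L m (fun i => g (t i)) w)//.
    by apply: eq_bigr => i _; rewrite Llin// mul1r mulN1r.
  apply: (le_trans (positive_functional01_dist Lp gb sb qb gs)).
  have Lc : L (fun=> e + M) = e + M.
    have := Llin (e + M) 0 _ _ (bounded_continuous01_cst 1) (bounded_continuous01_cst 1).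
    by rewrite Lone !mul0r mulr1 addr0.
  rewrite /q Llin//; last exact: bounded_continuous01_cst.
  rewrite Llin// Lc.
  have tm0 : 0 < t m by rewrite t_m; lra.
  have t00 : 0 < t 0%N by rewrite t_0.
  have /andP[_ l0] := LF (t 0%N) h t00 h0.
  have /andP[lm _] := LF (t m) h tm0 h0.
  have {}l0 : L (r 0%N) <= e.
    apply: (le_trans l0).
    by apply: le_trans Fa; apply: F_nd; rewrite t_0; lra.
  have {}lm : 1 - e <= L (r m) by apply: le_trans lm; rewrite t_m.
  have : M * (L (r 0%N) - L (r m)) <= M * (e - (1 - e)) by rewrite ler_wpM2l//; lra.
  lra.
have step i : (i <= m)%N -> `|L1 (r i) - L2 (r i)| <= e / (m%:R * (2 * M + 1)).
  move=> im; have ti : 0 < t i by exact: lt_le_trans (t_ge i).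
  have /andP[? ?] := L1_F ti h0; have /andP[? ?] := L2_F ti h0.
  have : F (t i + h) <= F (t i + h') by apply: F_nd; rewrite lerD2l.
  by have := Hh' i im => ? ?; rewrite ler_norml /r; apply/andP; split; lra.
have Ldiff : `|\sum_(i < m) g (t i) * (L1 (r i.+1) - L1 (r i)) -
    \sum_(i < m) g (t i) * (L2 (r i.+1) - L2 (r i))| <= e.
  rewrite -sumrB; apply: (le_trans (ler_norm_sum _ _ _)).
  apply: (@le_trans _ _ (\sum_(i < m) (2 * M + 1) * (e / (m%:R * (2 * M + 1))))).
    apply: ler_sum => i _; rewrite -mulrBr normrM.
    have h1 := step i (ltnW (ltn_ord i)); have h2 := step i.+1 (ltn_ord i).
    have h3 : `|g (t i)| <= M.
      by apply: gM; have := t_ge i; have := t_le i (ltnW (ltn_ord i)) => *; apply/andP; split; lra.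
    apply: (@le_trans _ _ (M * (2 * (e / (m%:R * (2 * M + 1)))))); last by lra.
    apply: ler_pM => //.
    have -> : L1 (r i.+1) - L1 (r i) - (L2 (r i.+1) - L2 (r i)) =
      (L1 (r i.+1) - L2 (r i.+1)) - (L1 (r i) - L2 (r i)) by ring.
    by apply: (le_trans (ler_normB _ _)); lra.
  rewrite sumr_const card_ord -mulr_natr le_eqVlt; apply/orP; left; apply/eqP; field.
  by apply/andP; split; [rewrite gt_eqF//; lra|rewrite gt_eqF].
have h1 := Ldist _ L1_pos L1_F; have h2 := Ldist _ L2_pos L2_F.
move: h1 h2 Ldiff; set S1 := \sum_(i < m) _ * _; set S2 := \sum_(i < m) _ * _.
rewrite !ler_norml => /andP[? ?] /andP[? ?] /andP[? ?].
by apply/andP; split; lra.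
Qed.

End functional_determined_by_ramps.

(** * Integration as a positive functional *)

Section integral_functional.
Context (R : realType).
Local Notation T := (measurableTypeR R).
Local Notation D := (`]0%R, 1%R[%classic : set T).
Variable nu : probability T R.
Hypothesis nu1 : carried_by_01 nu.

Let mD : measurable D. Proof. exact: measurable_itv. Qed.

Lemma bounded_continuous01_measurable (g : R -> R) : bounded_continuous01 g -> measurable_fun D g.
Proof.
move=> [gc _]; apply: open_continuous_measurable_fun; first exact: itv_open.
by move=> x; rewrite inE/= in_itv/=; exact: gc.
Qed.

Lemma bounded_continuous01_integrable (g : R -> R) : bounded_continuous01 g ->
  nu.-integrable D (EFin \o g).
Proof.
move=> gb; have mg := bounded_continuous01_measurable gb; have [_ [M gM]] := gb.
apply: measurable_bounded_integrable => //.
  by rewrite [X in (X < _)%E]nu1 ltry.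
exists M; split; first exact: num_real.
by move=> N MN x /=; rewrite in_itv/= => /gM /le_trans; apply; exact: ltW.
Qed.

Lemma integral_positive_functional01 :
  positive_functional01 (fun g => \int[nu]_(x in D) g x).
Proof.
have int := bounded_continuous01_integrable.
have intZ (a : R) f : bounded_continuous01 f -> nu.-integrable D (EFin \o (fun x => a * f x)).
  move=> fb; have := int _ (bounded_continuous01_lin a 0 fb fb).
  by congr (_.-integrable _ (_ \o _)); apply/funext => x; rewrite mul0r addr0.
split.
- move=> a b f g fb gb; rewrite (RintegralD mD (intZ a f fb) (intZ b g gb)).
  by rewrite (RintegralZl a mD (int _ fb)) (RintegralZl b mD (int _ gb)).
- move=> f g fb gb fg; apply: (le_Rintegral mD (int _ fb) (int _ gb)).
  by move=> x /=; rewrite in_itv/=; exact: fg.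
- by rewrite Rintegral_cst// mul1r [X in fine X]nu1.
Qed.

Lemma carried_by_01_setI (A : set T) : measurable A -> nu A = nu (A `&` D).
Proof.
move=> mA; rewrite (measureDI nu mA mD).
suff E : nu (A `\` D) = 0%E by rewrite [X in (X + _)%E]E add0e.
apply/eqP; rewrite -measure_le0.
have <- : nu (~` D) = 0%E by rewrite probability_setC// [X in (1 - X)%E]nu1 subee.
by apply: le_measure; rewrite ?inE; [exact: measurableD|exact: measurableC|move=> x []].
Qed.

Lemma integral_ramp_bounds (t h : R) : 0 < h ->
  (nu (`]-oo, t] `&` D) <= (\int[nu]_(x in D) ramp t h x)%:E <= nu (`]-oo, (t + h)%R] `&` D))%E.
Proof.
move=> h0; have rb := bounded_continuous01_ramp t h0.
have mr := bounded_continuous01_measurable rb.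
rewrite /Rintegral fineK; last exact: integrable_fin_num (bounded_continuous01_integrable rb).
have mrE : measurable_fun D (fun x => (ramp t h x)%:E) by exact/measurable_EFinP.
have mI s : measurable_fun D (fun x => (\1_(`]-oo, s] : set T) x)%:E : \bar R).
  by apply/measurable_EFinP; apply: measurable_indic; exact: measurable_itv.
rewrite -!(integral_indic nu mD); [|exact: measurable_itv|exact: measurable_itv].
apply/andP; split; apply: ge0_le_integral => // x _; rewrite lee_fin.
- rewrite indicE; case: (boolP (x \in _)) => [|_]; last by have /andP[] := ramp_itv t h x.
  by rewrite inE/= in_itv/= => xt; rewrite ramp_eq1.
- by have /andP[] := ramp_itv t h x.
- rewrite indicE; case: (boolP (x \in _)) => [_|]; first by have /andP[] := ramp_itv t h x.
  by rewrite notin_setE/= in_itv/= => /negP; rewrite -ltNge => /ltW tx; rewrite ramp_eq0.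
Qed.

End integral_functional.

(** * Representation of a tight positive functional by a measure *)

Section riesz.
Context (R : realType).
Local Notation T := (measurableTypeR R).
Local Notation D := (`]0%R, 1%R[%classic : set T).
Variable L : (R -> R) -> R.
Hypothesis L_pos : positive_functional01 L.
Hypothesis L_tight : forall e : R, 0 < e -> exists2 a : R, 0 < a < 2^-1 &
  forall g, bounded_continuous01 g -> (forall x, 0 < x < 1 -> 0 <= g x <= 1) ->
    (forall x, a <= x <= 1 - a -> g x = 0) -> L g <= e.

Let L_ramp_itv t h : 0 < h -> 0 <= L (ramp t h) <= 1.
Proof.
move=> h0; have [Llin Lle L1] := L_pos; have rb := bounded_continuous01_ramp t h0.
have c0 := @bounded_continuous01_cst R 0; have c1 := @bounded_continuous01_cst R 1.
have L0 : L (fun=> 0) = 0.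
  by have := Llin 0 0 _ _ c0 c0; rewrite !mul0r addr0.
by rewrite -{1}L0 -L1; apply/andP; split; apply: Lle => // x _; have /andP[] := ramp_itv t h x.
Qed.

(** Ramps decrease to the indicator of []-oo, t]] as [h] tends to [0], so this is the distribution
    function of the measure sought. *)
Definition ramp_inf (t : R) : R := inf [set L (ramp t h) | h in [set h : R | 0 < h]].
Local Notation F := ramp_inf.

Let F_has_inf t : has_inf [set L (ramp t h) | h in [set h : R | 0 < h]].
Proof.
split; first by exists (L (ramp t 1)), 1 => //=.
by exists 0 => _ [h /= h0 <-]; have /andP[] := L_ramp_itv t h0.
Qed.

Let F_le t h : 0 < h -> F t <= L (ramp t h).
Proof. by move=> h0; apply: ge_inf; [exact: (F_has_inf t).2|exists h]. Qed.

Let F_ge t c : (forall h, 0 < h -> c <= L (ramp t h)) -> c <= F t.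
Proof. by move=> H; apply: lb_le_inf; [exact: (F_has_inf t).1|move=> _ [h /= h0 <-]; exact: H]. Qed.

Let F_approx t e : 0 < e -> exists2 h : R, 0 < h & L (ramp t h) < F t + e.
Proof. by move=> e0; have [_ [h h0 <-] H] := inf_adherent e0 (F_has_inf t); exists h. Qed.

Let F_itv t : 0 <= F t <= 1.
Proof.
apply/andP; split; first by apply: F_ge => h h0; have /andP[] := L_ramp_itv t h0.
by apply: (le_trans (F_le t ltr01)); have /andP[] := L_ramp_itv t ltr01.
Qed.

Let F_nd : nondecreasing F.
Proof.
move=> s t st; apply: F_ge => h h0; apply: (le_trans (F_le s h0)).
have [_ Lle _] := L_pos; apply: Lle => [||x _]; try exact: bounded_continuous01_ramp.
exact: ramp_le.
Qed.

Let L_ramp_le t h : 0 < h -> L (ramp t h) <= F (t + h).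
Proof.
move=> h0; apply: F_ge => h' h'0.
have [_ Lle _] := L_pos; apply: Lle => [||x _]; try exact: bounded_continuous01_ramp.
exact: ramp_step.
Qed.

(** Take [h] nearly optimal at [t]: shifting that ramp by [s] raises it by at most [s / h]. *)
Let F_rc_le (t e : R) : 0 < e -> exists2 h : R, 0 < h & F (t + h) <= F t + e.
Proof.
move=> e0; have e2 : 0 < e / 2 by lra.
have [h h0 Hh] := F_approx t e2.
have s0 : 0 < h * (e / 2) by exact: mulr_gt0.
exists (h * (e / 2)) => //; apply: (le_trans (F_le _ h0)).
have [Llin Lle L1] := L_pos.
have rb := bounded_continuous01_ramp t h0; have c1 := @bounded_continuous01_cst R 1.
have : L (ramp (t + h * (e / 2)) h) <= L (fun x => 1 * ramp t h x + e / 2 * 1).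
  apply: Lle; [exact: bounded_continuous01_ramp|exact: bounded_continuous01_lin|].
  move=> x _; have := ramp_shift t x h0 (ltW s0).
  have -> : h * (e / 2) / h = e / 2 by field; lra.
  by rewrite mul1r mulr1.
rewrite (Llin 1 (e / 2) _ (fun=> 1))// L1; lra.
Qed.

Let F_rc x : F @ at_right x --> F x.
Proof.
apply/cvgrPdist_le => e e0; have [h h0 Hh] := F_rc_le x e0.
near=> y; have xy : x <= y by near: y; exact: nbhs_right_ge.
have yh : y <= x + h by near: y; apply: nbhs_right_le; lra.
have := F_nd xy; have := F_nd yh => ? ?.
by rewrite distrC ger0_norm ?subr_ge0//; lra.
Unshelve. all: by end_near. Qed.

Let F_tight e : 0 < e -> exists2 a : R, 0 < a < 2^-1 & F (2 * a) <= e /\ 1 - e <= F (1 - a).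
Proof.
move=> e0; have [a /andP[a0 a1] Ha] := L_tight e0.
have [Llin Lle L1] := L_pos; have c1 := @bounded_continuous01_cst R 1.
(* With this choice the ramp that starts at [2 * (a / 4)] with width [a / 2] vanishes from [a] on,
   as [L_tight] requires. *)
exists (a / 4); first by apply/andP; split; lra.
have a2 : 0 < a / 2 by lra.
split.
  apply: (le_trans (F_le _ a2)); apply: Ha.
  - exact: bounded_continuous01_ramp.
  - by move=> x _; exact: ramp_itv.
  - by move=> x /andP[ax _]; rewrite ramp_eq0//; lra.
apply: F_ge => h h0.
have rb := bounded_continuous01_ramp (1 - a / 4) h0.
have : L (fun x => 1 * 1 + (-1) * ramp (1 - a / 4) h x) <= e.
  apply: Ha; first exact: bounded_continuous01_lin.
    by move=> x _; have /andP[? ?] := ramp_itv (1 - a / 4) h x; apply/andP; split; lra.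
  by move=> x /andP[_ xa]; rewrite ramp_eq1//; [ring|lra].
by rewrite (Llin 1 (-1) (fun=> 1))// L1; lra.
Qed.

Let F_le0 t : t <= 0 -> F t = 0.
Proof.
move=> t0; have /andP[F0 _] := F_itv t; apply/eqP; rewrite eq_le F0 andbT.
apply/ler_addgt0Pl => e e0; rewrite addr0.
have [a /andP[a0 _] [Fa _]] := F_tight e0.
by apply: le_trans Fa; apply: F_nd; lra.
Qed.

Let F_ge1 t : 1 <= t -> F t = 1.
Proof.
move=> t1; have /andP[_ F1] := F_itv t; apply/eqP; rewrite eq_le F1 /=.
apply/ler_addgt0Pl => e e0.
have [a /andP[a0 _] [_ Fa]] := F_tight e0.
have : F (1 - a) <= F t by apply: F_nd; lra.
lra.
Qed.

#[local] HB.instance Definition _ := isCumulative.Build R _ R F F_nd F_rc.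

Let F_Ny : F @ -oo --> (0 : R).
Proof.
apply: cvg_near_cst; near=> t; apply: F_le0; near: t.
exact: nbhs_ninfty_le.
Unshelve. all: by end_near. Qed.

Let F_y : F @ +oo --> (1 : R).
Proof.
apply: cvg_near_cst; near=> t; apply: F_ge1; near: t.
exact: nbhs_pinfty_ge.
Unshelve. all: by end_near. Qed.

#[local] HB.instance Definition _ := isCumulativeBounded.Build R 0 1 F F_Ny F_y.

Let mu : probability T R := lebesgue_stieltjes_measure F.

Let mu_ocitv a b : a <= b -> mu (`]a, b]%classic) = (F b - F a)%:E.
Proof.
move=> ab; rewrite /mu /= /lebesgue_stieltjes_measure /measure_extension/=.
by rewrite measurable_mu_extE/=; [rewrite wlength_itv_bnd|exact: is_ocitv].
Qed.

Let mu_carried : carried_by_01 mu.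
Proof.
rewrite /carried_by_01; apply/eqP; rewrite eq_le probability_le1//=.
apply/lee_addgt0Pr => e e0; have [a /andP[a0 a1] [_ Fa]] := F_tight e0.
have : mu (`]0, 1 - a]%classic) = (F (1 - a) - F 0)%:E by apply: mu_ocitv; lra.
rewrite (F_le0 (lexx 0)) subr0 => E.
pose B : set T := `]0, 1 - a]%classic.
apply: (@le_trans _ _ (mu B + e%:E)%E).
  by rewrite E -EFinD lee_fin; lra.
rewrite leeD2r//; apply: le_measure; rewrite ?inE; [exact: measurable_itv|exact: measurable_itv|].
by move=> x; rewrite /B /= !in_itv/= => /andP[x0 x1]; apply/andP; split; lra.
Qed.

Let mu_F t : 0 < t -> mu (`]-oo, t] `&` D) = (F t)%:E.
Proof.
move=> t0; have : mu (`]0, t]%classic) = (F t - F 0)%:E by apply: mu_ocitv; exact: ltW.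
rewrite (F_le0 (lexx 0)) subr0 => <-.
rewrite [RHS](carried_by_01_setI mu_carried); last exact: measurable_itv.
congr (mu _); apply/seteqP; split=> x /=; rewrite !in_itv/=.
  by move=> [xt /andP[x0 x1]]; rewrite x0 xt x1.
by move=> [/andP[x0 xt] /andP[_ x1]]; rewrite x0 xt x1.
Qed.

(** Uniqueness is included because it yields the invariance of the limit law, whose image under [P]
    represents the same functional. *)
Lemma riesz_representation : exists mu : probability T R,
  [/\ carried_by_01 mu,
      forall g, bounded_continuous01 g -> (\int[mu]_(x in D) (g x)%:E)%E = (L g)%:E &
      forall nu : probability T R, carried_by_01 nu ->
        (forall g, bounded_continuous01 g -> (\int[nu]_(x in D) (g x)%:E)%E = (L g)%:E) ->
        forall A, measurable A -> nu A = mu A].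
Proof.
exists mu; split.
- exact: mu_carried.
- move=> g gb.
  have fin : (\int[mu]_(x in D) (g x)%:E)%E \is a fin_num.
    by apply: integrable_fin_num; [exact: measurable_itv|exact: (bounded_continuous01_integrable mu_carried)].
  rewrite -(fineK fin); congr EFin.
  apply: (@functional_eq R F _ L (integral_positive_functional01 mu_carried) L_pos) => //.
  + by move=> t h t0 h0; have := integral_ramp_bounds mu_carried t h0;
      rewrite !mu_F ?lee_fin//; lra.
  + by move=> t h t0 h0; rewrite F_le// L_ramp_le.
- move=> nu nuc nuL A mA; apply/esym.
  apply: (lebesgue_stieltjes_measure_unique (f := F)) => // _ [[a b] _ <-] /=.
  have [ab|ba] := leP a b; last first.
    by rewrite set_itv_ge ?measure0// bnd_simp -leNgt ltW.
  have mND t : measurable (`]-oo, t] `&` D : set T).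
    by apply: measurableI; exact: measurable_itv.
  have Jramp t h : 0 < h -> \int[nu]_(x in D) ramp t h x = L (ramp t h).
    by move=> h0; rewrite /Rintegral nuL//; exact: bounded_continuous01_ramp.
  have nuF t : nu (`]-oo, t] `&` D) = (F t)%:E.
    apply/eqP; rewrite eq_le; apply/andP; split.
      have fin : nu (`]-oo, t] `&` D) \is a fin_num by exact: fin_num_measure.
      rewrite -(fineK fin) lee_fin; apply: F_ge => h h0.
      rewrite -lee_fin (fineK fin) -Jramp//.
      by have /andP[] := integral_ramp_bounds nuc t h0.
    (* A ramp lies above the indicator of []-oo, t]], so the lower bound [F t] is first obtained on
       slightly longer half-lines and then passes to the limit by continuity from above. *)
    pose G n : set T := `]-oo, (t + n.+1%:R^-1)%R] `&` D.
    have GE : \bigcap_n G n = `]-oo, t] `&` D.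
      rewrite (itvNycEbigcap false); apply/seteqP; split => x /=.
        move=> H; split; last by have [] := H 0%N I.
        by move=> n _; have [] := H n I.
      by move=> [H xD] n _; split => //; exact: H.
    have cv : nu (G n) @[n --> \oo] --> nu (\bigcap_n G n).
      apply: nonincreasing_cvg_mu.
      - by rewrite (le_lt_trans (probability_le1 _ _)) ?ltry//; exact: mND.
      - by move=> n; exact: mND.
      - by rewrite GE; exact: mND.
      - move=> m n mn; apply/subsetPset => x [] /=; rewrite !in_itv/= => xn xD; split => //.
        by apply: (le_trans xn); rewrite lerD2l lef_pV2 ?posrE// ler_nat.
    rewrite -GE -(cvg_lim _ cv)//; apply: lime_ge; first exact: cvgP cv.
    apply: nearW => n; have n0 : 0 < (n.+1%:R : R)^-1 by rewrite invr_gt0.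
    have /andP[_] := integral_ramp_bounds nuc t n0; apply: le_trans.
    by rewrite Jramp// lee_fin; exact: F_le.
  rewrite [LHS](mu_ocitv ab) (carried_by_01_setI nuc); last exact: measurable_itv.
  have -> : `]a, b] `&` D = (`]-oo, b] `&` D) `\` (`]-oo, a] `&` D) :> set T.
    apply/seteqP; split => x /=; rewrite !in_itv/=.
      by move=> [/andP[ax xb] xD]; split => // -[xa _]; move: ax; rewrite ltNge xa.
    move=> [[xb xD] H]; split => //; rewrite xb andbT ltNge; apply/negP => xa.
    by apply: H.
  rewrite measureD//; last by rewrite (le_lt_trans (probability_le1 _ _)) ?ltry//; exact: mND.
  have -> : (`]-oo, b] `&` D) `&` (`]-oo, a] `&` D) = `]-oo, a] `&` D :> set T.
    by apply/setIidPr => x /=; rewrite !in_itv/= => -[xa xD]; split=> //; exact: le_trans ab.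
  by rewrite EFinB; congr (_ - _)%E; exact/esym/nuF.
Qed.

End riesz.

(** * Asymptotic stability *)

Section stability.
Context (R : realType) (x0 y0 : R) (p0 p1 : R -> R).
Local Notation T := (measurableTypeR R).
Local Notation D := (`]0%R, 1%R[%classic : set T).
Local Notation f0 := (map0 x0 y0).
Local Notation f1 := (map1 x0 y0).
Local Notation P := (markov_operator x0 y0 p0 p1).
Local Notation U n h := (iter n (transfer f0 f1 p0 p1) h).

Hypothesis p0_cont : forall x, 0 < x < 1 -> {for x, continuous p0}.
Hypothesis p1_cont : forall x, 0 < x < 1 -> {for x, continuous p1}.
Hypothesis p0_ge0 : forall x, 0 < x < 1 -> 0 <= p0 x.
Hypothesis p1_ge0 : forall x, 0 < x < 1 -> 0 <= p1 x.
Hypothesis p_sum : forall x, 0 < x < 1 -> p0 x + p1 x = 1.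
Hypothesis f0_cont : continuous f0.
Hypothesis f1_cont : continuous f1.
Hypothesis f0I : forall x, 0 < x < 1 -> 0 < f0 x < 1.
Hypothesis f1I : forall x, 0 < x < 1 -> 0 < f1 x < 1.
Hypothesis U_cvg : forall g, bounded_continuous01 g -> exists l : R,
  forall x, 0 < x < 1 -> U n g x @[n --> \oo] --> l.
Hypothesis U_tight : forall e : R, 0 < e -> exists2 a : R, 0 < a < 2^-1 &
  forall g, bounded_continuous01 g -> (forall x, 0 < x < 1 -> 0 <= g x <= 1) ->
    (forall x, a <= x <= 1 - a -> g x = 0) -> forall n, U n g 2^-1 <= e.

Let mD : measurable D. Proof. exact: measurable_itv. Qed.

Let hI : 0 < (2^-1 : R) < 1. Proof. by apply/andP; split; lra. Qed.

Let mp0 : measurable_fun D p0.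
Proof.
apply: open_continuous_measurable_fun; first exact: itv_open.
by move=> x; rewrite inE/= in_itv/=; exact: p0_cont.
Qed.

Let mp1 : measurable_fun D p1.
Proof.
apply: open_continuous_measurable_fun; first exact: itv_open.
by move=> x; rewrite inE/= in_itv/=; exact: p1_cont.
Qed.

Lemma bounded_continuous01_iter_transfer n g : bounded_continuous01 g ->
  bounded_continuous01 (U n g).
Proof.
move=> gb; have [_ [M gM]] := gb; split; last first.
  by exists M; exact: iter_transfer_bounded.
elim: n => [|n IH] x xI; first by have [gc _] := gb; exact: gc.
apply: cvgD; apply: cvgM; [exact: p0_cont| |exact: p1_cont|].
  by apply: (continuous_comp (f := f0)); [exact: f0_cont|exact/IH/f0I].
by apply: (continuous_comp (f := f1)); [exact: f1_cont|exact/IH/f1I].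
Qed.

(** The base point [2^-1] is arbitrary: by [U_cvg] the limit is the same at all points. *)
Let L (g : R -> R) : R := limn (fun n => U n g 2^-1).

Let L_cvg g x : bounded_continuous01 g -> 0 < x < 1 -> U n g x @[n --> \oo] --> L g.
Proof.
move=> gb xI; have [l Hl] := U_cvg gb.
by rewrite /L (cvg_lim _ (Hl _ hI))//; exact: Hl.
Qed.

Let L_eq g l : U n g 2^-1 @[n --> \oo] --> l -> L g = l.
Proof. by move=> H; rewrite /L (cvg_lim _ H). Qed.

Let L_pos : positive_functional01 L.
Proof.
split.
- move=> a b f g fb gb; apply: L_eq.
  under eq_cvg do rewrite (@iter_transfer_lin R f0 f1 p0 p1 f0I f1I) //.
  by apply: cvgD; apply: cvgM; try exact: cvg_cst; exact: L_cvg.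
- move=> f g fb gb fg; apply: (ler_lim (cvgP _ (L_cvg fb hI)) (cvgP _ (L_cvg gb hI))).
  by apply: nearW => n; exact: iter_transfer_le.
- apply: L_eq; under eq_cvg do rewrite (@iter_transfer_cst R f0 f1 p0 p1 f0I f1I p_sum)//.
  exact: cvg_cst.
Qed.

Let L_tight e : 0 < e -> exists2 a : R, 0 < a < 2^-1 &
  forall g, bounded_continuous01 g -> (forall x, 0 < x < 1 -> 0 <= g x <= 1) ->
    (forall x, a <= x <= 1 - a -> g x = 0) -> L g <= e.
Proof.
move=> /U_tight[a aI Ha]; exists a => // g gb g01 g0.
apply: limr_le; first exact: cvgP (L_cvg gb hI).
by apply: nearW => n; exact: Ha.
Qed.

Let L_transfer g : bounded_continuous01 g -> L (U 1 g) = L g.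
Proof.
move=> gb; apply: L_eq.
rewrite (_ : (fun n => _) = (fun n => U n.+1 g 2^-1)); last first.
  by apply/funext => n; rewrite [U n.+1 g]iterSr.
by rewrite (cvg_shiftS (fun n => U n g 2^-1)); exact: L_cvg.
Qed.

Let mf (f : R -> R) : continuous f -> measurable_fun [set: T] (f : T -> T).
Proof. by move=> fc; exact: continuous_measurable_fun. Qed.

Lemma integral_iter_markov_operator n (nu : probability T R) : carried_by_01 nu ->
  exists nu' : probability T R,
  [/\ carried_by_01 nu', (nu' : set T -> \bar R) = iter n P nu &
      forall g, bounded_continuous01 g ->
        (\int[nu']_(x in D) (g x)%:E = \int[nu]_(x in D) (U n g x)%:E)%E].
Proof.
move=> nu1.
have [nu' [nu'1 nuE nuU]] :=
  iter_markov_operator mp0 mp1 p0_ge0 p1_ge0 p_sum (mf f0_cont) (mf f1_cont) f0I f1I n nu1.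
exists nu'; split => // g gb; have [_ [M gM]] := gb.
have [lin' _ one'] := integral_positive_functional01 nu'1.
have [lin _ one] := integral_positive_functional01 nu1.
have c1 := @bounded_continuous01_cst R 1.
have Ub := bounded_continuous01_iter_transfer n gb.
have fin' := integrable_fin_num mD (bounded_continuous01_integrable nu'1 gb).
have fin := integrable_fin_num mD (bounded_continuous01_integrable nu1 Ub).
rewrite -(fineK fin') -(fineK fin); congr EFin.
(* The duality is known for nonnegative functions, and [g + M] is one. *)
have hb := bounded_continuous01_lin 1 M gb c1.
have hg x : 0 < x < 1 -> 0 <= 1 * g x + M * 1.
  by move=> /gM; rewrite ler_norml => /andP[? _]; lra.
have := congr1 fine (nuU _ (bounded_continuous01_measurable hb) hg).
rewrite -!/(Rintegral _ _ _) => H.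
have {}H : \int[nu']_(x in D) (1 * g x + M * 1) = \int[nu]_(x in D) (1 * U n g x + M * 1).
  rewrite H.
  apply: eq_Rintegral => x; rewrite inE/= in_itv/= => xI.
  have := @iter_transfer_lin R f0 f1 p0 p1 f0I f1I n 1 M g (fun=> 1) x xI.
  by rewrite (@iter_transfer_cst R f0 f1 p0 p1 f0I f1I p_sum n 1 x xI).
move: H; rewrite lin'// lin//; rewrite one' one /Rintegral; lra.
Qed.

Lemma asymptotic_stability : asymptotically_stable P.
Proof.
have [mu [mu1 muL mu_unique]] := riesz_representation L_pos L_tight.
exists mu; split => //.
- move=> A mA; have [nu [nu1 nuE nuU]] := integral_iter_markov_operator 1 mu1.
  (* [P mu] integrates [g] to [L (U 1 g) = L g], so it represents [L] just as [mu] does. *)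
  rewrite -[P mu]/(iter 1 P mu) -nuE; apply: mu_unique => // g gb.
  by rewrite nuU// muL ?L_transfer//; exact: bounded_continuous01_iter_transfer.
- move=> nu nu1 g gc [M gM].
  have gb : bounded_continuous01 g.
    split; last by exists M.
    move=> x xI; move: gc; rewrite continuous_open_subspace; last exact: itv_open.
    by apply; rewrite inE/= in_itv.
  have E n : (\int[iter n P nu]_(x in D) (g x)%:E = \int[nu]_(x in D) (U n g x)%:E)%E.
    by have [nu' [_ nuE nuU]] := integral_iter_markov_operator n nu1; rewrite -nuE nuU.
  rewrite (_ : (fun n => _) = fun n => (\int[nu]_(x in D) (U n g x)%:E)%E); last exact/funext.
  rewrite muL//.
  have mU n : measurable_fun D (EFin \o U n g).
    apply/measurable_EFinP; apply: bounded_continuous01_measurable.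
    exact: bounded_continuous01_iter_transfer.
  have Mint : nu.-integrable D (cst M%:E).
    exact: (bounded_continuous01_integrable nu1 (bounded_continuous01_cst M)).
  (* The pointwise limit is the constant [L g], so for every initial law the limit is [L g] times
     the total mass. *)
  have [||_ _] := @dominated_convergence _ T R nu D mD
    (fun n => EFin \o U n g) (cst (L g)%:E) (cst M%:E) mU (measurable_cst _) _ Mint.
  - apply: aeW => x /=; rewrite in_itv/= => xI.
    by apply: cvg_EFin; [exact: nearW|exact: L_cvg].
  - apply: aeW => x n /=; rewrite in_itv/= => xI; rewrite lee_fin.
    exact: (iter_transfer_bounded f0I f1I p0_ge0 p1_ge0 p_sum).
  by rewrite integral_cst// [X in (_ * X)%E]nu1 mule1.
Qed.

End stability.

Theorem theorem2 (R : realType) (x0 y0 : R) (p0 p1 : R -> R)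
  (p_pos : forall x : R, 0 <= x <= 1 -> 0 < p0 x /\ 0 < p1 x)
  (p_sum : forall x : R, 0 <= x <= 1 -> p0 x + p1 x = 1)
  (A1 : 2^-1 < x0 < 1 /\ 2^-1 <= y0 < x0)
  (A2 : dini p0 p1)
  (A3 : forall x : R, 0 <= x <= 1 -> 0 < p0 x < 1 /\ 0 < p1 x < 1)
  (A4 : 0 < lyapunov0 x0 y0 p0 p1 /\ 0 < lyapunov1 x0 y0 p0 p1) :
  asymptotically_stable (markov_operator x0 y0 p0 p1).
Proof.
have [x0I y0I] := A1; have [L0 L1] := A4.
have I01 (x : R) : 0 < x < 1 -> 0 <= x <= 1 by move=> /andP[? ?]; apply/andP; split; lra.
have [delta d0 pd] := dini_lower_bound A2 p_pos.
have p0_ge x (xI : 0 < x < 1) : delta <= p0 x := (pd x (I01 x xI)).1.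
have p1_ge x (xI : 0 < x < 1) : delta <= p1 x := (pd x (I01 x xI)).2.
have p0_ge0 x (xI : 0 < x < 1) : 0 <= p0 x := le_trans (ltW d0) (p0_ge x xI).
have p1_ge0 x (xI : 0 < x < 1) : 0 <= p1 x := le_trans (ltW d0) (p1_ge x xI).
have psum x (xI : 0 < x < 1) : p0 x + p1 x = 1 := p_sum x (I01 x xI).
have f0I x := @map0_01 R x0 y0 x0I y0I x.
have f1I x := @map1_01 R x0 y0 x0I y0I x.
have lim0 (e : R) : 0 < e ->
    exists2 z : R, 0 < z & forall x, 0 < x < 1 -> x < z -> `|p0 x - p0 0| <= e.
  move=> /(dini_uniform A2) [d d00 Hd]; exists d => // x xI xd.
  have I0 : 0 <= (0 : R) <= 1 by rewrite lexx ler01.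
  have /andP[x_gt0 _] := xI.
  have x0' : `|x - 0| < d by rewrite subr0 gtr0_norm.
  by have [] := Hd x 0 (I01 x xI) I0 x0'.
have lim1 (e : R) : 0 < e ->
    exists2 z : R, 0 < z & forall x, 0 < x < 1 -> 1 - x < z -> `|p0 x - p0 1| <= e.
  move=> /(dini_uniform A2) [d d00 Hd]; exists d => // x xI xd.
  have I1 : 0 <= (1 : R) <= 1 by rewrite lexx ler01.
  have /andP[_ x_lt1] := xI.
  have x1 : `|x - 1| < d by rewrite distrC gtr0_norm// subr_gt0.
  by have [] := Hd x 1 (I01 x xI) I1 x1.
have [V [w [k [r [C [[k01 r01 C0 V1 w1] [drift contract proper bounded]]]]]]] :=
  lyapunov_exists x0I y0I d0 p0_ge p1_ge p_sum (fun x xI => (p_pos x xI).1)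
    (fun x xI => (p_pos x xI).2) lim0 lim1 L0 L1.
have [b [S [b0 bS bosc]]] := dini_coefficients A2 k01.
have [xs xsI merge] := map10_merging x0I y0I.
have [a00 _ _ _ _] := slopes x0I y0I.
have hI : 0 < (2^-1 : R) < 1 by rewrite invr_gt0 invf_lt1// ltr0n ltr1n.
apply: asymptotic_stability => //.
- by move=> x /(dini_continuous A2)[].
- by move=> x /(dini_continuous A2)[].
- exact: lipschitz_continuous_at (map0_dist x0I y0I).
- exact: lipschitz_continuous_at (map1_dist x0I y0I).
- move=> g [gc [M gM]].
  apply: (iter_transfer_cvg f0I f1I p0_ge0 p1_ge0 psum k01 C0 V1 drift w1 r01 contract
    b0 _ bS proper gc gM d0 p0_ge p1_ge a00 (map0_confine x0I y0I) (map1_confine x0I y0I)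
    xsI merge bounded).
  by move=> n x y xI yI xy; have [] := bosc n x y xI (I01 y yI) xy.
- move=> e e0.
  (* Bounds the mean of [V] at all times from [2^-1]. A function at most [1] that vanishes where
     [V <= Q / e] lies below [e / Q * V], hence has mean at most [e]. *)
  pose Q := V 2^-1 + C / (1 - k).
  have Q0 : 0 < Q.
    have /andP[_ k1] := k01; have := V1 _ hI.
    by have : 0 <= C / (1 - k) by [rewrite divr_ge0// subr_ge0 ltW]; rewrite /Q; lra.
  have Qe : 0 < Q / e by exact: divr_gt0.
  have [a a0 Ha] := proper (Q / e).
  (* The minimum with [1/4] secures the required bound by [1/2]. *)
  exists (Num.min a 4^-1).
    by rewrite lt_min a0 invr_gt0 ltr0n/= gt_min ltf_pV2 ?posrE ?ltr0n// ltr_nat orbT.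
  move=> g gb g01 g0 n.
  have gV x : 0 < x < 1 -> g x <= e / Q * V x + 0.
    move=> xI; rewrite addr0; have Vx := V1 x xI; have /andP[g00 g1] := g01 x xI.
    have eQ : 0 < e / Q by exact: divr_gt0.
    have [VQ|VQ] := leP (V x) (Q / e).
      have /andP[ax xa] := Ha x xI VQ.
      have mina : Num.min a 4^-1 <= a by rewrite ge_min lexx.
      rewrite g0; first by rewrite mulr_ge0 ?(ltW eQ)// (le_trans ler01).
      by rewrite (le_trans mina ax) (le_trans xa)// lerD2l lerN2.
    apply: (le_trans g1); rewrite -(@divff _ (e / Q)) ?gt_eqF//.
    by rewrite ler_pM2l// invf_div ltW.
  apply: (le_trans (iter_transfer_le f0I f1I p0_ge0 p1_ge0 n gV hI)).
  rewrite (@iter_transfer_affine _ _ _ _ _ f0I f1I psum)// addr0.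
  rewrite -ler_pdivlMl ?divr_gt0// invf_div divfK ?gt_eqF//.
  exact: (iter_transfer_lyapunov_le f0I f1I p0_ge0 p1_ge0 psum k01 C0 V1 drift).
Qed.
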